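(* Let $\tilde X$ be an $n\times n$ periodic block band matrix with atom variable $\xi$ and bandwidth $b_n$, let $c_n=3b_n$, $X=\tilde X/\sqrt{c_n}$, $X_z=X-zI$ for a fixed $z\in\mathbb{C}$, and take $A>1$. Let $m_{n,z}(\zeta)=\frac1n\sum_{i=1}^n[\lambda_i(X_zX_z^* )-\zeta]^{-1}$. Suppose $\mathbb{E}\xi=0$, $\mathbb{E}|\xi|^2=1$, and $\omega_{4p}:=\mathbb{E}|\xi|^{4p}<\infty$ for some integer $p\ge1$. Then there exists a non-random probability measure $\nu_z$ on $[0,\infty)$ such that for every $\zeta\in\{\zeta\in\mathbb{C}:-A<\Re\zeta<A,\ 0<\Im\zeta<1\}$, $$\mathbb{E}\big[|m_{n,z}(\zeta)-m_z(\zeta)|^{2p}\big]\le\frac{C(p)A^p\omega_{4p}}{|\Im\zeta|^{8p}}\left[\left(\frac{n}{c_n^2}\right)^p+\frac{1}{c_n^{p/2}}\right],$$ where $m_z(\zeta)=\int_{\mathbb{R}}\frac{d\nu_z(x)}{x-\zeta}$ and $C(p)>0$ depends only on $p$. Moreover, $m_z(\zeta)$ is the unique solution of $$m_z(\zeta)=\left[\frac{|z|^2}{1+m_z(\zeta)}-(1+m_z(\zeta))\zeta\right]^{-1}$$ satisfying $\Im(\zeta m_z(\zeta^2))>0$ and $\Im(m_z(\zeta))>0$ when $\Im\zeta>0$.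
   Context: Periodic block band matrix: $b_n$ divides $n$, $m:=n/b_n$; $\tilde D_i,\tilde U_i,\tilde T_i$ ($i\in[m]$) are $3m$ independent $b_n\times b_n$ random matrices with iid entries distributed as $\xi$ (a complex random variable); $\tilde X$ is the $m\times m$ block matrix (blocks $b_n\times b_n$, block indices modulo $m$) with $(i,i)$ block $\tilde D_i$, $(i,i-1)$ block $\tilde T_{i-1}$, $(i,i+1)$ block $\tilde U_{i+1}$, other blocks zero. $\lambda_i(X_zX_z^* )$ are the eigenvalues of the Hermitian matrix $X_zX_z^*$. *)

(* Defs.v *)
From HB Require Import structures.
From mathcomp Require Import all_boot all_order all_algebra.
From mathcomp Require Import all_classical all_reals all_analysis.
From mathcomp Require Import complex.
Import Order.TTheory GRing.Theory Num.Theory.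

Set Implicit Arguments.
Unset Strict Implicit.
Unset Printing Implicit Defensive.

Local Open Scope ring_scope.
Local Open Scope classical_set_scope.

(* Index of one random entry: (kind, block index i in [m], row, column).
   kind 0 = D_i, kind 1 = U_i, kind 2 = T_i  (all b x b). *)
Definition entry_idx (m b : nat) := ('I_3 * 'I_m * 'I_b * 'I_b)%type.

Definition ord_of (k : nat) (K : nat) : option 'I_K := insub k.

(* Entry (r, c) of the block matrix of kind [k] and index [I] (nat indices);
   0 if out of range (never happens in use). *)
Definition blk_entry {C : nzRingType} (m b : nat)
    (g : entry_idx m b -> C) (k : 'I_3) (I r c : nat) : C :=
  match ord_of I m, ord_of r b, ord_of c b with
  | Some I', Some r', Some c' => g (k, I', r', c')
  | _, _, _ => 0
  end.

(* The n x n periodic block band matrix with bandwidth b (b | n), m = n / b: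
   block (I, I) is D_I, block (I, I-1) is T_{I-1}, block (I, I+1) is U_{I+1},
   block indices modulo m, all other blocks zero.  (When m < 3 some of these
   block positions coincide; the contributions are then added.) *)
Definition pbb_matrix {C : nzRingType} (n b : nat)
    (g : entry_idx (n %/ b) b -> C) : 'M[C]_n :=
  let m := (n %/ b)%N in
  \matrix_(i, j)
    (let I := (i %/ b)%N in let J := (j %/ b)%N in
     let r := (i %% b)%N in let c := (j %% b)%N in
       ((J == I)%:R * blk_entry g 0 I r c
      + (J == (I + m - 1) %% m)%N%:R * blk_entry g 2 ((I + m - 1) %% m) r c
      + (J == (I + 1) %% m)%N%:R * blk_entry g 1 ((I + 1) %% m) r c)).

Definition cplx_of {R : rcfType} (q : R * R) : R[i] := (q.1 +i* q.2)%C.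

Definition adjmx {R : rcfType} {m n : nat} (A : 'M[R[i]]_(m, n)) : 'M[R[i]]_(n, m) :=
  (map_mx conjc A)^T.

(* The eigenvalues (with multiplicity) of a square complex matrix: the roots
   of its (monic) characteristic polynomial, which splits over R[i]. *)
Definition eigenvalues {R : rcfType} {n : nat} (A : 'M[R[i]]_n) : seq R[i] :=
  sval (closed_field_poly_normal (char_poly A)).

Definition Xz_matrix {R : rcfType} (n b : nat)
    (g : entry_idx (n %/ b) b -> R[i]) (z : R[i]) : 'M[R[i]]_n :=
  ((Num.sqrt ((3 * b)%N%:R : R))^-1)%:C%C *: pbb_matrix g - z%:M.

Definition esd_stieltjes {R : rcfType} (n b : nat)
    (g : entry_idx (n %/ b) b -> R[i]) (z zeta : R[i]) : R[i] :=
  let Xz := Xz_matrix g z in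
  (n%:R)^-1 * \sum_(l <- eigenvalues (Xz *m adjmx Xz)) (l - zeta)^-1.

(* Stieltjes transform  int dnu(x) / (x - w)  of a probability measure on R,
   written through its real and imaginary parts:
   1/(x - w) = ((x - Re w) + i Im w) / ((x - Re w)^2 + (Im w)^2). *)
Definition stieltjes {R : realType} (nu : probability R R) (w : R[i]) : R[i] :=
  let a := complex.Re w in let t := complex.Im w in
  ((fine (\int[nu]_x ((x - a) / ((x - a) ^+ 2 + t ^+ 2))%:E))
   +i* (fine (\int[nu]_x (t / ((x - a) ^+ 2 + t ^+ 2))%:E)))%C.

Definition mz_relations {R : rcfType} (z : R[i]) (f : R[i] -> R[i]) (zeta : R[i]) : Prop :=
  [/\ f zeta = ((Normc.normc z ^+ 2)%:C%C / (1 + f zeta) - (1 + f zeta) * zeta)^-1,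
      0 < complex.Im (zeta * f (zeta ^+ 2)) & 0 < complex.Im (f zeta)].

(* Mutual independence of a finite family of random variables: the joint law
   is the product of the marginals (taking B k = setT recovers every
   finite subfamily). *)
Definition mutually_independent {d} {T : measurableType d} {R : realType}
    (P : probability T R) {I : finType} {d'} {V : measurableType d'}
    (Y : I -> T -> V) : Prop :=
  forall B : I -> set V, (forall k, measurable (B k)) ->
    P (\bigcap_k (Y k @^-1` B k)) = (\prod_k P (Y k @^-1` B k))%E.

Definition same_law {d} {T : measurableType d} {R : realType}
    (P : probability T R) {d'} {V : measurableType d'} (Y Z : T -> V) : Prop :=
  forall B : set V, measurable B -> P (Y @^-1` B) = P (Z @^-1` B).

(* Main.v *)
(** Let H be the Hermitization of X_z and G = (H - s)^-1 its resolvent at a square root s of zeta, so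
    that the upper left block of G is s (X_z X_z^* - zeta)^-1 and m_n = tr(that block) / (n s).
    Expanding G to second order in a single entry of X (instead of using Schur complements) shows
    that the expected normalised traces a, beta of the diagonal and off-diagonal blocks satisfy, up
    to small defects, the pair of loop equations whose elimination is a = Phi(s + a) with
    Phi(u) = u / (|z|^2 - u^2); this is the equation of s m_z(s^2).  The products of block traces
    which occur there decouple because block-shift invariance makes all block traces have the same
    mean, and because they concentrate: each column of X changes a partial trace of G by at most
    2 / Im s, so martingale exponential bounds apply.  The fixed point equation is stable because
    |Phi(u) - Phi(w)|^2 <= N(u) N(w) |u - w|^2 for N(u) = Im Phi(u) / Im u, and N < 1 at the exact
    solution; this bounds E m_n - m_z, and the bounded-difference estimate bounds the 2p-th moment
    of m_n - E m_n.

    The measure nu_z is a weak limit of the discrete measures attached to the iterates of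
    a -> Phi(s + a): these iterates are entries of resolvents of arrow-shaped Hermitian matrices,
    hence Stieltjes transforms by the spectral theorem, and nu_z is the law of the square. *)

Require Import Defs.
From HB Require Import structures.
From mathcomp Require Import all_boot all_order all_algebra.
From mathcomp Require Import all_classical all_reals all_analysis measurable_realfun.
From mathcomp Require Import complex ring lra.
From mathcomp Require Import spectral sesquilinear.
Import Order.TTheory GRing.Theory Num.Theory.
Import numFieldNormedType.Exports.
Set Implicit Arguments.
Unset Strict Implicit.
Unset Printing Implicit Defensive.
Local Open Scope classical_set_scope.
Local Open Scope ring_scope.

(** * Stability of the fixed point equation *)

Local Notation nc := Normc.normc.
Local Notation Rec := complex.Re.
Local Notation Imc := complex.Im.

(** The stability bound assumes nothing about the size of the defects: when they are too large for
    contraction they exceed [Imc s], and crude bounds suffice. The defect of order w h^4 / c, with h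
    = 1 / Im s and w the fourth moment of the atom, would enter squared, with a power of w that the
    claim does not allow. Since |a - g| min(1, Im s) <= 2 a priori, the square is at most twice the
    quantity itself, and w h^4 / c can be traded for w h^2 / sqrt c: this is the origin of c^(-p/2).
    The term n / c^2 comes from decoupling: a block trace reacts to all n columns, so its variance
    is of order n h^2, against products of block traces of size b^2. Jensen's inequality turns w^p
    into omega_{4p}. As E xi^2 is arbitrary, the part of the expansion containing x^2 is never
    evaluated; it carries two off-diagonal entries, whose squares sum to O(n) by the Ward identity.
    Everything is moved from the given probability space to the law of the configuration of all
    entries, where a single entry can be set to 0 or redrawn. *)

Lemma le_of_eq (R : numDomainType) (x y : R) : x = y -> x <= y.
Proof. by move=> ->. Qed.

Section Normc.
Variable R : rcfType.
Implicit Types x y : R[i].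

Lemma nc_ge0 x : 0 <= nc x. Proof. by case: x => a b; exact: sqrtr_ge0. Qed.
Lemma nc_sq x : nc x ^+ 2 = Rec x ^+ 2 + Imc x ^+ 2.
Proof. by case: x => a b; rewrite sqr_sqrtr // addr_ge0 ?sqr_ge0. Qed.
Lemma nc_re x : `|Rec x| <= nc x.
Proof. by rewrite -(@ler_pXn2r _ 2) ?nnegrE ?nc_ge0 // real_normK ?num_real // nc_sq; nra. Qed.
Lemma nc_im x : `|Imc x| <= nc x.
Proof. by rewrite -(@ler_pXn2r _ 2) ?nnegrE ?nc_ge0 // real_normK ?num_real // nc_sq; nra. Qed.
Lemma nc_reim x : nc x <= `|Rec x| + `|Imc x|.
Proof.
rewrite -(@ler_pXn2r _ 2) ?nnegrE ?nc_ge0 ?addr_ge0 //.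
rewrite nc_sq sqrrD !real_normK ?num_real //.
by have := mulr_ge0 (normr_ge0 (Rec x)) (normr_ge0 (Imc x)); lra.
Qed.
Lemma ncM x y : nc (x * y) = nc x * nc y. Proof. exact: Normc.normcM. Qed.
Lemma ncV x : nc x^-1 = (nc x)^-1. Proof. exact: Normc.normcV. Qed.
Lemma ncD x y : nc (x + y) <= nc x + nc y. Proof. exact: le_normcD. Qed.
Lemma ncN x : nc (- x) = nc x. Proof. exact: normcN. Qed.
Lemma ncB x y : nc (x - y) <= nc x + nc y. Proof. by rewrite -(ncN y) ncD. Qed.
Lemma ncBC x y : nc (x - y) = nc (y - x). Proof. by rewrite -ncN opprB. Qed.
Lemma nc0 : nc (0 : R[i]) = 0. Proof. exact: Normc.normc0. Qed.
Lemma nc1 : nc (1 : R[i]) = 1. Proof. exact: Normc.normc1. Qed.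
Lemma nc_real (a : R) : nc a%:C%C = `|a|.
Proof. by rewrite /= expr0n addr0 sqrtr_sqr. Qed.
Lemma nc_eq0 x : (nc x == 0) = (x == 0).
Proof. by apply/eqP/eqP => [/Normc.eq0_normc|-> //]; rewrite ?nc0. Qed.
Lemma nc_gt0 x : (0 < nc x) = (x != 0).
Proof. by rewrite lt_neqAle nc_ge0 andbT eq_sym nc_eq0. Qed.
Lemma ncX x n : nc (x ^+ n) = nc x ^+ n.
Proof. by elim: n => [|n IH]; rewrite ?expr0 ?nc1 // !exprS ncM IH. Qed.
Lemma nc_conj x : nc (conjc x) = nc x.
Proof. by case: x => a b /=; rewrite sqrrN. Qed.
Lemma cReD x y : Rec (x + y) = Rec x + Rec y. Proof. by case: x; case: y. Qed.
Lemma cImD x y : Imc (x + y) = Imc x + Imc y. Proof. by case: x; case: y. Qed.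
Lemma cReN x : Rec (- x) = - Rec x. Proof. by case: x. Qed.
Lemma cImN x : Imc (- x) = - Imc x. Proof. by case: x. Qed.
Lemma cReM x y : Rec (x * y) = Rec x * Rec y - Imc x * Imc y.
Proof. by case: x; case: y. Qed.
Lemma cImM x y : Imc (x * y) = Rec x * Imc y + Imc x * Rec y.
Proof. by case: x; case: y. Qed.
Lemma cImV x : Imc x^-1 = - Imc x / nc x ^+ 2.
Proof. by rewrite nc_sq; case: x => a b /=; rewrite mulNr. Qed.
Lemma cReV x : Rec x^-1 = Rec x / nc x ^+ 2.
Proof. by rewrite nc_sq; case: x => a b /=. Qed.
Lemma cReZ (a : R) x : Rec (a%:C%C * x) = a * Rec x.
Proof. by rewrite cReM /= mul0r subr0. Qed.
Lemma cImZ (a : R) x : Imc (a%:C%C * x) = a * Imc x.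
Proof. by rewrite cImM /= mul0r addr0. Qed.
Lemma Re_sum (I : Type) (r : seq I) (P : pred I) (F : I -> R[i]) :
  Rec (\sum_(i <- r | P i) F i) = \sum_(i <- r | P i) Rec (F i).
Proof. by elim/big_rec2: _ => // i x y _ <-; rewrite cReD. Qed.
Lemma Im_sum (I : Type) (r : seq I) (P : pred I) (F : I -> R[i]) :
  Imc (\sum_(i <- r | P i) F i) = \sum_(i <- r | P i) Imc (F i).
Proof. by elim/big_rec2: _ => // i x y _ <-; rewrite cImD. Qed.
Lemma nc_sum (I : Type) (r : seq I) (P : pred I) (F : I -> R[i]) :
  nc (\sum_(i <- r | P i) F i) <= \sum_(i <- r | P i) nc (F i).
Proof.
elim/big_rec2: _ => [|i x y _ h]; first by rewrite nc0.
by apply: (le_trans (ncD _ _)); rewrite lerD2l.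
Qed.
Lemma mulJ x : x * conjc x = (nc x ^+ 2)%:C%C.
Proof. by rewrite nc_sq; case: x => a b; apply/eqP; rewrite eq_complex /=; apply/andP; split; apply/eqP; ring. Qed.
Lemma complex_ext x y : Rec x = Rec y -> Imc x = Imc y -> x = y.
Proof. by case: x => ? ?; case: y => ? ? /= -> ->. Qed.
End Normc.

Section Stability.
Variable R : rcfType.
Implicit Types (s a g u w z e : R[i]) (r : R).

Lemma nc_inv_le u (t : R) : 0 < t -> t <= Imc u -> nc u^-1 <= t^-1.
Proof.
move=> t0 tu; have h : t <= nc u by rewrite (le_trans tu) // (le_trans (ler_norm _)) ?nc_im.
by rewrite ncV lef_pV2 // posrE ?(lt_le_trans t0 h).
Qed.

(* [nfun r u] is Im (Phi u) / Im u, where Phi u = u / (r^2 - u^2) is the right-hand side of the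
   self-consistent equation g = Phi (s + g). *)
Definition nfun r u : R := (nc (u - r%:C%C)^-1 ^+ 2 + nc (u + r%:C%C)^-1 ^+ 2) / 2.
(** Common upper bound for the moduli of Phi u and of r / (r^2 - u^2), the two factors that multiply
    the defects. *)
Definition mfun r u : R := (nc (u - r%:C%C)^-1 + nc (u + r%:C%C)^-1) / 2.

Lemma mfun_sq r u : mfun r u ^+ 2 <= nfun r u.
Proof.
rewrite /mfun /nfun; set p := nc _; set q := nc _.
have := sqr_ge0 (p - q); nra.
Qed.
Lemma mfun_ge0 r u : 0 <= mfun r u.
Proof. by rewrite divr_ge0 // addr_ge0 ?nc_ge0. Qed.

Lemma im_neq0 u : 0 < Imc u -> u != 0.
Proof. by move=> h; apply/eqP => u0; rewrite u0 ltxx in h. Qed.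

Lemma subr_neq r u : 0 < Imc u -> u - r%:C%C != 0.
Proof. by move=> h; apply: im_neq0; rewrite cImD cImN /= subr0. Qed.
Lemma addr_neq r u : 0 < Imc u -> u + r%:C%C != 0.
Proof. by move=> h; apply: im_neq0; rewrite cImD /= addr0. Qed.

Lemma den_fact r u : (r ^+ 2)%:C%C - u ^+ 2 = - ((u - r%:C%C) * (u + r%:C%C)).
Proof. by rewrite rmorphXn /=; ring. Qed.
Lemma den_neq0 r u : 0 < Imc u -> (r ^+ 2)%:C%C - u ^+ 2 != 0.
Proof. by move=> h; rewrite den_fact oppr_eq0 mulf_neq0 ?subr_neq ?addr_neq. Qed.

(** Partial fractions with the real poles r and -r: imaginary part and difference quotient of Phi
    can then be read off term by term. *)
Lemma phiE r u : 0 < Imc u ->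
  u / ((r ^+ 2)%:C%C - u ^+ 2) = - ((u - r%:C%C)^-1 + (u + r%:C%C)^-1) / 2%:R.
Proof.
move=> h; rewrite den_fact; field.
by rewrite subr_neq ?addr_neq.
Qed.
Lemma psiE r u : 0 < Imc u ->
  r%:C%C / ((r ^+ 2)%:C%C - u ^+ 2) = ((u + r%:C%C)^-1 - (u - r%:C%C)^-1) / 2%:R.
Proof.
move=> h; rewrite den_fact; field.
by rewrite subr_neq ?addr_neq.
Qed.
Lemma nc2 : nc (2%:R : R[i]) = 2.
Proof. have -> : 2%:R = (2%:R : R)%:C%C :> R[i] by rewrite rmorph_nat.
by rewrite nc_real normr_nat. Qed.

Lemma nc_phi r u : 0 < Imc u -> nc (u / ((r ^+ 2)%:C%C - u ^+ 2)) <= mfun r u.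
Proof.
move=> h; rewrite phiE // ncM ncN ncV nc2 ler_wpM2r // ?invr_ge0 //.
exact: ncD.
Qed.
Lemma nc_psi r u z : 0 < Imc u -> nc z = r -> nc (z / ((r ^+ 2)%:C%C - u ^+ 2)) <= mfun r u.
Proof.
move=> h zr; have -> : nc (z / ((r ^+ 2)%:C%C - u ^+ 2)) = nc (r%:C%C / ((r ^+ 2)%:C%C - u ^+ 2)).
  by rewrite !ncM nc_real -zr ger0_norm ?nc_ge0.
rewrite psiE // ncM ncV nc2 ler_wpM2r // ?invr_ge0 //.
by apply: (le_trans (ncB _ _)); rewrite addrC.
Qed.
Lemma im_phi r u : 0 < Imc u -> Imc (u / ((r ^+ 2)%:C%C - u ^+ 2)) = nfun r u * Imc u.
Proof.
move=> h; rewrite phiE //.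
have -> : (2%:R : R[i])^-1 = (2^-1 : R)%:C%C by rewrite fmorphV rmorph_nat.
rewrite mulrC cImZ cImN cImD !cImV !cImD cImN /= subr0 addr0 /nfun !ncV !exprVn.
by rewrite !mulNr; ring.
Qed.
Lemma phi_diff r u w : 0 < Imc u -> 0 < Imc w ->
  u / ((r ^+ 2)%:C%C - u ^+ 2) - w / ((r ^+ 2)%:C%C - w ^+ 2) =
  (u - w) * (((u - r%:C%C)^-1 * (w - r%:C%C)^-1 + (u + r%:C%C)^-1 * (w + r%:C%C)^-1) / 2%:R).
Proof.
move=> hu hw; rewrite !phiE //; field.
by rewrite !subr_neq ?addr_neq.
Qed.

(** Cauchy-Schwarz for the pairs of inverses at [u] and at [w]; the gap is the square in Lagrange's
    identity. The left side is the squared difference quotient from [phi_diff]. *)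
Lemma kappa_le r u w :
  nc (((u - r%:C%C)^-1 * (w - r%:C%C)^-1 + (u + r%:C%C)^-1 * (w + r%:C%C)^-1) / 2%:R) ^+ 2
  <= nfun r u * nfun r w.
Proof.
rewrite ncM ncV nc2 exprMn.
set p := (u - _)^-1; set p' := (w - _)^-1; set q := (u + _)^-1; set q' := (w + _)^-1.
have h : nc (p * p' + q * q') <= nc p * nc p' + nc q * nc q' by rewrite -!ncM ncD.
have h2 : nc (p * p' + q * q') ^+ 2 <= (nc p * nc p' + nc q * nc q') ^+ 2.
  by rewrite lerXn2r // nnegrE ?nc_ge0 // addr_ge0 // mulr_ge0 ?nc_ge0.
rewrite /nfun -/p -/q -/p' -/q'.
apply: (@le_trans _ _ ((nc p * nc p' + nc q * nc q') ^+ 2 * 2^-1 ^+ 2)).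
  by rewrite ler_wpM2r // sqr_ge0.
rewrite -subr_ge0.
have -> : (nc p ^+ 2 + nc q ^+ 2) / 2 * ((nc p' ^+ 2 + nc q' ^+ 2) / 2) - (nc p * nc p' + nc q * nc q') ^+ 2 * 2^-1 ^+ 2
  = (nc p * nc q' - nc q * nc p') ^+ 2 / 4 by field.
by rewrite divr_ge0 // sqr_ge0.
Qed.

Section Exact.
Variables (r : R) (s g : R[i]).
Hypothesis (s0 : 0 < Imc s) (g0 : 0 < Imc g).
Hypothesis gE : g = (s + g) / ((r ^+ 2)%:C%C - (s + g) ^+ 2).
Let w := s + g.
Let w0 : 0 < Imc w. Proof. by rewrite cImD addr_gt0. Qed.

(** The imaginary part of the equation. Since [Imc s] is positive, it forces [nfun r w] below 1, the
    source of the contraction. *)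
Lemma exact_nfun : nfun r w * (Imc s + Imc g) = Imc g.
Proof. by rewrite {2}gE im_phi -/w // /w cImD. Qed.
Lemma exact_nfun_lt1 : nfun r w < 1.
Proof.
rewrite -subr_gt0 -(pmulr_lgt0 _ (addr_gt0 s0 g0)) mulrBl exact_nfun mul1r.
by rewrite addrK.
Qed.
Lemma exact_nc_le1 : nc g <= 1.
Proof.
have h : nc g <= mfun r w by rewrite {1}gE nc_phi.
apply: (le_trans h); have := mfun_sq r w; have := exact_nfun_lt1; have := mfun_ge0 r w.
move: (mfun r w) (nfun r w) => M N M0 N1 MN; nra.
Qed.
Lemma exact_nc_leV : nc g <= (Imc s)^-1.
Proof.
have h : nc g <= mfun r w by rewrite {1}gE nc_phi.
apply: (le_trans h); rewrite /mfun.
have h1 : nc (w - r%:C%C)^-1 <= (Imc s)^-1.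
  by apply: nc_inv_le => //; rewrite cImD cImN /= subr0 cImD lerDl ltW.
have h2 : nc (w + r%:C%C)^-1 <= (Imc s)^-1.
  by apply: nc_inv_le => //; rewrite cImD /= addr0 cImD lerDl ltW.
lra.
Qed.
End Exact.

(** The residual [e] of the fixed point equation at [a] satisfies |e| <= E * [mfun r u]. If |e| <=
    Im s, its imaginary part gives N(u) <= 1 and the contraction argument works. Otherwise Im s <=
    E, and size bounds on [a] and [g] suffice. *)
Theorem stability r s a g e1 e2 z (E : R) :
  nc z = r -> 0 < Imc s -> 0 <= Imc a -> nc a <= (Imc s)^-1 ->
  a * ((r ^+ 2)%:C%C - (s + a) ^+ 2) = (s + a) + e1 * (s + a) - z * e2 ->
  0 < Imc g -> g = (s + g) / ((r ^+ 2)%:C%C - (s + g) ^+ 2) ->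
  nc e1 + nc e2 <= E ->
  nc (a - g) * Num.min 1 (Imc s) <= 4 * E.
Proof.
move=> zr s0 a0 als aE g0 gE eE.
have E0 : 0 <= E by rewrite (le_trans _ eE) // addr_ge0 ?nc_ge0.
set u := s + a in aE *; set w := s + g in gE *; set t := Imc s in s0 als *.
have u0 : 0 < Imc u by rewrite cImD ltr_wpDr.
have w0 : 0 < Imc w by rewrite cImD addr_gt0.
pose e := a - u / ((r ^+ 2)%:C%C - u ^+ 2).
have eE' : e = e1 * (u / ((r ^+ 2)%:C%C - u ^+ 2)) - z / ((r ^+ 2)%:C%C - u ^+ 2) * e2.
  have d0 := den_neq0 r u0.
  apply: (mulIf d0); rewrite /e mulrBl aE; field.
  by move: d0; rewrite rmorphXn.
have eM : nc e <= E * mfun r u.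
  rewrite eE' (le_trans (ncB _ _)) // !ncM.
  have := nc_phi r u0; have := nc_psi u0 zr; rewrite ncM.
  move: (mfun_ge0 r u) eE (nc_ge0 e1) (nc_ge0 e2); rewrite !ncM.
  set M := mfun r u; set x1 := nc z * _; set x2 := nc u * _ => M0 h h1 h2 h3 h4.
  nra.
have Nu : nfun r u * (t + Imc a) = Imc a - Imc e.
  by rewrite /e cImD cImN im_phi // opprD opprK addrA subrr add0r cImD.
have ime : - Imc e <= nc e by rewrite (le_trans _ (nc_im e)) // -normrN ler_norm.
have Nw := exact_nfun s0 g0 gE; rewrite -/w -/t in Nw.
have g1 := exact_nc_le1 s0 g0 gE.
have img : Imc g <= 1 by rewrite (le_trans (ler_norm _)) // (le_trans (nc_im _)).
have Msq := mfun_sq r u.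
have M0 := mfun_ge0 r u.
have N0 : 0 <= nfun r u by rewrite (le_trans _ Msq) // sqr_ge0.
have Nw0 : 0 <= nfun r w by rewrite (le_trans _ (mfun_sq r w)) // sqr_ge0.
have e0 := nc_ge0 e.
have [et|te] := leP (nc e) t.
  have N1 : nfun r u <= 1.
    rewrite -(ler_pM2r (_ : 0 < t + Imc a)); last by rewrite ltr_wpDr.
    by rewrite Nu; lra.
  have M1 : mfun r u <= 1 by nra.
  have eE2 : nc e <= E by nra.
  have diff : a - g = (u - w) * (((u - r%:C%C)^-1 * (w - r%:C%C)^-1 + (u + r%:C%C)^-1 * (w + r%:C%C)^-1) / 2%:R) + e.
    by rewrite -phi_diff // -gE /e; ring.
  have kk := kappa_le r u w.
  set k := nc _ in kk.
  have k0 : 0 <= k by exact: nc_ge0.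
  have d0 := nc_ge0 (a - g).
  have dk : nc (a - g) <= nc (a - g) * k + nc e.
    rewrite {1}diff (le_trans (ncD _ _)) // lerD2r ncM.
    by rewrite (_ : u - w = a - g) // /u /w; ring.
  have kN : k ^+ 2 <= nfun r w by nra.
  (* As Im g <= 1, the relation N(w) (t + Im g) = Im g gives N(w) <= 1 / (1 + t), a gap that does
     not depend on [a]. *)
  have Nw1 : nfun r w * (1 + t) <= 1 by nra.
  have k1 : k <= 1 by nra.
  have dd : nc (a - g) * t <= 2 * nc e * (1 + t).
    have h1 : nc (a - g) * (1 - k) <= nc e by lra.
    have h2 : t <= (1 - k ^+ 2) * (1 + t) by nra.
    have h3 : nc (a - g) * t <= nc (a - g) * ((1 - k ^+ 2) * (1 + t)) by rewrite ler_wpM2l.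
    have h4 : nc (a - g) * (1 - k ^+ 2) <= 2 * nc e.
      have -> : nc (a - g) * (1 - k ^+ 2) = nc (a - g) * (1 - k) * (1 + k) by ring.
      nra.
    nra.
  have mm : Num.min 1 t * (1 + t) <= 2 * t.
    by rewrite minEle; case: ifP => ht; nra.
  have m0 : 0 <= Num.min 1 t by rewrite le_min ler01 ltW.
  rewrite -(ler_pM2r (_ : 0 < 1 + t)); last lra.
  nra.
(* For N(u) >= 1 this is the identity [Nu]; for N(u) < 1 it follows from t < |e|. *)
have Ne : nfun r u * t <= nc e by nra.
have et2 : nc e * t <= E ^+ 2.
  have h : nc e ^+ 2 <= E ^+ 2 * nfun r u.
    apply: (@le_trans _ _ ((E * mfun r u) ^+ 2)).
      apply: lerXn2r => //; rewrite nnegrE. exact: mulr_ge0.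
    by rewrite exprMn; apply: ler_wpM2l => //; exact: sqr_ge0.
  have h2 : nc e * (nc e * t) <= nc e * E ^+ 2.
    have : E ^+ 2 * (nfun r u * t) <= E ^+ 2 * nc e by rewrite ler_wpM2l // sqr_ge0.
    nra.
  by rewrite -(ler_pM2l (lt_trans s0 te)).
have tE : t <= E by nra.
have dle : nc (a - g) <= nc a + 1 by rewrite (le_trans (ncB _ _)) // lerD2l.
(* For E >= 1 the bounds |a| <= 1 / t and |g| <= 1 are enough; otherwise t <= E < 1 and |a| t is
   estimated through [mfun]. *)
have [E1|E1] := leP 1 E.
  have h : nc (a - g) * Num.min 1 t <= (t^-1 + 1) * Num.min 1 t.
    apply: ler_wpM2r; first by rewrite le_min ler01 ltW.
    by apply: (le_trans dle); rewrite lerD2r.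
  apply: (le_trans h); rewrite mulrDl mul1r.
  have h1 : t^-1 * Num.min 1 t <= 1 by rewrite ler_pdivrMl // mulr1 ge_min lexx orbT.
  have h2 : Num.min 1 t <= 1 by rewrite ge_min lexx.
  lra.
have t1 : t <= 1 by lra.
rewrite min_r //.
have aM : nc a <= mfun r u + nc e.
  rewrite (_ : a = u / ((r ^+ 2)%:C%C - u ^+ 2) + e); last by rewrite /e; ring.
  by rewrite (le_trans (ncD _ _)) // lerD2r nc_phi.
have Mt : mfun r u * t <= E.
  have h : (mfun r u * t) ^+ 2 <= E ^+ 2 by rewrite exprMn; nra.
  have h0 : 0 <= mfun r u * t by rewrite mulr_ge0 // ltW.
  by move: h h0; move: (mfun r u * t) => v; nra.
have et3 : nc e * t <= E by nra.
nra.
Qed.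

(** An exact solution is an approximate one with zero defects, so [stability] applies with E = 0. *)
Lemma exact_unique r s g1 g2 : 0 <= r -> 0 < Imc s -> 0 < Imc g1 -> 0 < Imc g2 ->
  g1 = (s + g1) / ((r ^+ 2)%:C%C - (s + g1) ^+ 2) ->
  g2 = (s + g2) / ((r ^+ 2)%:C%C - (s + g2) ^+ 2) -> g1 = g2.
Proof.
move=> r0 s0 g10 g20 E1 E2.
have := @stability r s g1 g2 0 0 r%:C%C 0 _ s0 (ltW g10) (exact_nc_leV s0 g10 E1) _ g20 E2 _.
rewrite nc_real ger0_norm // nc0 addr0 (mulr0 (4 : R)).
move=> /(_ erefl) h.
have {}h : nc (g1 - g2) * Num.min 1 (Imc s) <= 0.
  apply: h => //; rewrite mul0r ?mulr0 addr0 subr0 {1}E1 divfK // den_neq0 // cImD addr_gt0 //.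
have m0 : 0 < Num.min 1 (Imc s) by rewrite lt_min ltr01.
have : nc (g1 - g2) <= 0 by rewrite -(pmulr_lle0 _ m0).
by move=> h2; apply/eqP; rewrite -subr_eq0 -nc_eq0 eq_le h2 nc_ge0.
Qed.

End Stability.

(** * Numerical inequalities *)

Section Numeric.
Variable R : realFieldType.

(** The tangent of x^(k+1) at w lies below the graph; integrated, this is Jensen's inequality for
    the moments of the atom. *)
Lemma expr_tangent (x w : R) k : 0 <= x -> 0 <= w ->
  w ^+ k.+1 + k.+1%:R * w ^+ k * (x - w) <= x ^+ k.+1.
Proof.
move=> x0 w0; elim: k => [|k IH]; first by rewrite !expr1 expr0; lra.
rewrite [in leRHS]exprS; apply: (le_trans _ (ler_wpM2l x0 IH)).
have k0 : 0 <= (k.+1)%:R * w ^+ k * (x - w) ^+ 2 by apply: mulr_ge0 (sqr_ge0 _); rewrite mulr_ge0 ?ler0n ?exprn_ge0.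
rewrite -subr_ge0; apply: (le_trans k0); apply: le_of_eq.
rewrite [k.+2%:R]mulrSr [in w ^+ k.+2]exprS !(exprS w k).
by move: (k.+1%:R) (w ^+ k) => a b; ring.
Qed.

Lemma exprD2_le (x y : R) k : 0 <= x -> 0 <= y -> (x + y) ^+ k <= 2 ^+ k * (x ^+ k + y ^+ k).
Proof.
move=> x0 y0; have [xy|/ltW xy] := leP x y.
  apply: (@le_trans _ _ ((2 * y) ^+ k)).
    by rewrite lerXn2r ?nnegrE ?addr_ge0 ?mulr_ge0 //; lra.
  by rewrite exprMn ler_wpM2l ?exprn_ge0 // lerDr exprn_ge0.
apply: (@le_trans _ _ ((2 * x) ^+ k)).
  by rewrite lerXn2r ?nnegrE ?addr_ge0 ?mulr_ge0 //; lra.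
by rewrite exprMn ler_wpM2l ?exprn_ge0 // lerDl exprn_ge0.
Qed.

Lemma exprD3_le (x y w : R) k : 0 <= x -> 0 <= y -> 0 <= w ->
  (x + y + w) ^+ k <= 3 ^+ k * (x ^+ k + y ^+ k + w ^+ k).
Proof.
move=> x0 y0 w0; pose M := Num.max x (Num.max y w).
have xM : x <= M by rewrite le_max lexx.
have yM : y <= M by rewrite !le_max lexx orbT.
have wM : w <= M by rewrite !le_max lexx !orbT.
have M0 : 0 <= M by exact: le_trans x0 xM.
apply: (@le_trans _ _ ((3 * M) ^+ k)).
  rewrite lerXn2r ?nnegrE ?addr_ge0 ?mulr_ge0 //.
  by move: (M) xM yM wM => M' *; lra.
rewrite exprMn ler_wpM2l ?exprn_ge0 //.
have p0 := exprn_ge0 k x0; have p1 := exprn_ge0 k y0; have p2 := exprn_ge0 k w0.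
have : M = x \/ M = y \/ M = w.
  rewrite /M; case: (leP x (Num.max y w)) => _; last by left.
  by right; case: (leP y w) => _; [right | left].
by case=> [->|[->|->]]; move: p0 p1 p2; lra.
Qed.

(** For S <= 1 use x^2 <= 2 x, for S > 1 that 4 S already exceeds x^2. An error S^2 thus enters the
    square of x only to first order in S. *)
Lemma sq_le_of_split (x E S : R) : 0 <= x -> x <= 2 -> 0 <= E -> 0 <= S -> x <= E + S ^+ 2 ->
  x ^+ 2 <= 2 * E + 4 * S.
Proof.
move=> x0 x2 E0 S0 xES.
have h : x ^+ 2 <= 2 * x by rewrite expr2 ler_wpM2r.
have [S1|S1] := leP S 1; last by lra.
have : S ^+ 2 <= S by rewrite expr2 ler_piMr.
lra.
Qed.

(** In the application S = |s|, t = Im s, eta = Im zeta, rc = sqrt c, e = exp 2, and d is the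
    distance of the expected trace from the exact solution. The scales S and t are eliminated by eta
    <= 2 S t and S^2 <= 2 A; the division by S^2 reflects m_n = trace / s. *)
Lemma bias_num (S t eta A w n rc e d : R) : 0 < S -> 0 < t -> 0 < eta -> eta <= 1 -> eta <= 2 * S * t ->
  S ^+ 2 <= 2 * A -> 1 <= A -> 1 <= w -> 0 <= n -> 1 <= rc -> 1 <= e -> 0 <= d ->
  d * Num.min 1 t <= 2 ->
  d * Num.min 1 t <= 8 * (72 * t^-1 ^+ 2 / rc ^+ 2 + 106 * w * t^-1 ^+ 4 / rc ^+ 2
     + 96 * e * (3 * n / rc ^+ 2) * t^-1 ^+ 2 / rc ^+ 2) ->
  d ^+ 2 / S ^+ 2 <= 32 * (4608 * e + 120) * A * w / eta ^+ 8 * (n / (rc ^+ 2) ^+ 2 + rc^-1).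
Proof.
move=> S0 t0 eta0 eta1 etaS SA A1 w1 n0 rc1 e1 d0 x2 xb.
set t1 := Num.min 1 t in x2 xb *; set h := t^-1 in xb *; set v := rc^-1.
have h0 : 0 < h by rewrite invr_gt0.
have rc0 : 0 < rc by apply: lt_le_trans rc1.
have v0 : 0 < v by rewrite invr_gt0.
have v1 : v <= 1 by rewrite invf_le1.
have t10 : 0 < t1 by rewrite lt_min ltr01.
pose N := n * v ^+ 4; pose q := N + v.
have N0 : 0 <= N by rewrite mulr_ge0 // exprn_ge0 // ltW.
have qE : n / (rc ^+ 2) ^+ 2 + rc^-1 = q by rewrite /q /N -exprM -exprVn.
have v2 : v ^+ 2 <= v by rewrite expr2 ler_piMr // ltW.
pose H := h ^+ 2.
have H0 : 0 <= H by exact: sqr_ge0.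
(* 2304 is 8 * 96 * 3 and also dominates 8 * 72; 30 is chosen because 30^2 exceeds 8 * 106. *)
pose S2 := 30 * w * H * v; pose E1 := 2304 * e * H * q.
have q0 : 0 <= q by rewrite addr_ge0 // ltW.
have w0 : 0 <= w by apply: le_trans w1.
have e0 : 0 <= e by apply: le_trans e1.
have xES : d * t1 <= E1 + S2 ^+ 2.
  apply: (le_trans xb).
  have -> : 8 * (72 * h ^+ 2 / rc ^+ 2 + 106 * w * h ^+ 4 / rc ^+ 2 + 96 * e * (3 * n / rc ^+ 2) * h ^+ 2 / rc ^+ 2)
     = H * (576 * v ^+ 2 + 2304 * e * N) + 848 * w * (H ^+ 2 * v ^+ 2).
    rewrite /H /N /v -!exprVn; ring.
  apply: lerD.
    rewrite (_ : E1 = H * (2304 * e * v + 2304 * e * N)); last by rewrite /E1 /q; ring.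
    apply: (ler_wpM2l H0); rewrite lerD2r; apply: (@le_trans _ _ (576 * v)).
      by apply: ler_wpM2l v2; rewrite ler0n.
    by apply: (ler_wpM2r (ltW v0)); move: e1; clear; lra.
  rewrite (_ : S2 ^+ 2 = 900 * w ^+ 2 * (H ^+ 2 * v ^+ 2)); last by rewrite /S2; ring.
  have hw : 848 * w <= 900 * w ^+ 2 by have := ler_wpM2l w0 w1; rewrite -expr2; move: w0; clear; lra.
  by apply: ler_wpM2r hw; apply: mulr_ge0; exact: sqr_ge0.
have x0 : 0 <= d * t1 by rewrite mulr_ge0 // ltW.
have S20 : 0 <= S2.
  by apply: mulr_ge0 (ltW v0); apply: mulr_ge0 H0; apply: mulr_ge0 w0; rewrite ler0n.
have E10 : 0 <= E1.
  by apply: mulr_ge0 q0; apply: mulr_ge0 H0; apply: mulr_ge0 e0; rewrite ler0n.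
have X := sq_le_of_split x0 x2 E10 S20 xES.
have Y : 2 * E1 + 4 * S2 <= (4608 * e + 120) * w * q * H.
  rewrite (_ : 2 * E1 + 4 * S2 = (4608 * e * q + 120 * w * v) * H); last by rewrite /E1 /S2; ring.
  apply: (ler_wpM2r H0).
  rewrite (_ : (4608 * e + 120) * w * q = 4608 * e * q * w + 120 * w * q); last by ring.
  apply: lerD.
    by apply: ler_peMr w1; apply: mulr_ge0 q0; apply: mulr_ge0 e0; rewrite ler0n.
  by apply: ler_wpM2l; [apply: mulr_ge0 w0; rewrite ler0n | rewrite lerDr].
have {X Y}Z := le_trans X Y.
have tH : t ^+ 2 * H = 1 by rewrite /H /h -exprMn divff ?expr1n // lt0r_neq0.
have Z2 : (d * t1 * t) ^+ 2 <= (4608 * e + 120) * w * q.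
  rewrite [in leLHS]exprMn; apply: (le_trans (ler_wpM2r (sqr_ge0 t) Z)).
  by rewrite -[leLHS]mulrA [H * _]mulrC tH mulr1.
have L1 : eta ^+ 2 <= (2 * S * t) ^+ 2.
  by rewrite ler_sqr ?nnegrE ?(ltW eta0) // (le_trans _ etaS) // ltW.
have SA0 : 0 < S ^+ 2 by exact: exprn_gt0.
have L2 : eta ^+ 2 <= 8 * A * t1 ^+ 2.
  rewrite /t1; case: (leP 1 t) => _.
    rewrite expr1n mulr1 (@le_trans _ _ 1) ?expr_le1 ?(ltW eta0) //.
    by move: A1; clear; lra.
  apply: (le_trans L1); rewrite !exprMn -mulrA; apply: (@le_trans _ _ (4 * (2 * A * t ^+ 2))); last first.
    by apply: le_of_eq; ring.
  by rewrite (_ : 2 ^+ 2 = 4) ?ler_wpM2l ?ler_wpM2r ?sqr_ge0 // -natrX.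
have A0 : 0 <= A by apply: le_trans A1.
have C0 : 0 <= (4608 * e + 120) * w * q.
  apply: mulr_ge0 q0; apply: mulr_ge0 w0; apply: addr_ge0; last by rewrite ler0n.
  by apply: mulr_ge0 e0; rewrite ler0n.
have AS0 : 0 <= 32 * A * S ^+ 2.
  by apply: mulr_ge0 (ltW SA0); apply: mulr_ge0 A0; rewrite ler0n.
move: Z2 C0; rewrite qE (_ : 32 * (4608 * e + 120) * A * w / eta ^+ 8 * q =
  32 * A * ((4608 * e + 120) * w * q) / eta ^+ 8); last by ring.
move: (_ * q) => B Z2 B0.
have L3 : d ^+ 2 * eta ^+ 4 <= 32 * A * S ^+ 2 * B.
  apply: (@le_trans _ _ (d ^+ 2 * ((2 * S * t) ^+ 2 * (8 * A * t1 ^+ 2)))).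
    apply: (ler_wpM2l (sqr_ge0 d)); rewrite (_ : eta ^+ 4 = eta ^+ 2 * eta ^+ 2); last by rewrite -exprD.
    by rewrite ler_pM ?sqr_ge0.
  rewrite (_ : d ^+ 2 * _ = 32 * A * S ^+ 2 * (d * t1 * t) ^+ 2); last by ring.
  exact: ler_wpM2l.
rewrite ler_pdivrMr //.
have eta4 : 0 < eta ^+ 4 by exact: exprn_gt0.
(* The argument has lost only [eta ^+ 4]; as eta <= 1, this is weakened to [eta ^+ 8]. *)
apply: (@le_trans _ _ (32 * A * S ^+ 2 * B / eta ^+ 4)); first by rewrite ler_pdivlMr.
rewrite (_ : 32 * A * B / eta ^+ 8 * S ^+ 2 = 32 * A * S ^+ 2 * B / eta ^+ 8); last by ring.
apply: ler_wpM2l; first exact: mulr_ge0.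
rewrite lef_pV2 ?posrE ?exprn_gt0 //.
rewrite (_ : eta ^+ 8 = eta ^+ 4 * eta ^+ 4); last by rewrite -exprD.
by rewrite ler_piMr ?(ltW eta4) // expr_le1 // ltW.
Qed.

(** With n columns of influence 2 / (t n) each, the variance proxy is of order 1 / n, and 1 <= sqrt
    c <= c <= 3 n bounds 1 / n by 3 / sqrt c. *)
Lemma fluct_num (S t eta A w n rc : R) : 0 < S -> 0 < t -> 0 < eta -> eta <= 1 -> eta <= 2 * S * t ->
  1 <= A -> 1 <= w -> 0 < n -> 1 <= rc -> rc ^+ 2 <= 3 * n ->
  n * (2 / t / n) ^+ 2 / S ^+ 2 <= 48 * A * w / eta ^+ 8 * rc^-1.
Proof.
move=> S0 t0 eta0 eta1 etaS A1 w1 n0 rc1 rcn.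
have rc0 : 0 < rc by apply: lt_le_trans rc1.
have L1 : eta ^+ 2 <= (2 * S * t) ^+ 2.
  by rewrite ler_sqr ?nnegrE ?(ltW eta0) // (le_trans _ etaS) // ltW.
have St : 0 < (S * t) ^+ 2 by rewrite exprn_gt0 // mulr_gt0.
have -> : n * (2 / t / n) ^+ 2 / S ^+ 2 = 4 * (n^-1 * ((S * t) ^+ 2)^-1).
  field; by rewrite !lt0r_neq0.
have a1 : n^-1 <= 3 * rc^-1.
  by rewrite ler_pdivlMr // mulrC ler_pdivrMr // (le_trans _ rcn) // expr2 ler_peMr // ltW.
have a2 : ((S * t) ^+ 2)^-1 <= 4 / eta ^+ 2.
  rewrite ler_pdivlMr ?exprn_gt0 // mulrC ler_pdivrMr // (le_trans L1) //.
  by apply: le_of_eq; ring.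
have a3 : (eta ^+ 2)^-1 <= (eta ^+ 8)^-1.
  rewrite lef_pV2 ?posrE ?exprn_gt0 // (_ : eta ^+ 8 = eta ^+ 2 * eta ^+ 6); last by rewrite -exprD.
  by rewrite ler_piMr ?sqr_ge0 // expr_le1 // ltW.
apply: (@le_trans _ _ (4 * (3 * rc^-1 * (4 / eta ^+ 8)))).
  rewrite ler_wpM2l // ler_pM ?invr_ge0 ?(ltW n0) ?(ltW St) // (le_trans a2) // ler_wpM2l //.
rewrite (_ : 4 * _ = 48 * (1 * 1) * ((eta ^+ 8)^-1 * rc^-1)); last by ring.
rewrite (_ : 48 * A * w / eta ^+ 8 * rc^-1 = 48 * (A * w) * ((eta ^+ 8)^-1 * rc^-1)); last by ring.
apply: ler_wpM2r; first by apply: mulr_ge0; rewrite invr_ge0 ?(ltW rc0) // exprn_ge0 // ltW.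
by apply: ler_wpM2l; [rewrite ler0n | apply: ler_pM].
Qed.
End Numeric.

(** * Discrete measures from Hermitian matrices *)

Section Spectral.
Variable R : rcfType.

Lemma adjmxE m n (A : 'M[R[i]]_(m, n)) i j : adjmx A i j = conjc (A j i).
Proof. by rewrite /adjmx !mxE. Qed.

Lemma herm_diag n (A : 'M[R[i]]_n) : adjmx A = A ->
  exists (P : 'M[R[i]]_n) (d : 'I_n -> R),
    [/\ adjmx P *m P = 1%:M, P *m adjmx P = 1%:M &
        A = adjmx P *m diag_mx (\row_i (d i)%:C%C) *m P].
Proof.
move=> hA.
have hh : A \is hermsymmx.
  by apply/is_hermitianmxP; rewrite expr0 scale1r -{1}hA; apply/matrixP => i j; rewrite !mxE.
have /hermitian_normalmx /orthomx_spectralP E := hh.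
have U := spectral_unitarymx A.
have /mxOverP dR := hermitian_spectral_diag_real hh.
have adE : adjmx (spectralmx A) = invmx (spectralmx A).
  by rewrite invmx_unitary //; apply/matrixP => i j; rewrite !mxE.
have PU := unitarymx_unit U.
exists (spectralmx A), (fun i => complex.Re (spectral_diag A 0 i)).
split; [by rewrite adE mulVmx | by rewrite adE mulmxV | rewrite adE].
rewrite {1}E; congr (_ *m diag_mx _ *m _); apply/rowP => i; rewrite mxE.
by rewrite RRe_real.
Qed.

(** This is the spectral measure of [A] at the basis vector [j]: atoms at the eigenvalues, weights
    |P k j|^2. The resolvent entry is a coordinate of any solution [y] of the linear system, so an
    explicit solution can be supplied instead of an inverse. *)
Lemma herm_root_measure n (A : 'M[R[i]]_n.+1) (j : 'I_n.+1) : adjmx A = A ->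
  exists D : seq (R * R),
    [/\ forall q, q \in D -> 0 <= q.1,
        \sum_(q <- D) q.1 = 1,
        (\sum_(q <- D) q.1 * q.2 ^+ 2)%:C%C = (A *m A) j j &
        forall (s : R[i]) (y : 'cV[R[i]]_n.+1), Imc s != 0 ->
          (A - s%:M) *m y = delta_mx j 0 ->
          \sum_(q <- D) q.1%:C%C / (q.2%:C%C - s) = y j 0].
Proof.
move=> /herm_diag[P [d [PP PP' AE]]].
exists [seq (nc (P k j) ^+ 2, d k) | k <- enum 'I_n.+1].
have sumE (f : R * R -> R) : \sum_(q <- [seq (nc (P k j) ^+ 2, d k) | k <- enum 'I_n.+1]) f q
   = \sum_k f (nc (P k j) ^+ 2, d k) by rewrite big_map big_enum.
have wE k : (nc (P k j) ^+ 2)%:C%C = conjc (P k j) * P k j by rewrite -mulJ mulrC.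
split.
- by move=> q /mapP[k _ ->] /=; rewrite sqr_ge0.
- rewrite sumE /=; apply: complexI; rewrite rmorph_sum /=; transitivity ((adjmx P *m P) j j); last by rewrite PP mxE eqxx.
  rewrite mxE; by apply: eq_bigr => k _; rewrite wE adjmxE.
- rewrite sumE rmorph_sum /= AE.
  have -> : adjmx P *m diag_mx (\row_i (d i)%:C%C) *m P *m (adjmx P *m diag_mx (\row_i (d i)%:C%C) *m P)
    = adjmx P *m diag_mx (\row_i (d i ^+ 2)%:C%C) *m P.
    rewrite !mulmxA -(mulmxA _ P (adjmx P)) PP' mulmx1 -!mulmxA; congr (_ *m _).
    rewrite !mulmxA mulmx_diag; congr (diag_mx _ *m _).
    by apply/rowP => i; rewrite !mxE -rmorphM.
  rewrite mxE; apply: eq_bigr => k _.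
  by rewrite mul_mx_diag !mxE rmorphM /= wE; ring.
- move=> s y s0 yE.
  have nz k : (d k)%:C%C - s != 0.
    by apply: contra s0 => /eqP /(congr1 (@complex.Im R)); rewrite cImD cImN /= sub0r => /eqP; rewrite oppr_eq0.
  have yE2 : y = adjmx P *m diag_mx (\row_i ((d i)%:C%C - s)^-1) *m P *m delta_mx j 0.
    rewrite -yE; have -> : A - s%:M = adjmx P *m diag_mx (\row_i ((d i)%:C%C - s)) *m P.
      rewrite AE; have -> : s%:M = adjmx P *m s%:M *m P.
        by rewrite mul_mx_scalar -scalemxAl PP scalemx1.
      rewrite -mulmxBl -mulmxBr; congr (_ *m _ *m _).
      by apply/matrixP => i k; rewrite !mxE; case: (i == k); rewrite ?mulr1n ?mulr0n ?subr0.
    rewrite !mulmxA -(mulmxA _ P (adjmx P)) PP' mulmx1 -(mulmxA _ (diag_mx _) (diag_mx _)) mulmx_diag.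
    rewrite (_ : diag_mx _ = 1%:M) ?mulmx1 ?PP ?mul1mx //.
    by apply/matrixP => i k; rewrite !mxE mulVf.
  have /matrixP /(_ j 0) -> := yE2; rewrite big_map big_enum /=.
  rewrite -mulmxA mxE; apply: eq_bigr => k _.
  rewrite mul_mx_diag !mxE wE (bigD1 j) //= big1 ?addr0; last first.
    by move=> i ij; rewrite !mxE (negbTE ij) mulr0.
  by rewrite !mxE !eqxx mulr1; ring.
Qed.

End Spectral.

(** * Arrow matrices and the iterates of the fixed point map *)

Section Tree.
Variable R : rcfType.
Implicit Types (D : seq (R * R)) (s : R[i]) (r : R).

(** Stieltjes transform of the discrete measure with mass [q.1] at the point [q.2]. *)
Definition st D s : R[i] := \sum_(q <- D) q.1%:C%C / (q.2%:C%C - s).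
Definition pmass D : Prop := (forall q, q \in D -> 0 <= q.1) /\ \sum_(q <- D) q.1 = 1.

Lemma im_inv_real (x : R) s : Imc (x%:C%C - s)^-1 = Imc s * nc (x%:C%C - s)^-1 ^+ 2.
Proof. by rewrite cImV cImD cImN /= sub0r opprK ncV exprVn. Qed.

Lemma imstE D s : Imc (st D s) = Imc s * \sum_(q <- D) q.1 * nc (q.2%:C%C - s)^-1 ^+ 2.
Proof.
rewrite /st Im_sum mulr_sumr; apply: eq_bigr => q _.
by rewrite cImZ im_inv_real mulrCA.
Qed.

Lemma realB_neq0 (x : R) s : Imc s != 0 -> x%:C%C - s != 0.
Proof.
move=> h; apply: contra h => /eqP /(congr1 (@complex.Im R)).
by rewrite cImD cImN /= sub0r => /eqP; rewrite oppr_eq0.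
Qed.

Lemma imst_gt0 D s : pmass D -> Imc s != 0 ->
  0 < \sum_(q <- D) q.1 * nc (q.2%:C%C - s)^-1 ^+ 2.
Proof.
move=> [D0 D1] s0.
have h0 q : q \in D -> 0 <= q.1 * nc (q.2%:C%C - s)^-1 ^+ 2.
  by move=> qD; rewrite mulr_ge0 ?sqr_ge0 // D0.
rewrite lt_neqAle big_seq sumr_ge0 // andbT eq_sym -big_seq; apply/eqP => E.
have q0 q : q \in D -> q.1 = 0.
  move=> qD; move/eqP: E; rewrite big_seq psumr_eq0 // => /allP /(_ _ qD).
  rewrite qD /= mulf_eq0 expf_eq0 /= nc_eq0 invr_eq0 (negbTE (realB_neq0 _ s0)) orbF.
  by move/eqP.
by move: D1; rewrite big_seq big1 // => /eqP; rewrite eq_sym oner_eq0.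
Qed.

Lemma st_im D s : pmass D -> 0 < Imc s -> 0 < Imc (st D s).
Proof. by move=> hD s0; rewrite imstE mulr_gt0 // imst_gt0 // gt_eqF. Qed.

Lemma st_bound D s : pmass D -> 0 < Imc s -> nc (st D s) <= (Imc s)^-1.
Proof.
move=> [D0 D1] s0; rewrite /st (le_trans (nc_sum _ _ _)) //.
rewrite -[leRHS]mul1r -D1 mulr_suml.
rewrite big_seq [leRHS]big_seq; apply: ler_sum => q qD.
rewrite ncM nc_real ger0_norm ?D0 // ler_wpM2l ?D0 //.
by rewrite -ncN -invrN nc_inv_le // opprB cImD cImN /= subr0.
Qed.

(** Border the diagonal matrix of the atoms of [D] by the square roots of the weights, with corner
    [r]. The Schur complement of the corner is r - s - st D s, so the spectral measure at the corner
    has the required transform; its second moment is the squared norm of the first row. *)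
Lemma arrow_step D r : pmass D -> exists D', [/\ pmass D',
   \sum_(q <- D') q.1 * q.2 ^+ 2 = r ^+ 2 + 1 &
   forall s, Imc s != 0 -> st D' s = - (s + st D s - r%:C%C)^-1].
Proof.
move=> [D0 D1].
pose v i : R := Num.sqrt (nth (0, 0) D i).1.
pose x i : R := (nth (0, 0) D i).2.
have v2 (i : 'I_(size D)) : v i ^+ 2 = (nth (0, 0) D i).1.
  by rewrite sqr_sqrtr // D0 // mem_nth.
pose A : 'M[R[i]]_((size D).+1) := \matrix_(i, j)
  match unlift 0 i, unlift 0 j with
  | None, None => r%:C%C
  | None, Some j' => (v j')%:C%C
  | Some i', None => (v i')%:C%C
  | Some i', Some j' => (x i')%:C%C *+ (i' == j')
  end.
have A00 : A 0 0 = r%:C%C by rewrite mxE unlift_none.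
have A0j j : A 0 (lift 0 j) = (v j)%:C%C by rewrite mxE unlift_none liftK.
have Aj0 j : A (lift 0 j) 0 = (v j)%:C%C by rewrite mxE unlift_none liftK.
have Aij i j : A (lift 0 i) (lift 0 j) = (x i)%:C%C *+ (i == j) by rewrite mxE !liftK.
have hA : adjmx A = A.
  apply/matrixP => i j; rewrite adjmxE.
  case: (unliftP 0 i) => [i'|] ->; case: (unliftP 0 j) => [j'|] ->;
    rewrite ?A00 ?A0j ?Aj0 ?Aij ?conjc_real //.
  by rewrite eq_sym; case: eqP => [->|_]; rewrite ?mulr1n ?mulr0n ?conjc_real ?conjc0.
have [D' [D'0 D'1 D'2 D's]] := herm_root_measure 0 hA.
exists D'; split=> //.
  apply: complexI; rewrite D'2 mxE big_ord_recl A00.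
  under eq_bigr do rewrite A0j Aj0 -rmorphM -expr2 v2.
  rewrite -rmorph_sum -rmorphM /= -rmorphD -expr2 /=; congr (real_complex R (_ + _)).
  by rewrite -(big_mkord xpredT (fun i => (nth (0, 0) D i).1)) -(big_nth (0, 0) xpredT (fun q => q.1)).
move=> s s0.
have stE : st D s = \sum_(i < size D) (v i ^+ 2)%:C%C / ((x i)%:C%C - s).
  under eq_bigr do rewrite v2.
  by rewrite -(big_mkord xpredT (fun i => ((nth (0, 0) D i).1)%:C%C / (((nth (0, 0) D i).2)%:C%C - s)))
    -(big_nth (0, 0) xpredT (fun q => q.1%:C%C / (q.2%:C%C - s))).
have nz : s + st D s - r%:C%C != 0.
  apply/eqP => /(congr1 (@complex.Im R)); rewrite !cImD cImN /= subr0 imstE.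
  rewrite -[X in X + _]mulr1 -mulrDr => /eqP; rewrite mulf_eq0 (negbTE s0) /=.
  by rewrite gt_eqF // addr_gt0 // imst_gt0.
(* Candidate for the first column of the resolvent: the lower rows are solved in terms of [Y], and
   the top row then fixes [Y]. *)
pose Y := - (s + st D s - r%:C%C)^-1.
pose y : 'cV[R[i]]_((size D).+1) := \col_i
  match unlift 0 i with None => Y | Some i' => - (v i')%:C%C * Y / ((x i')%:C%C - s) end.
have -> : - (s + st D s - r%:C%C)^-1 = y 0 0 by rewrite mxE unlift_none.
apply: D's => //; apply/matrixP => i j; rewrite ord1 {j} mxE big_ord_recl.
have AsE a b : (A - s%:M) a b = A a b - s *+ (a == b).
  by rewrite [LHS]mxE; congr (_ + _); rewrite mxE [in LHS]mxE.
have y0 : y 0 0 = Y by rewrite mxE unlift_none.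
have yS k : y (lift 0 k) 0 = - (v k)%:C%C * Y / ((x k)%:C%C - s) by rewrite mxE liftK.
case: (unliftP 0 i) => [i'|] ->.
  rewrite (bigD1 i') //= big1 => [|k ki]; last first.
    by rewrite AsE Aij (inj_eq (@lift_inj _ _)) [i' == k]eq_sym (negbTE ki) !mulr0n subr0 mul0r.
  rewrite addr0 y0 yS !AsE Aj0 Aij !eqxx mulr0n subr0 !mulr1n [RHS]mxE /=; field.
  exact: realB_neq0.
under eq_bigr => k _.
  rewrite yS AsE A0j mulr0n subr0.
  rewrite (_ : _ * _ = - Y * ((v k ^+ 2)%:C%C / ((x k)%:C%C - s))); last by rewrite expr2 rmorphM /=; ring.
  over.
rewrite -mulr_sumr -stE y0 AsE A00 eqxx mulr1n [RHS]mxE eqxx /= /Y.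
by field.
Qed.

End Tree.

Section Iter.
Variable R : rcfType.
Implicit Types (D : seq (R * R)).
Variable r : R.

Definition phi (u : R[i]) : R[i] := u / ((r ^+ 2)%:C%C - u ^+ 2).
(** Index 0 is already one step away from the start a = 0, so that every iterate is the transform of
    a probability measure. *)
Definition treeg (L : nat) (s : R[i]) : R[i] := iter L (fun a => phi (s + a)) (phi s).

Lemma treegS L s : treeg L.+1 s = phi (s + treeg L s). Proof. by []. Qed.

Lemma phiN u : phi (- u) = - phi u.
Proof. by rewrite /phi sqrrN mulNr. Qed.
Lemma treegN L s : treeg L (- s) = - treeg L s.
Proof. by elim: L => [|L IH]; [exact: phiN | rewrite !treegS IH -opprD phiN]. Qed.

Lemma st_cat D1 D2 s : st (D1 ++ D2) s = st D1 s + st D2 s.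
Proof. by rewrite /st big_cat. Qed.

Definition halve D : seq (R * R) := [seq (q.1 / 2, q.2) | q <- D].
Lemma halve_mix D1 D2 (M : R) : pmass D1 -> pmass D2 ->
  \sum_(q <- D1) q.1 * q.2 ^+ 2 <= M -> \sum_(q <- D2) q.1 * q.2 ^+ 2 <= M ->
  [/\ pmass (halve D1 ++ halve D2),
      \sum_(q <- halve D1 ++ halve D2) q.1 * q.2 ^+ 2 <= M &
      forall s, st (halve D1 ++ halve D2) s = (st D1 s + st D2 s) / 2%:R].
Proof.
move=> [p1 m1] [p2 m2] M1 M2; split.
- split; last first.
    by rewrite big_cat !big_map /= -!mulr_suml m1 m2; field.
  move=> q; rewrite mem_cat => /orP[] /mapP[q' q'D ->] /=; rewrite divr_ge0 //.
    exact: p1.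
  exact: p2.
- rewrite big_cat !big_map /=.
  have E D : \sum_(q <- D) q.1 / 2 * q.2 ^+ 2 = (\sum_(q <- D) q.1 * q.2 ^+ 2) / 2.
    by rewrite mulr_suml; apply: eq_bigr => q _; ring.
  by rewrite !E; lra.
- move=> s; rewrite st_cat mulrDl.
  have E D : st (halve D) s = st D s / 2%:R.
    rewrite /st big_map mulr_suml; apply: eq_bigr => q _ /=.
    by rewrite rmorphM /= fmorphV rmorph_nat; ring.
  by rewrite !E.
Qed.

Lemma phiE_gen (u : R[i]) : Imc u != 0 ->
  phi u = (- (u - r%:C%C)^-1 + - (u + r%:C%C)^-1) / 2%:R.
Proof.
move=> h; have h1 : u - r%:C%C != 0.
  by rewrite -oppr_eq0 opprB realB_neq0.
have h2 : u + r%:C%C != 0.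
  by rewrite -oppr_eq0 opprD addrC -rmorphN realB_neq0.
by rewrite /phi den_fact; field; rewrite h1 h2.
Qed.

Lemma imst_neq0 D s : pmass D -> Imc s != 0 -> Imc (s + st D s) != 0.
Proof.
move=> hD s0; rewrite cImD imstE -[X in X + _]mulr1 -mulrDr mulf_neq0 // gt_eqF //.
by rewrite addr_gt0 // imst_gt0.
Qed.

(** By partial fractions Phi(s + a) is the half sum of two transforms of the kind in [arrow_step],
    with corners r and -r, and so belongs to a mixture of two measures. The second moment bound,
    uniform in [L], is the tightness needed for the weak limit. *)
Lemma tree_measure L : exists D, [/\ pmass D,
  \sum_(q <- D) q.1 * q.2 ^+ 2 <= r ^+ 2 + 1 & forall s, Imc s != 0 -> st D s = treeg L s].
Proof.
elim: L => [|L [D [pD _ DE]]].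
  have pr (x : R) : pmass [:: (1, x)].
    by split; [move=> q; rewrite inE => /eqP -> | rewrite big_seq1].
  have M1 (x : R) : x ^+ 2 = r ^+ 2 -> \sum_(q <- [:: ((1 : R), x)]) q.1 * q.2 ^+ 2 <= r ^+ 2 + 1.
    by move=> xr; rewrite big_seq1 /= mul1r xr lerDl.
  have [h1 h2 h3] := halve_mix (pr r) (pr (- r)) (M1 r erefl) (M1 (- r) (sqrrN r)).
  exists (halve [:: (1, r)] ++ halve [:: (1, - r)]); split => // s s0.
  rewrite h3 /st !big_seq1 /= -/(phi s) phiE_gen // !mul1r; congr (_ / _).
  rewrite -[s - _]opprB invrN opprK rmorphN; congr (_ + _).
  by rewrite -invrN opprD addrC.
have [D1 [p1 m1 E1]] := arrow_step r pD.
have [D2 [p2 m2 E2]] := arrow_step (- r) pD.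
have m1' : \sum_(q <- D1) q.1 * q.2 ^+ 2 <= r ^+ 2 + 1 by rewrite m1.
have m2' : \sum_(q <- D2) q.1 * q.2 ^+ 2 <= r ^+ 2 + 1 by rewrite m2 sqrrN.
have [h1 h2 h3] := halve_mix p1 p2 m1' m2'.
exists (halve D1 ++ halve D2); split => // s s0.
rewrite h3 E1 // E2 // treegS -DE // phiE_gen ?imst_neq0 //.
by rewrite rmorphN opprK.
Qed.

Section Conv.
Variable s : R[i].
Hypothesis s0 : 0 < Imc s.
Let t := Imc s.
Let b L := Imc (treeg L s).

Lemma treeg_im L : 0 < Imc (treeg L s).
Proof.
have [D [pD _ DE]] := tree_measure L.
by rewrite -DE ?gt_eqF // st_im.
Qed.
Lemma treeg_bound L : nc (treeg L s) <= t^-1.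
Proof.
have [D [pD _ DE]] := tree_measure L.
by rewrite -DE ?gt_eqF // st_bound.
Qed.
Lemma treeg_imle L : Imc (treeg L s) <= t^-1.
Proof. by rewrite (le_trans _ (treeg_bound L)) // (le_trans _ (nc_im _)) // ler_norm. Qed.

(** The factors N are not known to be below 1 individually. But N(s + g_L) (t + b_L) = b_(L+1), so
    once b_(L+1) b_L is split off, each step multiplies the rest by two quotients b / (t + b), and b
    <= 1 / t makes these at most 1 / (1 + t^2). *)
Lemma treeg_diff L : nc (treeg L.+1 s - treeg L s) ^+ 2
  <= t^-1 ^+ 4 * ((1 + t ^+ 2)^-1 ^+ 2) ^+ L * (b L.+1 * b L).
Proof.
have u0 M : 0 < Imc (s + treeg M s) by rewrite cImD addr_gt0 // treeg_im.
have st0 : 0 < t by exact: s0.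
have bE M : nfun r (s + treeg M s) * (t + b M) = b M.+1.
  by rewrite /b treegS /phi im_phi // cImD.
have b0 M : 0 < b M by exact: treeg_im.
have tV : t * t^-1 = 1 by rewrite divff // gt_eqF.
have tb M : t * b M <= 1 by rewrite -tV; apply: ler_wpM2l; [exact: ltW | exact: treeg_imle].
have tiv0 : 0 < t^-1 by rewrite invr_gt0.
have nf0 u : 0 <= nfun r u by rewrite (le_trans _ (mfun_sq r u)) // sqr_ge0.
have cont u w : 0 < Imc u -> 0 < Imc w ->
  nc (phi u - phi w) ^+ 2 <= nc (u - w) ^+ 2 * (nfun r u * nfun r w).
  by move=> hu hw; rewrite phi_diff // ncM exprMn ler_wpM2l ?sqr_ge0 // kappa_le.
have t2 : 0 < 1 + t ^+ 2 by rewrite ltr_pwDl // sqr_ge0.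
elim: L => [|L IH].
  rewrite expr0 mulr1 treegS; apply: (le_trans (cont _ _ (u0 0%N) s0)).
  rewrite (_ : s + _ - s = treeg 0 s); last by rewrite addrC addKr.
  have b0E : nfun r s * t = b 0%N by rewrite /b /treeg /= /phi im_phi.
  have N1 : nfun r (s + treeg 0 s) <= t^-1 * b 1%N.
    by rewrite -bE mulrCA ler_peMr // mulrDr mulrC tV lerDl mulr_ge0 // ltW.
  have N0 : nfun r s = t^-1 * b 0%N by rewrite -b0E mulrCA [t^-1 * t]mulrC tV mulr1.
  have a0 : nc (treeg 0 s) ^+ 2 <= t^-1 ^+ 2.
    by apply: lerXn2r; rewrite ?nnegrE ?nc_ge0 ?(ltW tiv0) //; exact: treeg_bound.
  have h1 : nfun r (s + treeg 0 s) * nfun r s <= t^-1 ^+ 2 * (b 1%N * b 0%N).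
    rewrite N0 (_ : t^-1 ^+ 2 * _ = (t^-1 * b 1%N) * (t^-1 * b 0%N)); last by ring.
    by rewrite ler_wpM2r // mulr_ge0 // ltW.
  rewrite (_ : t^-1 ^+ 4 * _ = t^-1 ^+ 2 * (t^-1 ^+ 2 * (b 1%N * b 0%N))); last by ring.
  by apply: ler_pM => //; rewrite ?sqr_ge0 // mulr_ge0.
rewrite [treeg L.+2 s]treegS {1}[treeg L.+1 s]treegS.
rewrite [X in nc (_ - X)]treegS.
apply: (le_trans (cont _ _ (u0 L.+1) (u0 L))).
rewrite (_ : s + _ - _ = treeg L.+1 s - treeg L s); last by ring.
set K := t^-1 ^+ 4 * _ in IH.
have K0 : 0 <= K by rewrite /K mulr_ge0 // exprn_ge0 ?sqr_ge0 // ltW.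
have qle M : b M <= (1 + t ^+ 2)^-1 * (t + b M).
  rewrite mulrC ler_pdivlMr //.
  have := tb M; have := b0 M; move: st0; move: (b M) => x; nra.
apply: (@le_trans _ _ (K * (b L.+1 * b L) * (nfun r (s + treeg L.+1 s) * nfun r (s + treeg L s)))).
  by rewrite ler_wpM2r // mulr_ge0.
rewrite [_ ^+ L.+1]exprS [X in _ <= X * _](_ : _ = K * (1 + t ^+ 2)^-1 ^+ 2); last by rewrite /K -[RHS]mulrA; congr (_ * _); exact: mulrC.
rewrite -[leLHS]mulrA -[leRHS]mulrA ler_wpM2l //.
rewrite [b L.+2 * b L.+1](_ : _ = nfun r (s + treeg L.+1 s) * (t + b L.+1) * (nfun r (s + treeg L s) * (t + b L))); last by rewrite !bE.
have -> : b L.+1 * b L * (nfun r (s + treeg L.+1 s) * nfun r (s + treeg L s)) =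
   (nfun r (s + treeg L.+1 s) * nfun r (s + treeg L s)) * (b L.+1 * b L) by ring.
have -> : (1 + t ^+ 2)^-1 ^+ 2 * (nfun r (s + treeg L.+1 s) * (t + b L.+1) * (nfun r (s + treeg L s) * (t + b L)))
  = (nfun r (s + treeg L.+1 s) * nfun r (s + treeg L s)) *
    (((1 + t ^+ 2)^-1 * (t + b L.+1)) * ((1 + t ^+ 2)^-1 * (t + b L))) by ring.
apply: ler_wpM2l; first by rewrite mulr_ge0.
by apply: ler_pM; [exact: ltW | exact: ltW | exact: qle | exact: qle].
Qed.

Lemma treeg_diff_le L : nc (treeg L.+1 s - treeg L s) ^+ 2
  <= t^-1 ^+ 6 * ((1 + t ^+ 2)^-1 ^+ 2) ^+ L.
Proof.
apply: (le_trans (treeg_diff L)).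
have tiv0 : 0 < t^-1 by rewrite invr_gt0.
set q := (_ ^+ 2) ^+ L; have q0 : 0 <= q by rewrite exprn_ge0 // sqr_ge0.
rewrite (_ : t^-1 ^+ 6 * q = t^-1 ^+ 4 * q * (t^-1 * t^-1)); last by ring.
apply: ler_wpM2l; first by rewrite mulr_ge0 // exprn_ge0 // ltW.
by apply: ler_pM; rewrite ?(ltW (treeg_im _)) //; exact: treeg_imle.
Qed.

End Conv.
End Iter.

(** * Expectations of real and complex functions *)

Section Expect.
Context d (T : measurableType d) (R : realType) (P : probability T R).
Implicit Types f g : T -> R.

Definition itg f : Prop := P.-integrable setT (EFin \o f).
Definition Ex f : R := Rintegral P setT f.

Lemma itg_meas f : itg f -> measurable_fun setT f.
Proof. by move=> /integrableP[/measurable_EFinP]. Qed.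

Lemma itg_bounded f (C : R) : measurable_fun setT f -> (forall x, `|f x| <= C) -> itg f.
Proof.
move=> mf fC; have PT : (P setT < +oo)%E by rewrite probability_setT ltry.
apply: (measurable_bounded_integrable measurableT PT mf).
exists C; split; first exact: num_real.
by move=> M CM x _ /=; rewrite (le_trans (fC x)) // ltW.
Qed.

Lemma itg_cst (c : R) : itg (fun=> c).
Proof. by apply: (@itg_bounded _ `|c|) => //; exact: measurable_cst. Qed.

Lemma itg_ext f g : f =1 g -> itg f -> itg g.
Proof. by move=> /funext ->. Qed.

Lemma itgD f g : itg f -> itg g -> itg (fun x => f x + g x).
Proof. by move=> hf hg; have := integrableD measurableT hf hg. Qed.
Lemma itgB f g : itg f -> itg g -> itg (fun x => f x - g x).
Proof. by move=> hf hg; have := integrableB measurableT hf hg. Qed.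
Lemma itgZ (c : R) f : itg f -> itg (fun x => c * f x).
Proof. by move=> hf; have := integrableZl measurableT c hf. Qed.
Lemma itgZr (c : R) f : itg f -> itg (fun x => f x * c).
Proof. by move=> hf; apply: (@itg_ext (fun x => c * f x)); [move=> x; rewrite mulrC | exact: itgZ]. Qed.
Lemma itgN f : itg f -> itg (fun x => - f x).
Proof. by move=> hf; apply: (@itg_ext (fun x => (-1) * f x)); [move=> x; rewrite mulN1r | exact: itgZ]. Qed.
Lemma itg_abs f : itg f -> itg (fun x => `|f x|).
Proof. by move=> hf; have := integrable_norm hf. Qed.
Lemma itg_le f g : measurable_fun setT f -> (forall x, `|f x| <= g x) -> itg g -> itg f.
Proof.
move=> mf fg ig; apply: (le_integrable _ _ _ ig) => //.
  exact/measurable_EFinP.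
by move=> x _; rewrite lee_fin (le_trans (fg x)) // ler_norm.
Qed.
Lemma itgM_bounded f g (C : R) : itg f -> measurable_fun setT g -> (forall x, `|g x| <= C) ->
  itg (fun x => f x * g x).
Proof.
move=> hf mg gC; apply: (@itg_le _ (fun x => `|f x| * C)).
- by apply: measurable_funM => //; exact: itg_meas.
- by move=> x; rewrite normrM ler_wpM2l.
- by apply: itgZr; exact: itg_abs.
Qed.
Lemma itg_sum (I : Type) (s : seq I) (Q : pred I) (F : I -> T -> R) :
  (forall i, Q i -> itg (F i)) -> itg (fun x => \sum_(i <- s | Q i) F i x).
Proof.
move=> h; elim: s => [|i s IH].
  by apply: (@itg_ext (fun=> 0)); [move=> x; rewrite big_nil | exact: itg_cst].
have [Qi|nQi] := boolP (Q i).
  apply: (@itg_ext (fun x => F i x + \sum_(j <- s | Q j) F j x)).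
    by move=> x; rewrite big_cons Qi.
  by apply: itgD => //; exact: h.
by apply: itg_ext IH => x; rewrite big_cons (negbTE nQi).
Qed.

Lemma Ex_ext f g : f =1 g -> Ex f = Ex g.
Proof. by move=> /funext ->. Qed.
Lemma ExD f g : itg f -> itg g -> Ex (fun x => f x + g x) = Ex f + Ex g.
Proof. by move=> hf hg; rewrite /Ex RintegralD. Qed.
Lemma ExB f g : itg f -> itg g -> Ex (fun x => f x - g x) = Ex f - Ex g.
Proof. by move=> hf hg; rewrite /Ex RintegralB. Qed.
Lemma ExZ (c : R) f : itg f -> Ex (fun x => c * f x) = c * Ex f.
Proof. by move=> hf; rewrite /Ex RintegralZl. Qed.
Lemma ExZr (c : R) f : itg f -> Ex (fun x => f x * c) = Ex f * c.
Proof. by move=> hf; rewrite /Ex RintegralZr. Qed.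
Lemma ExN f : itg f -> Ex (fun x => - f x) = - Ex f.
Proof. by move=> hf; rewrite -mulN1r -ExZ //; apply: Ex_ext => x; rewrite mulN1r. Qed.
Lemma Ex_cst (c : R) : Ex (fun=> c) = c.
Proof. rewrite /Ex Rintegral_cst //; have h : P setT = 1%E := probability_setT P.
by transitivity (c * fine (P setT)); [|rewrite h mulr1]. Qed.
Lemma Ex_ge0 f : (forall x, 0 <= f x) -> 0 <= Ex f.
Proof. by move=> f0; apply: Rintegral_ge0 => x _; exact: f0. Qed.
Lemma Ex_le f g : itg f -> itg g -> (forall x, f x <= g x) -> Ex f <= Ex g.
Proof. by move=> hf hg fg; apply: le_Rintegral => // x _; exact: fg. Qed.
Lemma Ex_abs f : itg f -> `|Ex f| <= Ex (fun x => `|f x|).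
Proof. by move=> hf; exact: le_normr_Rintegral. Qed.
Lemma Ex_sum (I : Type) (s : seq I) (Q : pred I) (F : I -> T -> R) :
  (forall i, Q i -> itg (F i)) -> Ex (fun x => \sum_(i <- s | Q i) F i x) = \sum_(i <- s | Q i) Ex (F i).
Proof.
move=> h; elim: s => [|i s IH].
  by rewrite big_nil -[RHS](Ex_cst 0); apply: Ex_ext => x; rewrite big_nil.
rewrite [RHS]big_cons; case: ifPn => [Qi|nQi].
  rewrite -IH -ExD; [|exact: h|exact: itg_sum].
  by apply: Ex_ext => x; rewrite big_cons Qi.
by rewrite -IH; apply: Ex_ext => x; rewrite big_cons (negbTE nQi).
Qed.
Lemma Ex_fin f : itg f -> (\int[P]_x (f x)%:E = (Ex f)%:E)%E.
Proof. by move=> hf; rewrite /Ex /Rintegral fineK //; apply: integrable_fin_num. Qed.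
Lemma itg_indic (A : set T) : measurable A -> itg \1_A.
Proof.
move=> mA; apply: (@itg_bounded _ 1); first exact: measurable_indic.
by move=> x; rewrite indicE; case: (_ \in _); rewrite ?normr1 ?normr0.
Qed.
Lemma Ex_indic (A : set T) : measurable A -> Ex \1_A = fine (P A).
Proof. by move=> mA; rewrite /Ex /Rintegral integral_indic // setIT. Qed.

Lemma itg_sqr_itg f : measurable_fun setT f -> itg (fun x => f x ^+ 2) -> itg f.
Proof.
move=> mf h; apply: (@itg_le _ (fun x => 1 + f x ^+ 2)) => //.
  move=> x; have := sqr_ge0 (`|f x| - 1); rewrite -(real_normK (num_real (f x))).
  have := normr_ge0 (f x); nra.
by apply: itgD => //; exact: itg_cst.
Qed.

Lemma Ex_sq_le f : itg f -> itg (fun x => f x ^+ 2) -> Ex f ^+ 2 <= Ex (fun x => f x ^+ 2).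
Proof.
move=> i1 i2; rewrite -subr_ge0.
have -> : Ex (fun x => f x ^+ 2) - Ex f ^+ 2 = Ex (fun x => (f x - Ex f) ^+ 2).
  rewrite (@Ex_ext (fun x => (f x - Ex f) ^+ 2) (fun x => f x ^+ 2 - (2 * Ex f * f x - Ex f ^+ 2))).
    have i3 : itg (fun x => 2 * Ex f * f x) by exact: itgZ.
    have i4 := itg_cst (Ex f ^+ 2).
    by rewrite ExB //; [rewrite ExB // ExZ // Ex_cst; ring | exact: itgB].
  by move=> x; ring.
by apply: Ex_ge0 => x; exact: sqr_ge0.
Qed.

(** Passing through the real power function avoids a case distinction at 0, where the inverse is 0
    by convention. *)
Lemma measurable_inv_ge0 f : (forall x, 0 <= f x) -> measurable_fun setT f ->
  measurable_fun setT (fun x => (f x)^-1).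
Proof.
move=> f0 mf; under eq_fun do rewrite -powR_inv1 //.
by apply: (measurableT_comp (f := fun x : R => x `^ (-1))) mf; exact: measurable_powR.
Qed.

Lemma Ex_gt0 f : itg f -> (forall x, 0 < f x) -> 0 < Ex f.
Proof.
move=> hf f0; rewrite lt_neqAle Ex_ge0 ?andbT => [|x]; last exact: ltW.
apply/eqP => E; have mf : measurable_fun setT (EFin \o f) by apply/measurable_EFinP; exact: itg_meas.
have : (\int[P]_x `|(EFin \o f) x| = 0)%E.
  rewrite -[RHS]/(0%R%:E) E -Ex_fin //; apply: eq_integral => x _ /=.
  by rewrite ger0_norm // ltW.
move=> /(ae_eq_integral_abs P measurableT mf)[N [mN N0 subN]].
have : (P setT <= 0)%E.
  rewrite -N0; apply: le_measure; rewrite ?inE // => x _; apply: subN => /= h.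
  by have := f0 x; case: (h I) => ->; rewrite ltxx.
by rewrite probability_setT lee_fin ler10.
Qed.

Lemma Ex_ae (N : set T) f g : measurable N -> P N = 1%E -> measurable_fun setT f ->
  measurable_fun setT g -> (forall x, N x -> f x = g x) -> Ex f = Ex g.
Proof.
move=> mN N1 mf mg fg; rewrite /Ex /Rintegral; congr fine.
have hN : P (~` N) = 0%E by rewrite probability_setC // N1 subee.
apply: ae_eq_integral => //; [exact/measurable_EFinP|exact/measurable_EFinP|].
exists (~` N); split => //; first exact: measurableC.
by move=> x /= h Nx; apply: h => _; rewrite fg.
Qed.

Section Complex.
Implicit Types u v : T -> R[i].

(** Measurability and integrability of complex functions are stated by components, which avoids
    choosing a sigma-algebra on [R[i]]. *)
Definition cmeas u : Prop := measurable_fun setT (fun x => Rec (u x)) /\ measurable_fun setT (fun x => Imc (u x)).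
Definition citg u : Prop := itg (fun x => Rec (u x)) /\ itg (fun x => Imc (u x)).
Definition CE u : R[i] := Complex (Ex (fun x => Rec (u x))) (Ex (fun x => Imc (u x))).

Lemma cmeas_nc u : cmeas u -> measurable_fun setT (fun x => nc (u x)).
Proof.
move=> [m1 m2]; have -> : (fun x => nc (u x)) = (fun x => Num.sqrt (Rec (u x) ^+ 2 + Imc (u x) ^+ 2)).
  by apply/funext => x; case: (u x).
apply: (measurableT_comp (f := @Num.sqrt R)); first by apply: continuous_measurable_fun; exact: sqrt_continuous.
by apply: measurable_funD; exact: measurable_funX.
Qed.
Lemma cmeas_cst (c : R[i]) : cmeas (fun=> c).
Proof. by split; exact: measurable_cst. Qed.
Lemma cmeas_ext u v : u =1 v -> cmeas u -> cmeas v.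
Proof. by move=> /funext ->. Qed.
Lemma cmeasD u v : cmeas u -> cmeas v -> cmeas (fun x => u x + v x).
Proof.
move=> [a b] [c e]; split.
  by under eq_fun do rewrite cReD; exact: measurable_funD.
by under eq_fun do rewrite cImD; exact: measurable_funD.
Qed.
Lemma cmeasN u : cmeas u -> cmeas (fun x => - u x).
Proof.
move=> [a b]; split.
  by under eq_fun do rewrite cReN; exact: measurableT_comp.
by under eq_fun do rewrite cImN; exact: measurableT_comp.
Qed.
Lemma cmeasB u v : cmeas u -> cmeas v -> cmeas (fun x => u x - v x).
Proof. by move=> hu hv; apply: cmeasD => //; exact: cmeasN. Qed.
Lemma cmeasM u v : cmeas u -> cmeas v -> cmeas (fun x => u x * v x).
Proof.
move=> [a b] [c e]; split.
  by under eq_fun do rewrite cReM; apply: measurable_funB; exact: measurable_funM.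
by under eq_fun do rewrite cImM; apply: measurable_funD; exact: measurable_funM.
Qed.
Lemma cmeas_conj u : cmeas u -> cmeas (fun x => conjc (u x)).
Proof.
move=> [a b]; split.
  by apply: eq_measurable_fun a => x _; case: (u x).
have -> : (fun x => Imc (conjc (u x))) = (fun x => - Imc (u x)) by apply/funext => x; case: (u x).
exact: measurableT_comp.
Qed.
Lemma cmeasV u : cmeas u -> cmeas (fun x => (u x)^-1).
Proof.
move=> hu; have mn : measurable_fun setT (fun x => (nc (u x) ^+ 2)^-1).
  apply: measurable_inv_ge0 => [x|]; first exact: sqr_ge0.
  by apply: measurable_funX; exact: cmeas_nc.
case: hu => a b; split.
  by under eq_fun do rewrite cReV; exact: measurable_funM.
under eq_fun do rewrite cImV; apply: measurable_funM => //; exact: measurableT_comp.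
Qed.
Lemma cmeas_sum (I : Type) (s : seq I) (Q : pred I) (F : I -> T -> R[i]) :
  (forall i, cmeas (F i)) -> cmeas (fun x => \sum_(i <- s | Q i) F i x).
Proof.
move=> h; elim: s => [|i s IH].
  by apply: (@cmeas_ext (fun=> 0)); [move=> x; rewrite big_nil | exact: cmeas_cst].
have [Qi|nQi] := boolP (Q i).
  apply: (@cmeas_ext (fun x => F i x + \sum_(j <- s | Q j) F j x)).
    by move=> x; rewrite big_cons Qi.
  exact: cmeasD.
by apply: cmeas_ext IH => x; rewrite big_cons (negbTE nQi).
Qed.
Lemma cmeas_prod (I : Type) (s : seq I) (Q : pred I) (F : I -> T -> R[i]) :
  (forall i, cmeas (F i)) -> cmeas (fun x => \prod_(i <- s | Q i) F i x).
Proof.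
move=> h; elim: s => [|i s IH].
  by apply: (@cmeas_ext (fun=> 1)); [move=> x; rewrite big_nil | exact: cmeas_cst].
have [Qi|nQi] := boolP (Q i).
  apply: (@cmeas_ext (fun x => F i x * \prod_(j <- s | Q j) F j x)).
    by move=> x; rewrite big_cons Qi.
  exact: cmeasM.
by apply: cmeas_ext IH => x; rewrite big_cons (negbTE nQi).
Qed.

Lemma citg_meas u : citg u -> cmeas u.
Proof. by move=> [a b]; split; exact: itg_meas. Qed.
Lemma citg_le u g : cmeas u -> (forall x, nc (u x) <= g x) -> itg g -> citg u.
Proof.
move=> [m1 m2] ug ig; split.
  by apply: (itg_le m1 _ ig) => x; rewrite (le_trans (nc_re _)).
by apply: (itg_le m2 _ ig) => x; rewrite (le_trans (nc_im _)).
Qed.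
Lemma citg_bounded u (C : R) : cmeas u -> (forall x, nc (u x) <= C) -> citg u.
Proof. by move=> mu uC; apply: (citg_le mu uC); exact: itg_cst. Qed.
Lemma citg_nc u : citg u -> itg (fun x => nc (u x)).
Proof.
move=> hu; have [a b] := hu.
apply: (@itg_le _ (fun x => `|Rec (u x)| + `|Imc (u x)|)).
- exact/cmeas_nc/citg_meas.
- by move=> x; rewrite ger0_norm ?nc_ge0 // nc_reim.
- by apply: itgD; exact: itg_abs.
Qed.
Lemma citg_ext u v : u =1 v -> citg u -> citg v.
Proof. by move=> /funext ->. Qed.
Lemma citgD u v : citg u -> citg v -> citg (fun x => u x + v x).
Proof.
move=> hu hv; apply: (@citg_le _ (fun x => nc (u x) + nc (v x))).
- by apply: cmeasD; exact: citg_meas.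
- by move=> x; exact: ncD.
- by apply: itgD; exact: citg_nc.
Qed.
Lemma citgB u v : citg u -> citg v -> citg (fun x => u x - v x).
Proof.
move=> hu hv; apply: (@citg_le _ (fun x => nc (u x) + nc (v x))).
- by apply: cmeasB; exact: citg_meas.
- by move=> x; exact: ncB.
- by apply: itgD; exact: citg_nc.
Qed.
Lemma citgM_bounded u v (C : R) : citg u -> cmeas v -> (forall x, nc (v x) <= C) ->
  citg (fun x => u x * v x).
Proof.
move=> hu mv vC; apply: (@citg_le _ (fun x => nc (u x) * C)).
- by apply: cmeasM => //; exact: citg_meas.
- by move=> x; rewrite ncM ler_wpM2l ?nc_ge0.
- by apply: itgZr; exact: citg_nc.
Qed.
Lemma citgZ (c : R[i]) u : citg u -> citg (fun x => c * u x).
Proof.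
move=> hu; apply: (@citg_ext (fun x => u x * c)); first by move=> x; rewrite mulrC.
by apply: (citgM_bounded hu (cmeas_cst c)) => x.
Qed.
Lemma citg_cst (c : R[i]) : citg (fun=> c).
Proof. by split; exact: itg_cst. Qed.
Lemma citg_sum (I : Type) (s : seq I) (Q : pred I) (F : I -> T -> R[i]) :
  (forall i, Q i -> citg (F i)) -> citg (fun x => \sum_(i <- s | Q i) F i x).
Proof.
move=> h; split.
  by under eq_fun do rewrite Re_sum; apply: itg_sum => i /h[].
by under eq_fun do rewrite Im_sum; apply: itg_sum => i /h[].
Qed.

Lemma CE_ext u v : u =1 v -> CE u = CE v.
Proof. by move=> /funext ->. Qed.
Lemma CED u v : citg u -> citg v -> CE (fun x => u x + v x) = CE u + CE v.
Proof.
move=> [a b] [c e]; apply: complex_ext; rewrite ?cReD ?cImD /= -ExD //; apply: Ex_ext => x;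
  by rewrite ?cReD ?cImD.
Qed.
Lemma CEZ (c : R[i]) u : citg u -> CE (fun x => c * u x) = c * CE u.
Proof.
move=> [a b]; apply: complex_ext; rewrite ?cReM ?cImM /= -!ExZ //.
  by rewrite -ExB; [apply: Ex_ext => x; rewrite cReM | exact: itgZ | exact: itgZ].
by rewrite -ExD; [apply: Ex_ext => x; rewrite cImM | exact: itgZ | exact: itgZ].
Qed.
Lemma CEN u : citg u -> CE (fun x => - u x) = - CE u.
Proof. by move=> hu; rewrite -mulN1r -CEZ //; apply: CE_ext => x; rewrite mulN1r. Qed.
Lemma CEB u v : citg u -> citg v -> CE (fun x => u x - v x) = CE u - CE v.
Proof.
move=> hu hv; rewrite -CEN // -CED //.
by apply: (@citg_ext (fun x => (-1) * v x)); [move=> x; rewrite mulN1r | exact: citgZ].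
Qed.
Lemma CE_cst (c : R[i]) : CE (fun=> c) = c.
Proof. by apply: complex_ext; rewrite /= Ex_cst. Qed.
Lemma CE_sum (I : Type) (s : seq I) (Q : pred I) (F : I -> T -> R[i]) :
  (forall i, Q i -> citg (F i)) -> CE (fun x => \sum_(i <- s | Q i) F i x) = \sum_(i <- s | Q i) CE (F i).
Proof.
move=> h; apply: complex_ext; rewrite ?Re_sum ?Im_sum /= -Ex_sum; try by move=> i /h[].
  by apply: Ex_ext => x; rewrite Re_sum.
by apply: Ex_ext => x; rewrite Im_sum.
Qed.
(* Rotate so that the expectation becomes real and nonnegative. *)
Lemma nc_CE u : citg u -> nc (CE u) <= Ex (fun x => nc (u x)).
Proof.
move=> hu; set w := CE u.
have [w0|w0] := eqVneq w 0; first by rewrite w0 nc0; apply: Ex_ge0 => x; exact: nc_ge0.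
have n0 : 0 < nc w by rewrite nc_gt0.
have : nc w ^+ 2 <= nc w * Ex (fun x => nc (u x)).
  have -> : nc w ^+ 2 = Rec (CE (fun x => conjc w * u x)).
    by rewrite CEZ // -/w mulrC mulJ.
  rewrite -ExZ; last exact: citg_nc.
  have [h _] := citgZ (conjc w) hu.
  apply: (@le_trans _ _ (Ex (fun x => Rec (conjc w * u x)))); first by [].
  apply: (Ex_le h); first by apply: itgZ; exact: citg_nc.
  move=> x; apply: (le_trans (ler_norm _)); apply: (le_trans (nc_re _)).
  by rewrite ncM nc_conj.
by rewrite expr2 ler_pM2l.
Qed.
End Complex.
End Expect.

(** * Existence and uniqueness of the limit law *)

Section FromCdf.
Variable R : realType.

Lemma prob_of_cdf (G : R -> R) : {homo G : x y / x <= y} ->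
  right_continuous G -> G @ -oo --> (0 : R) -> G @ +oo --> (1 : R) ->
  exists nu : probability R R, forall x, nu `]-oo, x]%classic = (G x)%:E.
Proof.
move=> ndG rcG G0 G1.
pose C1 := isCumulative.Build R _ R G ndG rcG.
pose C2 := isCumulativeBounded.Build R 0 1 G G0 G1.
pose F : cumulativeBounded (0 : R) (1 : R) := HB.pack G C1 C2.
pose idTR : measurableTypeR R -> R := idfun.
pose M1 := @isMeasurableFun.Build _ _ (measurableTypeR R) R idTR (@measurable_id _ _ setT).
pose X : {mfun measurableTypeR R >-> R} := HB.pack idTR M1.
exists (distribution (lebesgue_stieltjes_measure F) X) => x.
exact: cdf_lebesgue_stieltjes_id.
Qed.

Lemma right_cont_reg (F : R -> R) : {homo F : x y / x <= y} -> (forall x, 0 <= F x <= 1) ->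
  (forall x, x < 0 -> F x = 0) -> (exists M, forall x, 0 < x -> 1 - M / x <= F x) ->
  exists nu : probability R R,
    nu [set x | 0 <= x] = 1%E /\
    forall x, exists2 g, nu `]-oo, x]%classic = g%:E & F x <= g /\ forall y, x < y -> g <= F y.
Proof.
move=> ndF F01 F0 [M FM].
pose S x := [set F y | y in [set y | x < y]].
pose G x := inf (S x).
have S0 x : S x !=set0 by exists (F (x + 1)), (x + 1) => //=; rewrite ltrDl ltr01.
have lbS x : lbound (S x) (F x) by move=> _ [y /= xy <-]; rewrite ndF // ltW.
have hiS x : has_inf (S x) by split => //; exists (F x).
have FG x : F x <= G x by apply: lb_le_inf.
have GF x y : x < y -> G x <= F y.
  by move=> xy; apply: ge_inf; [exists (F x) | exists y].
have ndG : {homo G : x y / x <= y}.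
  move=> x y xy; apply: lb_le_inf => // _ [z /= yz <-]; apply: GF.
  exact: le_lt_trans yz.
have rcG : right_continuous G.
  move=> x; apply/cvgrPdist_le => e e0.
  have [_ [y /= xy <-] Fy] := inf_adherent e0 (hiS x).
  near=> z.
  have xz : x < z by near: z; exact: nbhs_right_gt.
  have zy : z < y by near: z; exact: nbhs_right_lt.
  have h1 := ndG x z (ltW xz); have h2 := GF z y zy.
  by rewrite ler_distlC; apply/andP; split; [lra | rewrite (le_trans h2) // ltW].
have Gneg x : x < 0 -> G x = 0.
  move=> x0; apply/eqP; rewrite eq_le; apply/andP; split.
    by rewrite -(F0 (x / 2)) ?GF //; lra.
  by rewrite -(F0 x) // FG.
have G0 : G @ -oo --> (0 : R).
  apply: (@cvg_near_cst _ _ (0 : R) G); near=> x.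
  by apply: Gneg; near: x; apply: nbhs_ninfty_lt; rewrite num_real.
have G1 : G @ +oo --> (1 : R).
  apply/cvgrPdist_le => e e0; near=> x.
  have x0 : 0 < x by near: x; apply: nbhs_pinfty_gt; rewrite num_real.
  have xe : M / e <= x by near: x; apply: nbhs_pinfty_ge; rewrite num_real.
  have xx : x < x + 1 by rewrite ltrDl ltr01.
  have G1 : G x <= 1 by apply: (le_trans (GF x _ xx)); case/andP: (F01 (x + 1)).
  rewrite ger0_norm ?subr_ge0 // lerBlDr -lerBlDl (le_trans _ (FG x)) // (le_trans _ (FM x x0)) //.
  by rewrite lerD2l lerN2 ler_pdivrMr // mulrC -ler_pdivrMr.
have [nu nuE] := prob_of_cdf ndG rcG G0 G1.
exists nu; split; last by move=> x; exists (G x) => //; split => // y; exact: GF.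
have mI : measurable `]-oo, (0 : R)[%classic by exact: measurable_itv.
have nuneg : nu `]-oo, (0 : R)[%classic = 0%E.
  apply/eqP; rewrite eq_le measure_ge0 andbT.
  have -> : `]-oo, (0 : R)[%classic = \bigcup_n `]-oo, - (n.+1%:R^-1 : R)]%classic.
    apply/seteqP; split => x /=; rewrite in_itv /= => x0; last first.
      by case: x0 => n _; rewrite /= in_itv /= => /le_lt_trans; apply; rewrite oppr_lt0 invr_gt0.
    exists (Num.truncn (- x)^-1) => //=; rewrite in_itv /= lerNr -[leRHS]invrK lef_pV2 ?posrE ?invr_gt0 ?oppr_gt0 //.
    by rewrite ltW // truncnS_gt.
  apply: (le_trans (measure_sigma_subadditive _ _ _ (@subset_refl _ _))) => //.
  - by apply: bigcup_measurable => n _; exact: measurable_itv.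
  - rewrite eseries0 // => n _ _ /=; rewrite nuE Gneg // oppr_lt0 invr_gt0 //.
have -> : [set x | 0 <= x] = ~` `]-oo, (0 : R)[%classic.
  apply/seteqP; split => x /=; rewrite in_itv /= ?leNgt; first by move/negP.
  by move/negP.
by rewrite probability_setC // nuneg sube0.
Unshelve. all: by end_near. Qed.

End FromCdf.

(** * Weak limits along an ultrafilter *)

Section WeakLimit.
Variable R : realType.
Implicit Types (D : nat -> seq (R * R)) (U : set_system nat).

(** A fixed ultrafilter makes all bounded sequences converge at once and so takes the place of
    Helly's diagonal selection. *)
Lemma ultra_lim U (u : nat -> R) (a b : R) : UltraFilter U ->
  (forall L, a <= u L <= b) -> exists l : R, u @ U --> l.
Proof.
move=> UU u01.
have FA : (u @ U) `[a, b]%classic by apply: (@filterE _ U) => L; rewrite /= in_itv /= u01.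
have [l [_ lc]] := segment_compact (fmap_proper_filter u (@ultra_proper _ _ UU)) FA.
exists l => N Nl.
have [//|UN] := in_ultra_setVsetC (u @^-1` N) UU.
by have [x [xN Nx]] := lc (~` N) N UN Nl.
Qed.

Lemma lip_continuous (f : R -> R) (l : R) :
  (forall x y, `|f x - f y| <= l * `|x - y|) -> continuous f.
Proof.
move=> lf x; apply/cvgrPdist_le => e e0.
have l0 : 0 <= l by have := lf 0 1; rewrite sub0r normrN normr1 mulr1; apply: le_trans.
near=> y.
apply: (le_trans (lf x y)).
have h : `|x - y| <= e / (l + 1).
  near: y; have /cvgrPdist_le := @cvg_id _ (nbhs x); apply.
  by rewrite divr_gt0 // ltr_wpDl.
apply: (@le_trans _ _ (l * (e / (l + 1)))); first by rewrite ler_wpM2l.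
by rewrite mulrCA ler_piMr ?(ltW e0) // ler_pdivrMr ?ltr_wpDl // mul1r lerDl.
Unshelve. all: by end_near. Qed.

(* Staircase approximation of [f] on the grid 0, h, ..., K h. *)
Definition stair (f : R -> R) (h : R) (K : nat) (x : R) : R :=
  f (K%:R * h) + \sum_(k < K) (f (k%:R * h) - f (k.+1%:R * h)) * (x <= k%:R * h)%R%:R.

(** On a grid cell the sum telescopes to the value of [f] at the right end point; beyond the grid
    only [f (K%:R * h)] is left. *)
Lemma stairP f (l h : R) K x : 0 < h -> 0 <= x ->
  (forall x y, `|f x - f y| <= l * `|x - y|) ->
  (x <= K%:R * h -> `|f x - stair f h K x| <= l * h) /\
  (K%:R * h < x -> stair f h K x = f (K%:R * h)).
Proof.
move=> h0 x0 lf.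
have l0 : 0 <= l by have := lf 0 1; rewrite sub0r normrN normr1 mulr1; apply: le_trans.
elim: K => [|K [IH1 IH2]].
  rewrite /stair big_ord0 addr0 mul0r; split => // xle.
  have -> : x = 0 by apply/eqP; rewrite eq_le xle.
  by rewrite subrr normr0 mulr_ge0 // ltW.
have E : stair f h K.+1 x = stair f h K x +
   (f (K.+1%:R * h) - f (K%:R * h)) * (K%:R * h < x)%R%:R.
  rewrite /stair big_ord_recr /= ltNge; case: (x <= _) => /=; rewrite ?mulr1 ?mulr0; ring.
split => xK; rewrite E.
  have [xk|kx] := leP x (K%:R * h).
    by rewrite mulr0 addr0 IH1.
  rewrite IH2 // mulr1 (_ : f (K%:R * h) + _ = f (K.+1%:R * h)); last by ring.
  rewrite (le_trans (lf _ _)) // ler_wpM2l // ler_norml.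
  by move: xK kx; rewrite -natr1 mulrDl mul1r; lra.
have kx : K%:R * h < x.
  by apply: le_lt_trans xK; rewrite ler_wpM2r ?(ltW h0) // ler_nat.
by rewrite kx IH2 // mulr1; ring.
Qed.

Lemma stair_unif f (l e : R) :
  (forall x y, `|f x - f y| <= l * `|x - y|) -> 0 < e ->
  (exists B : R, forall x, B <= x -> `|f x| <= e) ->
  exists h K, [/\ 0 < h, l * h <= 2 * e & forall x, 0 <= x -> `|f x - stair f h K x| <= 2 * e].
Proof.
move=> lf e0 [B fB].
have l0 : 0 <= l by have := lf 0 1; rewrite sub0r normrN normr1 mulr1; apply: le_trans.
pose h := e / (l + 1).
have h0 : 0 < h by rewrite divr_gt0 // ltr_wpDl.
have lh : l * h <= e by rewrite mulrCA ler_piMr ?(ltW e0) // ler_pdivrMr ?ltr_wpDl // mul1r lerDl.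
pose K := (Num.truncn (B / h)).+1.
have KB : B <= K%:R * h by rewrite -ler_pdivrMr // ltW // truncnS_gt.
exists h, K; split => // [|x x0]; first lra.
have [h1 h2] := @stairP f l h K x h0 x0 lf.
have [xK|Kx] := leP x (K%:R * h); first by rewrite (le_trans (h1 xK)) //; lra.
rewrite h2 // (le_trans (ler_normB _ _)) //.
have := fB _ KB; have := fB x (le_trans KB (ltW Kx)); lra.
Qed.

Lemma weak_limit D (M : R) :
  (forall L q, q \in D L -> 0 <= q.1 /\ 0 <= q.2) ->
  (forall L, \sum_(q <- D L) q.1 = 1) ->
  (forall L, \sum_(q <- D L) q.1 * q.2 <= M) ->
  exists nu : probability R R, exists U : set_system nat,
  [/\ UltraFilter U, \oo `<=` U, nu [set x | 0 <= x] = 1%E &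
   forall (f : R -> R) (l : R), (forall x y, `|f x - f y| <= l * `|x - y|) ->
    (exists C : R, forall x, `|f x| <= C) ->
    (forall e, 0 < e -> exists B : R, forall x, B <= x -> `|f x| <= e) ->
    (fun L => \sum_(q <- D L) q.1 * f q.2) @ U --> Rintegral nu setT f].
Proof.
move=> D0 D1 DM.
have [U [UU Uoo]] := @ultraFilterLemma nat \oo _.
pose E L (f : R -> R) := \sum_(q <- D L) q.1 * f q.2.
pose FL x L := E L (fun y => (y <= x)%R%:R).
have Emono L f g : (forall y, 0 <= y -> f y <= g y) -> E L f <= E L g.
  move=> fg; rewrite /E !big_seq; apply: ler_sum => q qD.
  by have [q1 q2] := D0 L q qD; rewrite ler_wpM2l // fg.
have E1 L : E L (fun=> 1) = 1 by rewrite /E; under eq_bigr do rewrite mulr1; exact: D1.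
have Ecst L (c : R) : E L (fun=> c) = c by rewrite /E -mulr_suml D1 mul1r.
have FL01 x L : 0 <= FL x L <= 1.
  apply/andP; split; [rewrite -[leLHS](Ecst L 0)|rewrite -[leRHS](E1 L)]; apply: Emono => y _;
    by case: (y <= x).
have FLl x : exists l : R, FL x @ U --> l by apply: (ultra_lim UU (FL01 x)).
pose F x := sval (cid (FLl x)).
have FE x : FL x @ U --> F x by exact: svalP (cid (FLl x)).
have Fle x y : (forall L, FL x L <= FL y L) -> F x <= F y.
  move=> h; have := ler_lim (cvgP _ (FE x)) (cvgP _ (FE y)).
  by rewrite (cvg_lim _ (FE x)) // (cvg_lim _ (FE y)) //; apply; apply: (@filterE _ U).
have Fge x (c : R) : (forall L, c <= FL x L) -> c <= F x.
  move=> h; have := limr_ge (x := c) (cvgP _ (FE x)).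
  by rewrite (cvg_lim _ (FE x)) //; apply; apply: (@filterE _ U).
have Fle1 x (c : R) : (forall L, FL x L <= c) -> F x <= c.
  move=> h; have := limr_le (x := c) (cvgP _ (FE x)).
  by rewrite (cvg_lim _ (FE x)) //; apply; apply: (@filterE _ U).
have F01 x : 0 <= F x <= 1.
  by rewrite Fge ?Fle1 // => L; case/andP: (FL01 x L).
have ndF : {homo F : x y / x <= y}.
  move=> x y xy; apply: Fle => L; apply: Emono => z _.
  by have [zx|] := leP z x; [rewrite (le_trans zx xy) | rewrite ler0n].
have Fneg x : x < 0 -> F x = 0.
  move=> x0; apply/eqP; rewrite eq_le; case/andP: (F01 x) => -> _; rewrite andbT.
  apply: Fle1 => L; rewrite -[leRHS](Ecst L 0); apply: Emono => y y0.
  by rewrite [y <= x]leNgt (lt_le_trans x0 y0).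
have FM : exists M, forall x, 0 < x -> 1 - M / x <= F x.
  exists M => x x0; apply: Fge => L; rewrite lerBlDr.
  (* Markov's inequality: where y > x, the quotient y / x is at least 1. *)
  rewrite -(E1 L) (@le_trans _ _ (E L (fun y => (y <= x)%R%:R + y / x))) //.
    apply: Emono => y y0; have [yx|xy] := leP y x; first by rewrite lerDl divr_ge0 // ltW.
    by rewrite add0r ler_pdivlMr // mul1r ltW.
  rewrite /E (eq_bigr (fun q => q.1 * (q.2 <= x)%R%:R + q.1 * q.2 / x)); last by move=> q _; rewrite mulrDr mulrA.
  by rewrite big_split /= lerD2l -mulr_suml ler_wpM2r // invr_ge0 ltW.
have [nu [nu0 nuF]] := right_cont_reg ndF F01 Fneg FM.
exists nu, U; split => // f l lf [C fC] vf.
have l0 : 0 <= l by have := lf 0 1; rewrite sub0r normrN normr1 mulr1; apply: le_trans.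
have mf : measurable_fun setT f by apply: continuous_measurable_fun; exact: lip_continuous lf.
apply/cvgrPdist_le => e e0.
have e80 : 0 < e / 8 by lra.
have [h [K [h0 lh fh]]] := stair_unif lf e80 (vf _ e80).
set S := stair f h K in fh.
pose c k := f (k%:R * h) - f (k.+1%:R * h).
pose g k := fine (nu `]-oo, k%:R * h]%classic).
have gE k : nu `]-oo, k%:R * h]%classic = (g k)%:E.
  by rewrite /g; have [x -> _] := nuF (k%:R * h).
have gF k : F (k%:R * h) <= g k <= F (k.+1%:R * h).
  have [x E2 [h1 h2]] := nuF (k%:R * h); rewrite /g E2 /= h1 h2 //.
  by rewrite ltr_pM2r // ltr_nat.
pose A := f (K%:R * h) + \sum_(k < K) c k * F (k%:R * h).
pose B := f (K%:R * h) + \sum_(k < K) c k * g k.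
(* [F] and the distribution function of [nu] may differ at grid points, but every |c k| is at most e
   / 4 and the differences are dominated by increments of [F], which telescope to at most 1. *)
have AB : `|A - B| <= e / 4.
  have -> : A - B = \sum_(k < K) c k * (F (k%:R * h) - g k).
    rewrite /A /B opprD addrACA subrr add0r -sumrB; apply: eq_bigr => k _; ring.
  apply: (le_trans (ler_norm_sum _ _ _)).
  have cle k : `|c k| <= e / 4.
    apply: (le_trans (lf _ _)); rewrite -mulrBl -natr1 opprD addrA subrr add0r mulN1r normrN gtr0_norm //.
    by apply: (le_trans lh); lra.
  apply: (@le_trans _ _ (\sum_(k < K) e / 4 * (F (k.+1%:R * h) - F (k%:R * h)))).
    apply: ler_sum => k _; rewrite normrM; apply: ler_pM => //.
    have /andP[h1 h2] := gF k; rewrite ler_distl.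
    by apply/andP; split; [lra | have := ndF (k%:R * h) (k.+1%:R * h); lra].
  rewrite -mulr_sumr -(big_mkord xpredT (fun k => F (k.+1%:R * h) - F (k%:R * h))) telescope_sumr //.
  have /andP[? ?] := F01 (K%:R * h); have /andP[? ?] := F01 (0%:R * h).
  rewrite ler_piMr //; lra.
have mI k : measurable `]-oo, k%:R * h]%classic by exact: measurable_itv.
have SE x : S x = f (K%:R * h) + \sum_(k < K) c k * \1_(`]-oo, k%:R * h]%classic) x.
  rewrite /S /stair; congr (_ + _); apply: eq_bigr => k _; congr (_ * _).
  by rewrite indicE mem_setE in_itv /=.
have iS : itg nu S.
  apply: itg_ext (fun x => esym (SE x)) _; apply: itgD; first exact: itg_cst.
  by apply: itg_sum => k _; apply: itgZ; exact: itg_indic.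
have ES : Ex nu S = B.
  rewrite (Ex_ext nu SE) ExD; [|exact: itg_cst|]; last first.
    by apply: itg_sum => k _; apply: itgZ; exact: itg_indic.
  rewrite Ex_cst Ex_sum; last by move=> k _; apply: itgZ; exact: itg_indic.
  congr (_ + _); apply: eq_bigr => k _; rewrite ExZ; last exact: itg_indic.
  by rewrite Ex_indic.
have if_ : itg nu f by apply: (itg_bounded nu mf fC).
have fB : `|Ex nu f - B| <= e / 4.
  rewrite -ES -ExB //; apply: (le_trans (Ex_abs (itgB if_ iS))).
  (* The staircase approximates [f] only on the half-line that carries [nu]; on its null complement
     a constant bound suffices. *)
  pose N := [set x : R | 0 <= x].
  have mN : measurable N.
    by rewrite (_ : N = `[0, +oo[%classic); [exact: measurable_itv | apply/seteqP; split => x; rewrite /N /= in_itv /= andbT].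
  have mNC : measurable (~` N) by exact: measurableC.
  pose CS := C + (`|f (K%:R * h)| + \sum_(k < K) `|c k|).
  have SC x : `|f x - S x| <= CS.
    rewrite (le_trans (ler_normB _ _)) // lerD // SE (le_trans (ler_normD _ _)) // lerD2l.
    rewrite (le_trans (ler_norm_sum _ _ _)) // ler_sum // => k _.
    by rewrite normrM indicE; case: (_ \in _); rewrite ?normr1 ?normr0 ?mulr1 ?mulr0.
  have iN := itg_indic nu mNC.
  apply: (@le_trans _ _ (Ex nu (fun x => e / 4 + CS * \1_(~` N) x))).
    apply: Ex_le; first by apply: itg_abs; exact: itgB.
      by apply: itgD; [exact: itg_cst | exact: itgZ].
    move=> x; have [x0|x0] := leP 0 x.
      rewrite indicE memNset ?mulr0 ?addr0; last by move=> /=; apply.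
      by apply: (le_trans (fh x x0)); lra.
    rewrite indicE mem_set ?mulr1; last by rewrite /N /=; apply/negP; rewrite -ltNge.
    by rewrite (le_trans (SC x)) // lerDr; lra.
  rewrite ExD; [|exact: itg_cst|exact: itgZ].
  rewrite Ex_cst ExZ // Ex_indic // probability_setC //.
  have -> : nu N = 1%E by exact: nu0.
  by rewrite subee //= mulr0 addr0.
have cE : E ^~ S @ U --> A.
  have -> : E ^~ S = (fun L => f (K%:R * h) + \sum_(k < K) c k * FL (k%:R * h) L).
    apply/funext => L; rewrite /E /FL /E -[X in _ = X + _](Ecst L) /E.
    under [X in _ = _ + X]eq_bigr do rewrite mulr_sumr.
    rewrite exchange_big /= -big_split /=; apply: eq_bigr => q _.
    rewrite /S /stair mulrDr mulr_sumr; congr (_ + _); apply: eq_bigr => k _.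
    by rewrite mulrCA.
  apply: cvgD; first exact: cvg_cst.
  apply: cvg_big => [|k _]; first exact: add_continuous.
  apply: cvgM; first exact: cvg_cst.
  exact: FE.
move/cvgrPdist_le : cE => /(_ _ e80).
apply: filterS => L AL.
have EfS : `|E L f - E L S| <= e / 4.
  rewrite /E -sumrB (le_trans (ler_norm_sum _ _ _)) //.
  rewrite -[leRHS](Ecst L) /E !big_seq; apply: ler_sum => q qD.
  have [q1 q2] := D0 L q qD.
  rewrite -mulrBr normrM ger0_norm // ler_wpM2l // (le_trans (fh _ q2)) //; lra.
have h1 : `|Ex nu f - E L f| <= `|Ex nu f - B| + `|A - B| + `|A - E L S| + `|E L f - E L S|.
  have -> : Ex nu f - E L f = (Ex nu f - B) - (A - B) + (A - E L S) - (E L f - E L S) by ring.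
  rewrite (le_trans (ler_normB _ _)) // lerD2r (le_trans (ler_normD _ _)) // lerD2r.
  by rewrite (le_trans (ler_normB _ _)).
by rewrite (le_trans h1) //; lra.
Unshelve. all: by end_near. Qed.

End WeakLimit.

(** * The equation of m_z versus the fixed point equation *)

Section MzAlgebra.
Variable R : rcfType.
Implicit Types (z s f : R[i]).

Lemma csqrt_ex (w : R[i]) : 0 < Imc w -> exists s, [/\ s ^+ 2 = w, 0 < Imc s & 0 < Rec s].
Proof.
move=> w0; have E := sqr_sqrtc w; set s := sqrtc w in E.
have ims : 0 < Rec s * Imc s.
  by move: w0; rewrite -E expr2 cImM [Imc s * _]mulrC; lra.
have [h|h] := ltP 0 (Imc s).
  by exists s; split => //; rewrite -(pmulr_lgt0 _ h).
exists (- s); rewrite sqrrN cImN cReN !oppr_gt0.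
have h2 : Imc s < 0 by rewrite lt_neqAle h andbT; apply/eqP => h0; move: ims; rewrite h0 mulr0 ltxx.
by split => //; rewrite -(nmulr_lgt0 _ h2).
Qed.

Lemma mz_to_g z s f : 0 < Imc s -> 0 < Imc (s * f) ->
  f = ((nc z ^+ 2)%:C%C / (1 + f) - (1 + f) * s ^+ 2)^-1 ->
  s * f = phi (nc z) (s + s * f).
Proof.
move=> s0 g0 fE.
have sn := im_neq0 s0.
have fn : f != 0 by apply/eqP => f0; move: g0; rewrite f0 mulr0 ltxx.
have f1 : 1 + f != 0.
  (* If 1 + f were 0, the convention that 0 has inverse 0 would turn the equation into f = 0. *)
  apply/eqP => h; move: fE; rewrite h invr0 mulr0 mul0r subr0 invr0.
  by move/eqP; rewrite (negbTE fn).
have u0 : 0 < Imc (s + s * f) by rewrite cImD addr_gt0.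
have d0 := den_neq0 (nc z) u0.
rewrite /phi; apply/(canRL (mulfK d0)).
have fV : f * ((nc z ^+ 2)%:C%C / (1 + f) - (1 + f) * s ^+ 2) = 1.
  by rewrite {1}fE mulVf //; apply: contra_neq fn => h; rewrite fE h invr0.
have -> : s + s * f = s * (1 + f) by ring.
rewrite -mulrA; congr (_ * _); rewrite -[RHS]mulr1 -[X in _ = _ * X]fV; field.
by rewrite f1.
Qed.

Lemma g_to_mz z s f : 0 < Imc s -> 0 < Imc (s * f) ->
  s * f = phi (nc z) (s + s * f) ->
  f = ((nc z ^+ 2)%:C%C / (1 + f) - (1 + f) * s ^+ 2)^-1.
Proof.
move=> s0 g0 gE.
have sn := im_neq0 s0.
have u0 : 0 < Imc (s + s * f) by rewrite cImD addr_gt0.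
have un := im_neq0 u0.
have d0 := den_neq0 (nc z) u0.
have f1 : 1 + f != 0 by apply: contra_neq un => h; rewrite -(mulr0 s) -h; ring.
have fn : f != 0 by apply/eqP => f0; move: g0; rewrite f0 mulr0 ltxx.
have E : s * f * ((nc z ^+ 2)%:C%C - (s * (1 + f)) ^+ 2) = s * (1 + f).
  have -> : s * (1 + f) = s + s * f by ring.
  by rewrite {1}gE /phi divfK.
have E2 : f * ((nc z ^+ 2)%:C%C / (1 + f) - (1 + f) * s ^+ 2) = 1.
  apply: (mulfI sn); apply: (mulIf f1); rewrite mulr1 -E; field.
  by rewrite f1.
have n2 : (nc z ^+ 2)%:C%C / (1 + f) - (1 + f) * s ^+ 2 != 0.
  by apply/eqP => h; move/eqP: E2; rewrite h mulr0 eq_sym oner_eq0.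
by apply: (mulIf n2); rewrite E2 mulVf.
Qed.

Lemma mz_unique z s f1 f2 : 0 < Imc s -> 0 < Imc (s * f1) -> 0 < Imc (s * f2) ->
  f1 = ((nc z ^+ 2)%:C%C / (1 + f1) - (1 + f1) * s ^+ 2)^-1 ->
  f2 = ((nc z ^+ 2)%:C%C / (1 + f2) - (1 + f2) * s ^+ 2)^-1 -> f1 = f2.
Proof.
move=> s0 h1 h2 E1 E2; apply: (mulfI (im_neq0 s0)).
by apply: (exact_unique (nc_ge0 z) s0 h1 h2); rewrite -/(phi _ _) -mz_to_g.
Qed.

Lemma phi_lip r s (u w : R[i]) : 0 < Imc s -> Imc s <= Imc u -> Imc s <= Imc w ->
  nc (phi r u - phi r w) <= nc (u - w) * (Imc s)^-1 ^+ 2.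
Proof.
move=> s0 su sw; rewrite phi_diff ?(lt_le_trans s0) // ncM ler_wpM2l ?nc_ge0 //.
have h x : Imc s <= Imc x -> nfun r x <= (Imc s)^-1 ^+ 2.
  move=> sx; rewrite /nfun.
  have h1 : nc (x - r%:C%C)^-1 <= (Imc s)^-1 by rewrite nc_inv_le // cImD cImN /= subr0.
  have h2 : nc (x + r%:C%C)^-1 <= (Imc s)^-1 by rewrite nc_inv_le // cImD /= addr0.
  have := nc_ge0 (x - r%:C%C)^-1; have := nc_ge0 (x + r%:C%C)^-1.
  move: h1 h2; set p := nc _; set q := nc _; set t := _^-1 => h1 h2 h3 h4.
  nra.
have := kappa_le r u w; set k := nc _ => kk.
have k0 : 0 <= k by exact: nc_ge0.
have hu := h _ su; have hw := h _ sw.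
have nf0 x : 0 <= nfun r x by rewrite (le_trans _ (mfun_sq r x)) // sqr_ge0.
have h3 : nfun r u * nfun r w <= (Imc s)^-1 ^+ 2 * (Imc s)^-1 ^+ 2 by apply: ler_pM.
have t0 : 0 <= (Imc s)^-1 ^+ 2 by exact: sqr_ge0.
move: (_^-1 ^+ 2) t0 h3 => t t0 h3; nra.
Qed.
End MzAlgebra.

(** * The Stieltjes kernel and its signs *)

Section Kernel.
Variable R : realType.
Implicit Types (w : R[i]).

Definition sre w (x : R) : R := (x - Rec w) / ((x - Rec w) ^+ 2 + Imc w ^+ 2).
Definition sim w (x : R) : R := Imc w / ((x - Rec w) ^+ 2 + Imc w ^+ 2).

Lemma nc2B (x : R) w : nc (x%:C%C - w) ^+ 2 = (x - Rec w) ^+ 2 + Imc w ^+ 2.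
Proof. by rewrite nc_sq cReD cImD cReN cImN /= sub0r sqrrN. Qed.
Lemma sreE w x : sre w x = Rec (x%:C%C - w)^-1.
Proof. by rewrite cReV nc2B cReD cReN. Qed.
Lemma simE w x : sim w x = Imc (x%:C%C - w)^-1.
Proof. by rewrite cImV nc2B cImD cImN /= sub0r opprK. Qed.
Lemma stieltjesE (nu : probability R R) w :
  stieltjes nu w = Complex (Ex nu (sre w)) (Ex nu (sim w)).
Proof. by []. Qed.

Lemma den_ge0 w (x : R) : 0 <= (x - Rec w) ^+ 2 + Imc w ^+ 2.
Proof. by rewrite addr_ge0 ?sqr_ge0. Qed.

Lemma meas_den w : measurable_fun setT (fun x : R => ((x - Rec w) ^+ 2 + Imc w ^+ 2)^-1).
Proof.
apply: measurable_inv_ge0 => [x|]; first exact: den_ge0.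
apply: measurable_funD => //; apply: measurable_funX; exact: measurable_funB.
Qed.
Lemma meas_sre w : measurable_fun setT (sre w).
Proof. by apply: measurable_funM; [exact: measurable_funB | exact: meas_den]. Qed.
Lemma meas_sim w : measurable_fun setT (sim w).
Proof. by apply: measurable_funM => //; exact: meas_den. Qed.

Lemma inv_lip w (x y : R) : 0 < Imc w ->
  nc ((x%:C%C - w)^-1 - (y%:C%C - w)^-1) <= (Imc w)^-1 ^+ 2 * `|x - y|.
Proof.
move=> w0; have n0 v : (v : R)%:C%C - w != 0 by rewrite realB_neq0 // gt_eqF.
have -> : (x%:C%C - w)^-1 - (y%:C%C - w)^-1 = (y - x)%:C%C * ((x%:C%C - w)^-1 * (y%:C%C - w)^-1).
  by rewrite rmorphB /=; field; rewrite !n0.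
have h v : nc ((v : R)%:C%C - w)^-1 <= (Imc w)^-1.
  by rewrite -ncN -invrN nc_inv_le // opprB cImD cImN /= subr0.
rewrite ncM nc_real distrC mulrC ler_wpM2r // ncM; apply: ler_pM; rewrite ?nc_ge0 //.
Qed.

Lemma inv_vanish w (e : R) : 0 < e -> exists B : R, forall x, B <= x -> nc (x%:C%C - w)^-1 <= e.
Proof.
move=> e0; exists (Rec w + e^-1) => x xB.
rewrite ncV invf_ple ?posrE //; last first.
  rewrite (lt_le_trans _ (nc_re _)) // cReD cReN /= normr_gt0.
  have : 0 < e^-1 by rewrite invr_gt0.
  by apply: contraTneq => h; rewrite -leNgt; lra.
by rewrite (le_trans _ (nc_re _)) // cReD cReN /= (le_trans _ (ler_norm _)) //; lra.
Qed.

Lemma inv_bound w (x : R) : 0 < Imc w -> nc (x%:C%C - w)^-1 <= (Imc w)^-1.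
Proof. by move=> w0; rewrite -ncN -invrN nc_inv_le // opprB cImD cImN /= subr0. Qed.

(* Restricting to x >= 0 makes the kernel bounded even when w is a negative real number. *)
Lemma stieltjes_im_gt0 (nu : probability R R) (s : R[i]) : nu [set x | 0 <= x] = 1%E ->
  0 < Imc s -> 0 < Imc (s * stieltjes nu (s ^+ 2)).
Proof.
move=> nu1 s0; set w := s ^+ 2.
pose N := [set x : R | 0 <= x].
have mN : measurable N.
  by rewrite (_ : N = `[0, +oo[%classic); [exact: measurable_itv | apply/seteqP; split => x; rewrite /N /= in_itv /= andbT].
pose m (x : R) := Num.max x 0.
have mm : measurable_fun setT m by apply: measurable_maxr => //; exact: measurable_cst.
have m0 x : 0 <= m x by rewrite /m le_max lexx orbT.
have b0 : 0 < Imc s ^+ 2 by rewrite exprn_gt0.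
have reim : Rec w = Rec s ^+ 2 - Imc s ^+ 2 /\ Imc w = 2 * Rec s * Imc s.
  by rewrite /w expr2 cReM cImM; split; ring.
have [rew imw] := reim.
have dE x : (x - Rec w) ^+ 2 + Imc w ^+ 2 = (x + Imc s ^+ 2 - Rec s ^+ 2) ^+ 2 + 4 * Rec s ^+ 2 * Imc s ^+ 2.
  by rewrite rew imw; ring.
have d0 x : 0 <= x -> Imc s ^+ 2 ^+ 2 <= (x - Rec w) ^+ 2 + Imc w ^+ 2.
  move=> x0; rewrite dE; move: (Imc s ^+ 2) b0 (Rec s ^+ 2) (sqr_ge0 (Rec s)) => b b0 a a0.
  have := sqr_ge0 (x - a); have := mulr_ge0 x0 (ltW b0); have := mulr_ge0 a0 (ltW b0); nra.
pose h x := Rec s * sim w (m x) + Imc s * sre w (m x).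
have ncb x : nc ((m x)%:C%C - w)^-1 <= (Imc s ^+ 2)^-1.
  rewrite ncV lef_pV2 ?posrE //; last first.
    rewrite nc_gt0; apply/eqP => E; have := d0 _ (m0 x); rewrite -nc2B E nc0 expr0n /=.
    by rewrite leNgt exprn_gt0.
  have := d0 _ (m0 x); rewrite -nc2B; move: (nc _) (nc_ge0 ((m x)%:C%C - w)) => v v0.
  by move: (Imc s ^+ 2) b0 => b b0; nra.
have hpos x : 0 < h x.
  have D0 : 0 < (m x - Rec w) ^+ 2 + Imc w ^+ 2 by rewrite (lt_le_trans _ (d0 _ (m0 x))) // exprn_gt0.
  (* [h x] is the imaginary part of s / (x - s^2) at [m x]; its numerator Im s (x + |s|^2) is
     positive for x >= 0. *)
  have -> : h x = Imc s * (m x + (Rec s ^+ 2 + Imc s ^+ 2)) / ((m x - Rec w) ^+ 2 + Imc w ^+ 2).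
    rewrite /h /sim /sre !mulrA -mulrDl; congr (_ / _); rewrite rew imw; ring.
  rewrite divr_gt0 // mulr_gt0 // ltr_wpDl // ltr_wpDl // sqr_ge0 //.
have is1 : itg nu (fun x => sre w (m x)).
  apply: (@itg_bounded _ _ _ _ _ (Imc s ^+ 2)^-1).
    exact: measurableT_comp (meas_sre w) mm.
  by move=> x; rewrite sreE (le_trans (nc_re _)).
have is2 : itg nu (fun x => sim w (m x)).
  apply: (@itg_bounded _ _ _ _ _ (Imc s ^+ 2)^-1).
    exact: measurableT_comp (meas_sim w) mm.
  by move=> x; rewrite simE (le_trans (nc_im _)).
have mx x : N x -> m x = x by move=> Nx; rewrite /m max_l.
have -> : Imc (s * stieltjes nu w) = Ex nu h.
  rewrite /h ExD; [|exact: itgZ|exact: itgZ]; rewrite (ExZ _ is2) (ExZ _ is1).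
  rewrite cImM stieltjesE /=; congr (_ * _ + _ * _); apply: (Ex_ae mN nu1).
  - exact: meas_sim.
  - exact: measurableT_comp (meas_sim w) mm.
  - by move=> x /mx ->.
  - exact: meas_sre.
  - exact: measurableT_comp (meas_sre w) mm.
  - by move=> x /mx ->.
by apply: Ex_gt0 => //; apply: itgD; exact: itgZ.
Qed.

Lemma stieltjes_im_gt0' (nu : probability R R) w : 0 < Imc w -> 0 < Imc (stieltjes nu w).
Proof.
move=> w0; rewrite stieltjesE /=; apply: Ex_gt0.
  apply: (@itg_bounded _ _ _ _ _ (Imc w)^-1); first exact: meas_sim.
  by move=> x; rewrite simE (le_trans (nc_im _)) // inv_bound.
by move=> x; rewrite /sim divr_gt0 // ltr_wpDl ?sqr_ge0 // exprn_gt0.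
Qed.
End Kernel.

Section Existence.
Variable R : realType.

Lemma treeg_cauchy (r : R) (s : R[i]) (e : R) : 0 < Imc s -> 0 < e ->
  \forall L \near \oo, nc (treeg r L.+1 s - treeg r L s) <= e.
Proof.
move=> s0 e0; set t := Imc s in s0 *.
set q : R := (1 + t ^+ 2)^-1 ^+ 2.
have t2 : 0 < t ^+ 2 by rewrite exprn_gt0.
have q1 : `|q| < 1.
  have v0 : 0 <= (1 + t ^+ 2)^-1 by rewrite invr_ge0 addr_ge0 // ltW.
  have v1 : (1 + t ^+ 2)^-1 < 1 by rewrite invf_lt1 ?ltrDl // addr_gt0.
  by rewrite ger0_norm ?sqr_ge0 // expr_lt1.
have C0 : 0 < t^-1 ^+ 6 by rewrite exprn_gt0 // invr_gt0.
have e2 : 0 < e ^+ 2 / t^-1 ^+ 6 by rewrite divr_gt0 // exprn_gt0.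
have /cvgrPdist_le /(_ _ e2) := cvg_expr q1.
apply: filterS => L; rewrite sub0r normrN ger0_norm => [h|]; last by apply: exprn_ge0; exact: sqr_ge0.
have h2 := treeg_diff_le r s0 L; rewrite -/t -/q in h2.
have h3 : nc (treeg r L.+1 s - treeg r L s) ^+ 2 <= e ^+ 2.
  by rewrite (le_trans h2) // mulrC -ler_pdivlMr.
by move: h3; rewrite ler_pXn2r // nnegrE ?nc_ge0 // ltW.
Qed.

(** The identity 2 s / (x^2 - s^2) = 1 / (x - s) - 1 / (x + s) expresses the transform of the law of
    the squares by the values at s and -s, and the iterates are odd in s. *)
Lemma st_sq (T : seq (R * R)) (r : R) L (s : R[i]) : Imc s != 0 -> Imc (s ^+ 2) != 0 ->
  (forall v, Imc v != 0 -> st T v = treeg r L v) ->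
  \sum_(q <- T) q.1%:C%C * ((q.2 ^+ 2)%:C%C - s ^+ 2)^-1 = treeg r L s / s.
Proof.
move=> s0 w0 TE.
have sn : s != 0 by apply: contra_neq s0 => ->.
apply: (mulfI (_ : 2%:R * s != 0)); first by rewrite mulf_neq0 // pnatr_eq0.
transitivity (st T s - st T (- s)); last first.
  by rewrite TE // TE ?cImN ?oppr_eq0 // treegN opprK; field.
rewrite /st -sumrB mulr_sumr; apply: eq_bigr => q _.
have h1 : q.2%:C%C - s != 0 by rewrite realB_neq0.
have h2 : q.2%:C%C + s != 0 by rewrite -[s]opprK realB_neq0 // cImN oppr_eq0.
rewrite opprK rmorphXn /= (_ : _ ^+ 2 - _ = (q.2%:C%C - s) * (q.2%:C%C + s)); last by ring.
by field; rewrite h1 h2.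
Qed.

(** [nu] and the ultrafilter are fixed before w. Along the ultrafilter the iterates divided by s
    converge to the transform of [nu]; as successive iterates become arbitrarily close, their limit
    solves the equation. *)
Theorem limit_law_exists (z : R[i]) : exists nu : probability R R,
  nu [set x | 0 <= x] = 1%E /\
  forall w, 0 < Imc w -> mz_relations z (stieltjes nu) w.
Proof.
set r := nc z.
pose T L := sval (cid (tree_measure r L)).
have TP L := svalP (cid (tree_measure r L)); rewrite -/(T _) in TP.
pose D L := [seq (q.1, q.2 ^+ 2) | q <- T L].
have [|||nu [U [UU Uoo nu1 nuE]]] := @weak_limit R D (r ^+ 2 + 1).
- move=> L q /mapP[q' q'T ->] /=; have [[p1 _] _ _] := TP L.
  by split; [exact: p1 | exact: sqr_ge0].
- by move=> L; rewrite big_map /=; have [[_ ->] _ _] := TP L.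
- by move=> L; rewrite big_map /=; have [_ + _] := TP L.
exists nu; split => // w w0.
have [s [sw s0 rs0]] := csqrt_ex w0.
have m0 : 0 < Imc (s * stieltjes nu w) by rewrite -sw; exact: stieltjes_im_gt0.
split; [|exact: stieltjes_im_gt0|exact: stieltjes_im_gt0'].
have -> : (1 + stieltjes nu w) * w = (1 + stieltjes nu w) * s ^+ 2 by rewrite sw.
apply: g_to_mz => //; set m := stieltjes nu w in m0 *.
have cre : (fun L => Rec (treeg r L s / s)) @ U --> Rec m.
  have -> : (fun L => Rec (treeg r L s / s)) = (fun L => \sum_(q <- D L) q.1 * sre w q.2).
    apply/funext => L; have [_ _ TL] := TP L.
    rewrite -(st_sq _ _ TL) ?sw ?gt_eqF // Re_sum big_map; apply: eq_bigr => q _ /=.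
    by rewrite cReZ sreE.
  apply: (nuE _ ((Imc w)^-1 ^+ 2)).
  - by move=> x y; rewrite !sreE -cReN -cReD (le_trans (nc_re _)) // inv_lip.
  - by exists (Imc w)^-1 => x; rewrite sreE (le_trans (nc_re _)) // inv_bound.
  - move=> e e0; have [B hB] := inv_vanish w e0; exists B => x xB.
    by rewrite sreE (le_trans (nc_re _)) // hB.
have cim : (fun L => Imc (treeg r L s / s)) @ U --> Imc m.
  have -> : (fun L => Imc (treeg r L s / s)) = (fun L => \sum_(q <- D L) q.1 * sim w q.2).
    apply/funext => L; have [_ _ TL] := TP L.
    rewrite -(st_sq _ _ TL) ?sw ?gt_eqF // Im_sum big_map; apply: eq_bigr => q _ /=.
    by rewrite cImZ simE.
  apply: (nuE _ ((Imc w)^-1 ^+ 2)).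
  - by move=> x y; rewrite !simE -cImN -cImD (le_trans (nc_im _)) // inv_lip.
  - by exists (Imc w)^-1 => x; rewrite simE (le_trans (nc_im _)) // inv_bound.
  - move=> e e0; have [B hB] := inv_vanish w e0; exists B => x xB.
    by rewrite simE (le_trans (nc_im _)) // hB.
set g := s * m in m0 *.
have sn := im_neq0 s0.
(* K adds up three errors: replacing the limit by an iterate, passing to the next iterate, and the
   first error multiplied by the Lipschitz constant of Phi. *)
pose K := 2 * nc s + 1 + 2 * nc s * (Imc s)^-1 ^+ 2.
have K0 : 0 < K.
  have k1 : 0 <= 2 * nc s by rewrite mulr_ge0 ?nc_ge0.
  have k2 := mulr_ge0 k1 (sqr_ge0 (Imc s)^-1); rewrite /K; lra.
suff h e : 0 < e -> nc (g - phi r (s + g)) <= K * e.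
  apply: subr0_eq; apply: Normc.eq0_normc; apply/eqP; rewrite eq_le nc_ge0 andbT; apply/ler_addgt0Pr => e e0.
  by rewrite add0r (le_trans (h (e / K) _)) ?divr_gt0 // mulrC divfK // gt_eqF.
move=> e0.
have n1 : \forall L \near U, `|Rec m - Rec (treeg r L s / s)| <= e by move/cvgrPdist_le: cre; apply.
have n2 : \forall L \near U, `|Imc m - Imc (treeg r L s / s)| <= e by move/cvgrPdist_le: cim; apply.
have n3 : \forall L \near U, nc (treeg r L.+1 s - treeg r L s) <= e by apply: Uoo; exact: treeg_cauchy.
have [L [[h1 h2] h3]] := @filter_ex _ U _ _ (filterI (filterI n1 n2) n3).
set a := treeg r L s in h1 h2 h3.
have ga : nc (g - a) <= 2 * nc s * e.
  have -> : g - a = s * (m - a / s) by rewrite /g; field.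
  rewrite ncM [2 * _]mulrC -mulrA ler_wpM2l ?nc_ge0 // (le_trans (nc_reim _)) //.
  by rewrite cReD cReN cImD cImN; lra.
have pg : nc (phi r (s + a) - phi r (s + g)) <= nc (g - a) * (Imc s)^-1 ^+ 2.
  have -> : nc (g - a) = nc (s + a - (s + g)) by rewrite -ncN; congr nc; ring.
  apply: phi_lip => //; rewrite cImD lerDl ltW //; exact: treeg_im.
have -> : g - phi r (s + g) = (g - a) - (treeg r L.+1 s - a) + (phi r (s + a) - phi r (s + g)).
  by rewrite treegS -/a; ring.
apply: (le_trans (ncD _ _)).
have h4 := ncB (g - a) (treeg r L.+1 s - a).
have h5 := ler_wpM2r (sqr_ge0 (Imc s)^-1) ga.
rewrite /K; move: (_^-1 ^+ 2) pg h5 => X pg h5; nra.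
Qed.

(** For a square root s of w, the equation is used at w but the sign condition at s, because it
    concerns s f(s^2). Hence the relations enter at two points of the half-plane. *)
Theorem limit_law_unique (z : R[i]) (f1 f2 : R[i] -> R[i]) :
  (forall w, 0 < Imc w -> mz_relations z f1 w) ->
  (forall w, 0 < Imc w -> mz_relations z f2 w) ->
  forall w, 0 < Imc w -> f1 w = f2 w.
Proof.
move=> h1 h2 w w0; have [s [sw s0 rs0]] := csqrt_ex w0.
have [e1 _ _] := h1 _ w0; have [_ g1 _] := h1 _ s0.
have [e2 _ _] := h2 _ w0; have [_ g2 _] := h2 _ s0.
rewrite sw in g1 g2; rewrite -{4}sw in e1; rewrite -{4}sw in e2.
exact: (mz_unique (z := z) s0 g1 g2).
Qed.

End Existence.

(** * Product laws on finite configurations *)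

Section Rectangles.
Context (K : finType) d' (V : measurableType d').

Definition rect (B : K -> set V) : set (K -> V) := [set y | forall k, B k (y k)].
Definition rects : set (set (K -> V)) :=
  [set A | exists2 B : K -> set V, (forall k, measurable (B k)) & A = rect B].
(** The product space of all entry values. On it, unlike on an arbitrary probability space, single
    coordinates can be redrawn or set to 0. *)
Definition config := g_sigma_algebraType rects.

Lemma measurable_rect B : (forall k, measurable (B k)) -> measurable (rect B : set config).
Proof. by move=> mB; apply: sub_sigma_algebra; exists B. Qed.

Lemma rect1 k (A : set V) :
  [set y : K -> V | A (y k)] = rect (fun j => if j == k then A else setT).
Proof.
apply/seteqP; split => y /= h; first by move=> j; case: eqP => // ->.
by have := h k; rewrite eqxx.
Qed.

Lemma measurable_coord k : measurable_fun setT (fun y : config => y k).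
Proof.
move=> _ A mA; rewrite setTI (_ : _ @^-1` _ = rect (fun j => if j == k then A else setT)).
  by apply: measurable_rect => j; case: ifP.
exact: rect1.
Qed.

Lemma measurable_config d (T : measurableType d) (f : T -> config) :
  (forall k, measurable_fun setT (fun t => f t k)) -> measurable_fun setT f.
Proof.
move=> mf; apply: (@measurability _ _ T config setT f rects erefl) => _ [_ [B mB ->] <-].
rewrite setTI (_ : f @^-1` _ = \bigcap_(k in [set: K]) ((fun t => f t k) @^-1` B k)).
  apply: fin_bigcap_measurable; first exact: finite_finset.
  by move=> k _; rewrite -[X in measurable X]setTI; exact: mf.
apply/seteqP; split => t /= h; first by move=> k _; exact: h.
by move=> k; exact: h.
Qed.

Lemma rects_setI : setI_closed rects.
Proof.
move=> _ _ [B mB ->] [B' mB' ->]; exists (fun k => B k `&` B' k).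
  by move=> k; exact: measurableI.
apply/seteqP; split => y /=; first by move=> [h h'] k; split; [exact: h | exact: h'].
by move=> h; split => k; have [] := h k.
Qed.

Lemma rectT : rect (fun=> setT) = setT.
Proof. by apply/seteqP; split. Qed.

(** Rectangles generate the sigma-algebra and are stable under intersection, so the pi-lambda
    theorem applies. *)
Lemma config_measure_unique (R : realType) (P1 P2 : probability config R) :
  (forall B, (forall k, measurable (B k)) -> P1 (rect B) = P2 (rect B)) ->
  forall A, measurable A -> P1 A = P2 A.
Proof.
move=> h A mA; have c1 : \bigcup_(_ : nat) (setT : set config) = setT by rewrite bigcup_const.
have c2 : nat -> rects setT by move=> _; exists (fun=> setT) => //; rewrite rectT.
have c3 (E : set config) : rects E -> P1 E = P2 E by move=> [B mB ->]; exact: h.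
have c4 : nat -> (P1 setT < +oo)%E by move=> _; rewrite probability_setT ltry.
exact: (@measure_unique _ R config rects (fun=> setT) erefl rects_setI c2 c1 P1 P2 c3 c4 A mA).
Qed.
End Rectangles.

Section Transfer.
Context d d' (T : measurableType d) (S : measurableType d') (R : realType).
Variables (P : probability T R) (Q : probability S R) (f : T -> S).
Hypothesis mf : measurable_fun setT f.
Hypothesis PQ : forall A, measurable A -> P (f @^-1` A) = Q A.

Lemma transfer_itg (F : S -> R) : itg Q F -> itg P (F \o f).
Proof.
move=> hF; have mF := itg_meas hF; apply/integrableP; split.
  by apply/measurable_EFinP; exact: measurableT_comp.
have /integrableP[_] := hF; apply: le_lt_trans.
have -> : (\int[Q]_x `|(EFin \o F) x| = \int[pushforward P f]_x `|(EFin \o F) x|)%E.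
  apply: eq_measure_integral => A mA _; rewrite /pushforward; exact/esym/PQ.
rewrite ge0_integral_pushforward //; first by apply: measurableT_comp => //; apply/measurable_EFinP.
Qed.

Lemma transfer_Ex (F : S -> R) : itg Q F -> Ex P (F \o f) = Ex Q F.
Proof.
move=> hF; have mF := itg_meas hF; rewrite /Ex /Rintegral; congr fine.
have -> : (\int[Q]_x (F x)%:E = \int[pushforward P f]_x (F x)%:E)%E.
  apply: eq_measure_integral => A mA _; rewrite /pushforward; exact/esym/PQ.
rewrite integral_pushforward //.
- exact/measurable_EFinP.
- exact: transfer_itg.
Qed.

Lemma transfer_CE (u : S -> R[i]) : citg Q u -> CE P (u \o f) = CE Q u.
Proof.
move=> [a b]; apply: complex_ext => /=; first exact: transfer_Ex a.
exact: transfer_Ex b.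
Qed.
End Transfer.

Section FubiniReal.
Context d1 d2 (T1 : measurableType d1) (T2 : measurableType d2) (R : realType).
Variables (P1 : probability T1 R) (P2 : probability T2 R).

Lemma Ex_prod (F : T1 * T2 -> R) : itg (P1 \x P2)%E F ->
  (forall x, itg P2 (fun y => F (x, y))) ->
  itg P1 (fun x => Ex P2 (fun y => F (x, y))) /\
  Ex (P1 \x P2)%E F = Ex P1 (fun x => Ex P2 (fun y => F (x, y))).
Proof.
move=> hF h2.
have FE x : (fubini_F P2 (EFin \o F) x = (Ex P2 (fun y => F (x, y)))%:E)%E.
  by rewrite /fubini_F -Ex_fin.
split; last first.
  rewrite {1 2}/Ex /Rintegral -integral12_prod_meas1 //; congr fine.
  by apply: eq_integral => x _; rewrite FE.
have := integrable_fubini_F hF.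
by apply: eq_integrable => // x _; rewrite FE.
Qed.
End FubiniReal.

(** * Resampling and independence under a product law *)

Section IID.
Context (K : finType) d' (V : measurableType d') (R : realType).
Local Notation Om := (config K V).
Variables (Q : probability Om R) (mu : probability V R).

Definition iid_law : Prop := forall B : K -> set V, (forall k, measurable (B k)) ->
  Q (rect B) = (\prod_k mu (B k))%E.
Hypothesis iid : iid_law.

Definition mix (A : pred K) (y y' : Om) : Om := fun k => if A k then y' k else y k.

Lemma measurable_mix A : measurable_fun setT (fun z : Om * Om => mix A z.1 z.2).
Proof.
apply: measurable_config => k; rewrite /mix; case: (A k).
  by apply: (measurableT_comp (measurable_coord k)); exact: measurable_snd.
by apply: (measurableT_comp (measurable_coord k)); exact: measurable_fst.
Qed.

(** Each coordinate of the mixture comes from exactly one of two independent copies, so the measure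
    of a rectangle factors as before. *)
Lemma mix_law A : forall E, measurable E ->
  (Q \x Q)%E ((fun z : Om * Om => mix A z.1 z.2) @^-1` E) = Q E.
Proof.
pose M := isMeasurableFun.Build _ _ _ _ _ (measurable_mix A).
pose X : {mfun (Om * Om)%type >-> Om} := HB.pack (fun z : Om * Om => mix A z.1 z.2) M.
move=> E mE; apply: (@config_measure_unique _ _ _ _ (distribution (Q \x Q)%E X) Q) => // B mB.
transitivity ((Q \x Q)%E (rect (fun k => if A k then setT else B k) `*` rect (fun k => if A k then B k else setT))).
  congr ((Q \x Q)%E _); apply/seteqP; split => [[y y'] /= h|[y y'] /= [h1 h2] k].
    by split => k; have := h k; rewrite /= /mix; case: (A k).
  by have := h1 k; have := h2 k; rewrite /= /mix; case: (A k).
have m1 k : measurable (if A k then setT else B k) by case: (A k).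
have m2 k : measurable (if A k then B k else setT) by case: (A k).
have PE (A1 A2 : set Om) : measurable A1 -> measurable A2 -> (Q \x Q)%E (A1 `*` A2) = (Q A1 * Q A2)%E.
  by move=> ? ?; apply: product_measure1E.
rewrite PE; [|exact: measurable_rect|exact: measurable_rect].
rewrite (iid m1) (iid m2) (iid mB).
rewrite -big_split; apply: eq_bigr => k _; case: (A k).
  by rewrite probability_setT /= mul1e.
by rewrite probability_setT /= mule1.
Qed.

(** Under an iid law this is a version of the conditional expectation given the coordinates outside
    [A], defined at every point. *)
Definition resample A (F : Om -> R) : Om -> R := fun y => Ex Q (fun y' => F (mix A y y')).

Lemma measurable_mix2 A y : measurable_fun setT (fun y' : Om => mix A y y').
Proof.
apply: measurable_config => k; rewrite /mix; case: (A k).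
  exact: measurable_coord.
exact: measurable_cst.
Qed.

Lemma resample_itg (A : pred K) (F : Om -> R) (C : R) : measurable_fun setT F -> (forall y, `|F y| <= C) ->
  itg Q (resample A F) /\ Ex Q (resample A F) = Ex Q F.
Proof.
move=> mF FC.
have hF : itg Q F by exact: (itg_bounded Q mF FC).
have h1 : itg (Q \x Q)%E (fun z => F (mix A z.1 z.2)).
  exact: (transfer_itg (measurable_mix A) (mix_law A) hF).
have h2 x : itg Q (fun y => F (mix A x y)).
  apply: (itg_bounded Q (C := C)) => [|y]; last exact: FC.
  by apply: measurableT_comp mF _; exact: measurable_mix2.
have [h3 h4] := Ex_prod h1 h2.
split; first exact: h3.
by rewrite -[RHS](transfer_Ex (measurable_mix A) (mix_law A) hF) -h4.
Qed.

Lemma resample_bound (A : pred K) (F : Om -> R) (C : R) y : measurable_fun setT F -> (forall y, `|F y| <= C) -> `|resample A F y| <= C.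
Proof.
move=> mF FC.
have h2 : itg Q (fun y' => F (mix A y y')).
  apply: (itg_bounded Q (C := C)) => [|y']; last exact: FC.
  by apply: measurableT_comp mF _; exact: measurable_mix2.
apply: (le_trans (Ex_abs h2)); rewrite -[leRHS](Ex_cst Q C).
by apply: Ex_le; [exact: itg_abs | exact: itg_cst | move=> y'; exact: FC].
Qed.

(** Drawing coordinate [k] from a second copy makes [phi] a function of one copy and [psi] of the
    other; Fubini then factors the expectation. *)
Lemma Ex_indep k (phi psi : Om -> R) (C : R) :
  (forall y y', y k = y' k -> phi y = phi y') ->
  (forall y y', (forall j, j != k -> y j = y' j) -> psi y = psi y') ->
  itg Q phi -> measurable_fun setT psi -> (forall y, `|psi y| <= C) ->
  Ex Q (fun y => phi y * psi y) = Ex Q phi * Ex Q psi.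
Proof.
move=> phik psik iphi mpsi psiC.
have hF : itg Q (fun y => phi y * psi y) by exact: itgM_bounded iphi mpsi psiC.
pose A := pred1 k.
have h1 : itg (Q \x Q)%E (fun z => phi (mix A z.1 z.2) * psi (mix A z.1 z.2)).
  exact: (transfer_itg (measurable_mix A) (mix_law A) hF).
have FE x y : phi (mix A x y) * psi (mix A x y) = phi y * psi x.
  congr (_ * _); first by apply: phik; rewrite /mix /A /= eqxx.
  by apply: psik => j jk; rewrite /mix /A /= (negbTE jk).
have h2 x : itg Q (fun y => phi (mix A x y) * psi (mix A x y)).
  by apply: (itg_ext (fun y => esym (FE x y))); exact: itgZr.
have [_ h4] := Ex_prod h1 h2.
rewrite -(transfer_Ex (measurable_mix A) (mix_law A) hF) h4.
rewrite (@Ex_ext _ _ _ _ _ (fun x => Ex Q phi * psi x)); last first.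
  by move=> x; rewrite (Ex_ext Q (FE x)) ExZr.
rewrite ExZ //; exact: (itg_bounded Q mpsi psiC).
Qed.

Lemma CE_indep k (phi psi : Om -> R[i]) (C : R) :
  (forall y y', y k = y' k -> phi y = phi y') ->
  (forall y y', (forall j, j != k -> y j = y' j) -> psi y = psi y') ->
  citg Q phi -> cmeas psi -> (forall y, nc (psi y) <= C) ->
  CE Q (fun y => phi y * psi y) = CE Q phi * CE Q psi.
Proof.
move=> phik psik [i1 i2] [m1 m2] psiC.
have b1 y : `|Rec (psi y)| <= C by rewrite (le_trans (nc_re _)).
have b2 y : `|Imc (psi y)| <= C by rewrite (le_trans (nc_im _)).
have e1 y y' : y k = y' k -> Rec (phi y) = Rec (phi y') by move=> /phik ->.
have e2 y y' : y k = y' k -> Imc (phi y) = Imc (phi y') by move=> /phik ->.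
have e3 y y' : (forall j, j != k -> y j = y' j) -> Rec (psi y) = Rec (psi y') by move=> /psik ->.
have e4 y y' : (forall j, j != k -> y j = y' j) -> Imc (psi y) = Imc (psi y') by move=> /psik ->.
apply: complex_ext; rewrite ?cReM ?cImM /=.
  rewrite (Ex_ext Q (fun y => cReM (phi y) (psi y))).
  rewrite ExB; [|exact: itgM_bounded i1 m1 b1|exact: itgM_bounded i2 m2 b2].
  by rewrite (Ex_indep e1 e3 i1 m1 b1) (Ex_indep e2 e4 i2 m2 b2).
rewrite (Ex_ext Q (fun y => cImM (phi y) (psi y))).
rewrite ExD; [|exact: itgM_bounded i1 m2 b2|exact: itgM_bounded i2 m1 b1].
by rewrite (Ex_indep e1 e4 i1 m2 b2) (Ex_indep e2 e3 i2 m1 b1).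
Qed.

Lemma measurable_perm (sg : K -> K) : measurable_fun setT (fun y : Om => (fun k => y (sg k)) : Om).
Proof. by apply: measurable_config => k; exact: measurable_coord. Qed.

Lemma perm_law (sg sg' : K -> K) : cancel sg sg' -> cancel sg' sg -> forall E, measurable E ->
  Q ((fun y : Om => (fun k => y (sg k)) : Om) @^-1` E) = Q E.
Proof.
move=> sgK sgK'.
pose M := isMeasurableFun.Build _ _ _ _ _ (measurable_perm sg).
pose X : {mfun Om >-> Om} := HB.pack (fun y : Om => (fun k => y (sg k)) : Om) M.
move=> E mE; apply: (@config_measure_unique _ _ _ _ (distribution Q X) Q) => // B mB.
transitivity (Q (rect (fun k => B (sg' k)))).
  congr (Q _); apply/seteqP; split => y /= h k; first by have := h (sg' k); rewrite /= sgK'.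
  by have := h (sg k); rewrite sgK.
rewrite (iid mB) (iid (fun k => mB (sg' k))) (reindex_inj (can_inj sgK)) /=.
by apply: eq_bigr => k _; rewrite sgK.
Qed.

Lemma CE_perm (sg sg' : K -> K) (u : Om -> R[i]) : cancel sg sg' -> cancel sg' sg -> citg Q u ->
  CE Q (fun y => u (fun k => y (sg k))) = CE Q u.
Proof. by move=> h h' hu; rewrite -[RHS](transfer_CE (measurable_perm sg) (perm_law h h') hu). Qed.

End IID.

(** * Moments of functions with bounded differences *)

Section ExpIneq.
Variable R : realType.

Lemma expR_quad (t : R) : t <= 1 -> expR t <= 1 + t + 2 * t ^+ 2.
Proof.
move=> t1.
have h : (1 - t / 2) ^+ 2 <= expR (- t).
  have -> : - t = 2%:R * (- (t / 2)) by field.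
  rewrite expRM_natl lerXn2r // ?nnegrE ?expR_ge0 //; first lra.
  by have := expR_ge1Dx (- (t / 2)); lra.
have h0 : 0 < (1 - t / 2) ^+ 2 by rewrite exprn_gt0 //; lra.
have h2 : expR t <= ((1 - t / 2) ^+ 2)^-1.
  by rewrite -[leLHS]invrK -expRN lef_pV2 ?posrE ?expR_gt0.
rewrite (le_trans h2) // -[leLHS]mul1r ler_pdivrMr //.
(* This expression is exactly the excess of (1 + t + 2 t^2) (1 - t / 2)^2 over 1. *)
have h3 : 0 <= t ^+ 2 * ((1 - t) * (5 / 4 - t / 2)) by rewrite mulr_ge0 ?sqr_ge0 // mulr_ge0; lra.
nra.
Qed.

Lemma pow_le_exp (x : R) n : x ^+ (2 * n.+1) <= (2 * n.+1)`!%:R * (expR x + expR (- x)).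
Proof.
have f0 : 0 < (2 * n.+1)`!%:R :> R by rewrite ltr0n fact_gt0.
rewrite mulrC -ler_pdivrMr //.
have h y : 0 <= y -> y ^+ (2 * n.+1) / (2 * n.+1)`!%:R <= expR y :> R.
  move=> y0; have := expR_ge1Dxn (2 * n).+1 y0.
  by rewrite mulnS addnC addn2; lra.
have [x0|x0] := leP 0 x; first by rewrite (le_trans (h _ x0)) // lerDl expR_ge0.
have x1 : 0 <= - x by rewrite oppr_ge0 ltW.
have -> : x ^+ (2 * n.+1) = (- x) ^+ (2 * n.+1) by rewrite !exprM sqrrN.
by rewrite (le_trans (h _ x1)) // lerDr expR_ge0.
Qed.
End ExpIneq.

Section BoundedDiff.
Context (K : finType) d' (V : measurableType d') (R : realType).
Local Notation Om := (config K V).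
Variables (Q : probability Om R) (mu : probability V R).
Hypothesis iid : iid_law Q mu.
Variables (N : nat) (gam : K -> 'I_N).

Definition agree_off (S : pred 'I_N) (y y' : Om) : Prop := forall k, ~~ S (gam k) -> y k = y' k.

Definition bdiff (F : Om -> R) (c : R) : Prop :=
  forall j y y', agree_off (pred1 j) y y' -> `|F y - F y'| <= c.

Definition grp (j : 'I_N) : pred K := fun k => gam k == j.

Lemma resample_bdiff (F : Om -> R) (B c : R) j : measurable_fun setT F -> (forall y, `|F y| <= B) ->
  bdiff F c -> bdiff (resample Q (grp j) F) c.
Proof.
move=> mF FB bd i y y' yy'.
have h z : itg Q (fun y' => F (mix (grp j) z y')).
  apply: (itg_bounded Q (C := B)) => [|y1]; last exact: FB.
  by apply: measurableT_comp mF _; exact: measurable_mix2.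
rewrite /resample -ExB //; apply: (le_trans (Ex_abs (itgB (h y) (h y')))).
rewrite -[leRHS](Ex_cst Q c); apply: Ex_le; [|exact: itg_cst|].
  by apply: itg_abs; exact: itgB.
move=> y1; apply: (bd i) => k ki; rewrite /mix; case: (grp j k) => //; exact: yy'.
Qed.

Lemma resample_mean (F : Om -> R) (B c : R) j y y' : measurable_fun setT F -> (forall y, `|F y| <= B) ->
  bdiff F c -> `|F (mix (grp j) y y') - resample Q (grp j) F y| <= c.
Proof.
move=> mF FB bd.
have h : itg Q (fun y' => F (mix (grp j) y y')).
  apply: (itg_bounded Q (C := B)) => [|y1]; last exact: FB.
  by apply: measurableT_comp mF _; exact: measurable_mix2.
rewrite /resample -[X in `|X - _|](Ex_cst Q) -ExB //; last exact: itg_cst.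
have hh := itgB (itg_cst Q (F (mix (grp j) y y'))) h.
apply: (le_trans (Ex_abs hh)); rewrite -[leRHS](Ex_cst Q c); apply: Ex_le; [exact: itg_abs|exact: itg_cst|].
move=> y1; apply: (bd j) => k; rewrite /mix /grp /= => kj; by rewrite (negbTE kj).
Qed.

Lemma exp_itg (F : Om -> R) (B l : R) : measurable_fun setT F -> (forall y, `|F y| <= B) ->
  measurable_fun setT (fun y => expR (l * F y)) /\ forall y, `|expR (l * F y)| <= expR (`|l| * B).
Proof.
move=> mF FB; split.
  by apply: (measurableT_comp (f := @expR R) (@measurable_expR R)); exact: measurable_funM.
move=> y; rewrite ger0_norm ?expR_ge0 // ler_expR (le_trans (ler_norm _)) // normrM.
by rewrite ler_wpM2l.
Qed.

(** Given the other groups, the deviation [D] has mean zero and modulus at most |l| c <= 1. In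
    [expR_quad] the linear term integrates to 0, so one group costs only the factor 1 + 2 (l
    c)^2. *)
Lemma exp_step (F : Om -> R) (B c l : R) j : measurable_fun setT F -> (forall y, `|F y| <= B) ->
  bdiff F c -> `|l| * c <= 1 ->
  Ex Q (fun y => expR (l * F y)) <=
  (1 + 2 * (l * c) ^+ 2) * Ex Q (fun y => expR (l * resample Q (grp j) F y)).
Proof.
move=> mF FB bd lc.
have [me eB] := exp_itg l mF FB.
set F1 := resample Q (grp j) F.
have [iF1 EF1] := resample_itg iid (grp j) mF FB; rewrite -/F1 in iF1 EF1.
have mF1 := itg_meas iF1.
have F1B y : `|F1 y| <= B by exact: resample_bound.
have [me1 eB1] := exp_itg l mF1 F1B.
have [h1 h2] := resample_itg iid (grp j) me eB.
rewrite -h2 -ExZ; last exact: (itg_bounded Q me1 eB1).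
apply: (Ex_le h1); first by apply: itgZ; exact: (itg_bounded Q me1 eB1).
move=> y; rewrite {1}/resample.
pose D y' := l * (F (mix (grp j) y y') - F1 y).
have mFm : measurable_fun setT (fun y' => F (mix (grp j) y y')).
  by apply: measurableT_comp mF _; exact: measurable_mix2.
have iFm : itg Q (fun y' => F (mix (grp j) y y')) by apply: (itg_bounded Q mFm (C := B)).
have DE y' : expR (l * F (mix (grp j) y y')) = expR (l * F1 y) * expR (D y').
  by rewrite -expRD; congr expR; rewrite /D; ring.
have Dle y' : `|D y'| <= `|l| * c.
  by rewrite normrM ler_wpM2l // (resample_mean j y y' mF FB bd).
have lc2 : (l * c) ^+ 2 = (`|l| * c) ^+ 2 by rewrite !exprMn real_normK ?num_real.
have D2 y' : D y' ^+ 2 <= (l * c) ^+ 2.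
  rewrite lc2 -(real_normK (num_real (D y'))) lerXn2r ?nnegrE //.
  by rewrite (le_trans _ (Dle y')).
have iD : itg Q D.
  by apply: itgZ; apply: itgB => //; exact: itg_cst.
have ED : Ex Q D = 0.
  have E2 : Ex Q (fun y' => F (mix (grp j) y y')) = F1 y by [].
  rewrite /D ExZ; last by apply: itgB => //; exact: itg_cst.
  have ic : itg Q (fun=> F1 y) by exact: itg_cst.
  by rewrite (ExB iFm ic) Ex_cst E2 subrr mulr0.
have ieD : itg Q (fun y' => expR (D y')).
  apply: (@itg_bounded _ _ _ _ _ (expR 1)).
    by apply: (measurableT_comp (f := @expR R) (@measurable_expR R)); exact: (itg_meas iD).
  move=> y'; rewrite ger0_norm ?expR_ge0 // ler_expR (le_trans (ler_norm _)) // (le_trans (Dle y')) //.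
rewrite (Ex_ext Q DE) ExZ // mulrC ler_wpM2r ?expR_ge0 //.
apply: (@le_trans _ _ (Ex Q (fun y' => (1 + 2 * (l * c) ^+ 2) + D y'))).
  apply: Ex_le => // [|y']; first by apply: itgD => //; exact: itg_cst.
  apply: (le_trans (expR_quad _)); first by rewrite (le_trans (ler_norm _)) // (le_trans (Dle y')).
  by have := D2 y'; lra.
by rewrite ExD //; [rewrite Ex_cst ED addr0 | exact: itg_cst].
Qed.

(** Groups are averaged out one after the other: the functions [Fn] form the martingale of
    conditional expectations, and bounded differences survive each averaging. *)
Lemma exp_chain (n : nat) (F : Om -> R) (B c l : R) : (n <= N)%N ->
  measurable_fun setT F -> (forall y, `|F y| <= B) -> bdiff F c -> `|l| * c <= 1 ->
  exists Fn : Om -> R, [/\ measurable_fun setT Fn, (forall y, `|Fn y| <= B), bdiff Fn c, Ex Q Fn = Ex Q F &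
    (forall y y', agree_off (fun j : 'I_N => (j < n)%N) y y' -> Fn y = Fn y') /\
    Ex Q (fun y => expR (l * F y)) <= (1 + 2 * (l * c) ^+ 2) ^+ n * Ex Q (fun y => expR (l * Fn y))].
Proof.
move=> nN mF FB bd lc; elim: n nN => [_|n IH nN].
  exists F; split => //; split => [y y' yy'|]; last by rewrite expr0 mul1r.
  by congr F; apply/funext => k; apply: yy'; rewrite ltn0.
have [Fn [m1 B1 b1 E1 [a1 e1]]] := IH (ltnW nN).
pose j : 'I_N := Ordinal nN.
have [iF EF] := resample_itg iid (grp j) m1 B1.
exists (resample Q (grp j) Fn); split.
- exact: (itg_meas iF).
- by move=> y; apply: resample_bound.
- exact: (resample_bdiff j m1 B1 b1).
- by rewrite EF.
split.
  move=> y y' yy'; apply: Ex_ext => y1; apply: a1 => k; rewrite -leqNgt => nk.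
  rewrite /mix /grp; case: eqP => // kj; apply: yy'; rewrite -leqNgt ltn_neqAle nk andbT.
  by apply: contra_notN kj => /eqP kn; apply/val_inj.
apply: (le_trans e1); rewrite [_ ^+ n.+1]exprSr -mulrA; apply: ler_wpM2l.
  by rewrite exprn_ge0 // addr_ge0 // mulr_ge0 // sqr_ge0.
exact: (exp_step j m1 B1 b1 lc).
Qed.

Lemma exp_moment (F : Om -> R) (B c l : R) :
  measurable_fun setT F -> (forall y, `|F y| <= B) -> bdiff F c -> `|l| * c <= 1 ->
  Ex Q (fun y => expR (l * (F y - Ex Q F))) <= (1 + 2 * (l * c) ^+ 2) ^+ N.
Proof.
move=> mF FB bd lc; have [Fn [m1 B1 b1 E1 [a1 e1]]] := exp_chain (leqnn N) mF FB bd lc.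
have Fc y : Fn y = Ex Q F.
  rewrite -E1 -[LHS](Ex_cst Q); apply: Ex_ext => y'; apply: a1 => k.
  by rewrite ltn_ord.
have [me eB] := exp_itg l mF FB.
rewrite (@Ex_ext _ _ _ _ _ (fun y => expR (- (l * Ex Q F)) * expR (l * F y))); last first.
  by move=> y; rewrite -expRD; congr expR; ring.
rewrite ExZ; last exact: (itg_bounded Q me eB).
rewrite expRN mulrC ler_pdivrMr ?expR_gt0 // (le_trans e1) //.
by rewrite (@Ex_ext _ _ _ _ _ (fun=> expR (l * Ex Q F))) ?Ex_cst // => y; rewrite Fc.
Qed.

Theorem bdiff_moment (F : Om -> R) (B c : R) (n : nat) : (0 < N)%N -> 0 < c ->
  measurable_fun setT F -> (forall y, `|F y| <= B) -> bdiff F c ->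
  Ex Q (fun y => (F y - Ex Q F) ^+ (2 * n.+1)) <=
   2 * expR 2 * (2 * n.+1)`!%:R * (N%:R * c ^+ 2) ^+ n.+1.
Proof.
move=> N0 c0 mF FB bd.
have Nr : 0 < N%:R :> R by rewrite ltr0n.
have N1 : 1 <= N%:R :> R by rewrite ler1n.
(* With l = 1 / (sqrt N c) the exponential moment is at most (1 + 2 / N)^N <= exp 2; the even moment
   is then recovered from the exponentials by a single Taylor term. *)
pose q := Num.sqrt N%:R * c.
have q0 : 0 < q by rewrite mulr_gt0 // sqrtr_gt0.
have q2 : q ^+ 2 = N%:R * c ^+ 2 by rewrite exprMn sqr_sqrtr // ltW.
pose l := q^-1.
have l0 : 0 < l by rewrite invr_gt0.
have lc2 : (l * c) ^+ 2 = N%:R^-1.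
  by rewrite exprMn exprVn q2 invfM -mulrA mulVf ?mulr1 // expf_neq0 // gt_eqF.
have lc : l * c <= 1.
  have h0 : 0 <= l * c by rewrite mulr_ge0 // ltW.
  have : (l * c) ^+ 2 <= 1 by rewrite lc2 invf_le1.
  by move: h0; move: (l * c) => v; nra.
have EB := exp_moment mF FB bd.
have cst_bd l' : (l' * c) ^+ 2 = N%:R^-1 -> (1 + 2 * (l' * c) ^+ 2) ^+ N <= expR 2.
  move=> ->; have E2 : (2 : R) = N%:R * (2 / N%:R) by field; rewrite gt_eqF.
  have a0 : 0 <= 1 + 2 / N%:R :> R by rewrite addr_ge0 // divr_ge0 // ltW.
  by rewrite [in leRHS]E2 expRM_natl; apply: lerXn2r; rewrite ?nnegrE ?expR_ge0 // expR_ge1Dx.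
have [e1 e2] : Ex Q (fun y => expR (l * (F y - Ex Q F))) <= expR 2 /\ Ex Q (fun y => expR ((- l) * (F y - Ex Q F))) <= expR 2.
  split; apply: (le_trans (EB _ _)); rewrite ?normrN ?gtr0_norm ?cst_bd // mulNr sqrrN //.
have mD : measurable_fun setT (fun y => F y - Ex Q F) by exact: measurable_funB.
have DB y : `|F y - Ex Q F| <= B + `|Ex Q F| by rewrite (le_trans (ler_normB _ _)) // lerD2r.
have [m1 b1] := exp_itg l mD DB; have [m2 b2] := exp_itg (- l) mD DB.
have i1 := itg_bounded Q m1 b1; have i2 := itg_bounded Q m2 b2.
have f0 : 0 < (2 * n.+1)`!%:R :> R by rewrite ltr0n fact_gt0.
have ipow : itg Q (fun y => (F y - Ex Q F) ^+ (2 * n.+1)).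
  apply: (@itg_bounded _ _ _ _ _ ((B + `|Ex Q F|) ^+ (2 * n.+1))); first exact: measurable_funX.
  by move=> y; rewrite normrX lerXn2r // nnegrE // (le_trans _ (DB y)).
rewrite -q2 -exprM.
have -> : 2 * expR 2 * (2 * n.+1)`!%:R * q ^+ (2 * n.+1) =
  q ^+ (2 * n.+1) * ((2 * n.+1)`!%:R * (expR 2 + expR 2)) by ring.
apply: (@le_trans _ _ (Ex Q (fun y => q ^+ (2 * n.+1) * ((2 * n.+1)`!%:R *
   (expR (l * (F y - Ex Q F)) + expR ((- l) * (F y - Ex Q F))))))).
  apply: Ex_le => // [|y]; first by do 2 apply: itgZ; exact: itgD.
  have := pow_le_exp (l * (F y - Ex Q F)) n.
  rewrite exprMn mulNr => h.
  have lq : q * l = 1 by rewrite divff // gt_eqF.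
  have -> : (F y - Ex Q F) ^+ (2 * n.+1) = q ^+ (2 * n.+1) * (l ^+ (2 * n.+1) * (F y - Ex Q F) ^+ (2 * n.+1)).
    by rewrite mulrA -exprMn lq expr1n mul1r.
  by apply: ler_wpM2l => //; apply: exprn_ge0; exact: ltW.
rewrite ExZ; last by apply: itgZ; exact: itgD.
apply: ler_wpM2l; first by apply: exprn_ge0; exact: ltW.
rewrite ExZ; last exact: itgD.
by rewrite ler_wpM2l ?(ltW f0) // ExD // lerD.
Qed.

End BoundedDiff.

(** * Resolvents of Hermitian matrices *)

Section Resolvent.
Variable R : rcfType.
Local Notation C := (R[i]).

Definition res N (H : 'M[C]_N) (s : C) : 'M[C]_N := invmx (H - s%:M).

Lemma adjmxM m n p (A : 'M[C]_(m, n)) (B : 'M[C]_(n, p)) : adjmx (A *m B) = adjmx B *m adjmx A.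
Proof. by rewrite /adjmx map_mxM trmx_mul. Qed.
Lemma adjmxK m n (A : 'M[C]_(m, n)) : adjmx (adjmx A) = A.
Proof. by apply/matrixP => i j; rewrite !adjmxE conjcK. Qed.

Lemma herm_sub_diag N (H : 'M[C]_N) (P : 'M[C]_N) (d : 'I_N -> R) (s : C) :
  adjmx P *m P = 1%:M -> H = adjmx P *m diag_mx (\row_i (d i)%:C%C) *m P ->
  H - s%:M = adjmx P *m diag_mx (\row_i ((d i)%:C%C - s)) *m P.
Proof.
move=> PP HE; rewrite HE; have -> : s%:M = adjmx P *m s%:M *m P.
  by rewrite mul_mx_scalar -scalemxAl PP scalemx1.
rewrite -mulmxBl -mulmxBr; congr (_ *m _ *m _).
by apply/matrixP => i k; rewrite !mxE; case: (i == k); rewrite ?mulr1n ?mulr0n ?subr0.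
Qed.

Lemma sub_scalarE N (H : 'M[C]_N) (s : C) i j : (H - s%:M) i j = H i j - s *+ (i == j).
Proof. by rewrite [LHS]mxE; congr (_ + _); rewrite mxE [in LHS]mxE. Qed.

Section Herm.
Variables (N : nat) (H : 'M[C]_N) (s : C).
Hypothesis hH : adjmx H = H.
Hypothesis s0 : Imc s != 0.
Let G := res H s.

Lemma herm_unit : H - s%:M \in unitmx.
Proof.
have [P [d [PP PP' HE]]] := herm_diag hH.
have DE := herm_sub_diag s PP HE.
have h : (adjmx P *m diag_mx (\row_i ((d i)%:C%C - s)^-1) *m P) *m (H - s%:M) = 1%:M.
  rewrite DE !mulmxA -(mulmxA _ P (adjmx P)) PP' mulmx1 -(mulmxA _ (diag_mx _) (diag_mx _)) mulmx_diag.
  rewrite (_ : diag_mx _ = 1%:M) ?mulmx1 ?PP //.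
  by apply/matrixP => i k; rewrite !mxE mulVf // realB_neq0.
by have [] := mulmx1_unit h.
Qed.

Lemma resK : (H - s%:M) *m G = 1%:M. Proof. exact: mulmxV herm_unit. Qed.
Lemma resV : G *m (H - s%:M) = 1%:M. Proof. exact: mulVmx herm_unit. Qed.

Lemma res_adj : adjmx G *m (H - (conjc s)%:M) = 1%:M /\ (H - (conjc s)%:M) *m adjmx G = 1%:M.
Proof.
have e1 : adjmx (1%:M : 'M[C]_N) = 1%:M.
  by apply/matrixP => i j; rewrite adjmxE !mxE eq_sym; case: eqP => _; rewrite ?conjc1 ?conjc0.
have e2 : adjmx (H - s%:M) = H - (conjc s)%:M.
  apply/matrixP => i j; rewrite adjmxE !mxE rmorphB /=.
  have /matrixP /(_ i j) := hH; rewrite adjmxE => ->; congr (_ - _).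
  by rewrite eq_sym; case: eqP => _; rewrite ?mulr1n ?mulr0n ?conjc0.
by split; rewrite -e2 -adjmxM ?resK ?resV.
Qed.

Lemma scalarD : (H - (conjc s)%:M) - (H - s%:M) = (s - conjc s)%:M.
Proof.
apply/matrixP => a b; rewrite !mxE; case: (a == b); rewrite ?mulr1n ?mulr0n; ring.
Qed.

(** Ward identity: the diagonal of G - adj G = (s - conj s) G adj G. *)
Lemma ward_row i : Imc (G i i) = Imc s * \sum_k nc (G i k) ^+ 2.
Proof.
have [_ h2] := res_adj.
have E : G - adjmx G = (s - conjc s) *: (G *m adjmx G).
  have -> : G - adjmx G = G *m ((H - (conjc s)%:M) - (H - s%:M)) *m adjmx G.
    by rewrite mulmxBr mulmxBl -mulmxA h2 mulmx1 resV mul1mx.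
  by rewrite scalarD mul_mx_scalar -scalemxAl.
have /matrixP /(_ i i) := E; rewrite [LHS]mxE [(- adjmx G) i i]mxE adjmxE [RHS]mxE [(G *m _) i i]mxE.
move/(congr1 (@complex.Im R)).
have sc : s - conjc s = Complex 0 (2 * Imc s) by case: s => a b /=; apply: complex_ext => /=; ring.
have -> : \sum_k G i k * adjmx G k i = (\sum_k nc (G i k) ^+ 2)%:C%C.
  by rewrite rmorph_sum; apply: eq_bigr => k _; rewrite adjmxE mulJ.
rewrite sc cImD cImN cImM /= mul0r add0r.
have -> : Imc (conjc (G i i)) = - Imc (G i i) by case: (G i i).
lra.
Qed.

Lemma ward_col i : Imc (G i i) = Imc s * \sum_k nc (G k i) ^+ 2.
Proof.
have [h1 _] := res_adj.
have E : G - adjmx G = (s - conjc s) *: (adjmx G *m G).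
  have -> : G - adjmx G = adjmx G *m ((H - (conjc s)%:M) - (H - s%:M)) *m G.
    by rewrite mulmxBr mulmxBl h1 mul1mx -mulmxA resK mulmx1.
  by rewrite scalarD mul_mx_scalar -scalemxAl.
have /matrixP /(_ i i) := E; rewrite [LHS]mxE [(- adjmx G) i i]mxE adjmxE [RHS]mxE [(_ *m G) i i]mxE.
move/(congr1 (@complex.Im R)).
have sc : s - conjc s = Complex 0 (2 * Imc s) by case: s => a b /=; apply: complex_ext => /=; ring.
have -> : \sum_k adjmx G i k * G k i = (\sum_k nc (G k i) ^+ 2)%:C%C.
  by rewrite rmorph_sum; apply: eq_bigr => k _; rewrite adjmxE mulrC mulJ.
rewrite sc cImD cImN cImM /= mul0r add0r.
have -> : Imc (conjc (G i i)) = - Imc (G i i) by case: (G i i).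
lra.
Qed.

Section Bounds.
Hypothesis sp : 0 < Imc s.

Lemma res_row_sq i : \sum_k nc (G i k) ^+ 2 <= nc (G i i) / Imc s.
Proof.
rewrite ler_pdivlMr // mulrC -ward_row.
by rewrite (le_trans (ler_norm _)) // nc_im.
Qed.
Lemma res_col_sq i : \sum_k nc (G k i) ^+ 2 <= nc (G i i) / Imc s.
Proof.
rewrite ler_pdivlMr // mulrC -ward_col.
by rewrite (le_trans (ler_norm _)) // nc_im.
Qed.
Lemma res_diag_le i : nc (G i i) <= (Imc s)^-1.
Proof.
have h := res_row_sq i; rewrite (bigD1 i) //= in h.
have h2 : nc (G i i) ^+ 2 <= nc (G i i) / Imc s.
  by rewrite (le_trans _ h) // lerDl sumr_ge0 // => k _; exact: sqr_ge0.
have [g0|g0] := eqVneq (nc (G i i)) 0; first by rewrite g0 invr_ge0 ltW.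
have g1 : 0 < nc (G i i) by rewrite lt_neqAle eq_sym g0 nc_ge0.
by rewrite -(ler_pM2l g1) -expr2.
Qed.
Lemma res_row_le i : \sum_k nc (G i k) ^+ 2 <= (Imc s)^-1 ^+ 2.
Proof.
by rewrite (le_trans (res_row_sq i)) // expr2 ler_wpM2r ?invr_ge0 ?(ltW sp) // res_diag_le.
Qed.
Lemma res_col_le i : \sum_k nc (G k i) ^+ 2 <= (Imc s)^-1 ^+ 2.
Proof.
by rewrite (le_trans (res_col_sq i)) // expr2 ler_wpM2r ?invr_ge0 ?(ltW sp) // res_diag_le.
Qed.
Lemma res_le i j : nc (G i j) <= (Imc s)^-1.
Proof.
have h := res_row_le i; rewrite (bigD1 j) //= in h.
have h2 : nc (G i j) ^+ 2 <= (Imc s)^-1 ^+ 2.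
  by rewrite (le_trans _ h) // lerDl sumr_ge0 // => k _; exact: sqr_ge0.
by move: h2; rewrite ler_pXn2r // nnegrE ?nc_ge0 // invr_ge0 ltW.
Qed.
(** A vanishing diagonal entry would, by the Ward identity, annihilate its whole row and contradict
    invertibility. *)
Lemma res_diag_neq0 i : G i i != 0.
Proof.
apply/eqP => g0; have /matrixP /(_ i i) := resV; rewrite [LHS]mxE [RHS]mxE eqxx big1.
  by move/eqP; rewrite eq_sym oner_eq0.
move=> k _; suff -> : G i k = 0 by rewrite mul0r.
have := res_row_sq i; rewrite g0 nc0 mul0r => h.
have : nc (G i k) ^+ 2 <= 0.
  apply: le_trans h; rewrite (bigD1 k) //= lerDl sumr_ge0 // => l _; exact: sqr_ge0.
move=> h2; apply: Normc.eq0_normc; apply/eqP; rewrite -sqrf_eq0 eq_le h2 sqr_ge0 //.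
Qed.
Lemma res_im_gt0 i : 0 < Imc (G i i).
Proof.
rewrite ward_row mulr_gt0 // (bigD1 i) //= ltr_pwDl ?exprn_gt0 ?nc_gt0 ?res_diag_neq0 //.
by rewrite sumr_ge0 // => k _; exact: sqr_ge0.
Qed.
End Bounds.
End Herm.

Section Minor.
Variables (N : nat) (s : C).
Hypothesis sp : 0 < Imc s.

Definition minor_res (H : 'M[C]_N) (q k l : 'I_N) : C :=
  res H s k l - res H s k q * res H s q l / res H s q q.

Let sn : Imc s != 0. Proof. by rewrite gt_eqF. Qed.

(* [minor_res H q] is the resolvent of [H] with row and column [q] removed, extended by zeros, so
   it does not depend on row and column [q] of [H]. *)
Lemma minor_res_eq (H1 H2 : 'M[C]_N) q : adjmx H1 = H1 -> adjmx H2 = H2 ->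
  (forall k l, k != q -> l != q -> H1 k l = H2 k l) ->
  forall k l, minor_res H1 q k l = minor_res H2 q k l.
Proof.
move=> h1 h2 H12.
pose D H : 'M[C]_N := \matrix_(k, l) minor_res H q k l.
suff E : D H1 = D H2 by move=> k l; have /matrixP /(_ k l) := E; rewrite !mxE.
have nz H : adjmx H = H -> res H s q q != 0 by move=> hH; exact: res_diag_neq0.
have Dq H l : adjmx H = H -> D H q l = 0.
  by move=> hH; rewrite mxE /minor_res mulrAC divff ?mul1r ?subrr // nz.
have Dq' H k : adjmx H = H -> D H k q = 0.
  by move=> hH; rewrite mxE /minor_res -mulrA divff ?mulr1 ?subrr // nz.
have AD H k l : adjmx H = H -> ((H - s%:M) *m D H) k l = (k == l)%:R - (k == q)%:R * (res H s q l / res H s q q).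
  move=> hH; rewrite mxE.
  have /matrixP /(_ k l) e1 := resK hH sn; rewrite [LHS]mxE [RHS]mxE in e1.
  have /matrixP /(_ k q) e2 := resK hH sn; rewrite [LHS]mxE [RHS]mxE in e2.
  rewrite -e1 -e2 mulr_suml -sumrB; apply: eq_bigr => j _; rewrite [D H j l]mxE /minor_res.
  by rewrite mulrBr !mulrA.
have DA H k l : adjmx H = H -> (D H *m (H - s%:M)) k l = (k == l)%:R - res H s k q / res H s q q * (q == l)%:R.
  move=> hH; rewrite mxE.
  have /matrixP /(_ k l) e1 := resV hH sn; rewrite [LHS]mxE [RHS]mxE in e1.
  have /matrixP /(_ q l) e2 := resV hH sn; rewrite [LHS]mxE [RHS]mxE in e2.
  rewrite -e1 -e2 mulr_sumr -sumrB; apply: eq_bigr => j _; rewrite [D H k j]mxE /minor_res.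
  by rewrite mulrBl; congr (_ - _); ring.
(* Row [q] of [D H1] is zero, so column [q] of the Hermitian matrix does not matter here, and [H1]
   may be exchanged for [H2]. *)
have A2D1 k l : k != q -> ((H2 - s%:M) *m D H1) k l = (k == l)%:R.
  move=> kq; have := AD H1 k l h1; rewrite (negbTE kq) mul0r subr0 => <-.
  rewrite ![(_ *m _) k l]mxE; apply: eq_bigr => j _.
  have [->|jq] := eqVneq j q; first by rewrite Dq // !mulr0.
  by rewrite (sub_scalarE H2) (sub_scalarE H1) H12.
(* In the product of [D H2], [H2 - s] and [D H1] both neighbouring pairs act as the identity away
   from [q]; it therefore equals [D H1] and [D H2]. *)
apply/matrixP => i l; transitivity ((D H2 *m ((H2 - s%:M) *m D H1)) i l).
  rewrite mulmxA [RHS]mxE (bigD1 i) //= big1 => [|k ki].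
    have [->|iq] := eqVneq i q; first by rewrite !Dq // mulr0 addr0.
    by rewrite DA // eqxx eq_sym (negbTE iq) mulr0 subr0 mul1r addr0.
  have [->|kq] := eqVneq k q; first by rewrite Dq // mulr0.
  by rewrite DA // eq_sym (negbTE ki) sub0r eq_sym (negbTE kq) mulr0 oppr0 mul0r.
rewrite [LHS]mxE (bigD1 l) //= big1 => [|k kl].
  have [->|lq] := eqVneq l q; first by rewrite !Dq' // mul0r addr0.
  by rewrite A2D1 // eqxx mulr1 addr0.
have [->|kq] := eqVneq k q; first by rewrite Dq' // mul0r.
by rewrite A2D1 // (negbTE kl) mulr0.
Qed.

(** After the arithmetic-geometric inequality, row [q] and column [q] contribute at most |G_qq| / Im
    s each by the Ward identity, which cancels the division by G_qq. Injectivity makes the sums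
    parts of a full row and a full column. *)
Lemma minor_sum_le (H : 'M[C]_N) q (J : finType) (a b : J -> 'I_N) (Q : pred J) :
  adjmx H = H -> injective a -> injective b ->
  nc (\sum_(j | Q j) res H s (a j) q * res H s q (b j) / res H s q q) <= (Imc s)^-1.
Proof.
move=> hH ia ib; set G := res H s.
have g0 : 0 < nc (G q q) by rewrite nc_gt0 res_diag_neq0.
have inj_sum (f : J -> 'I_N) (F : 'I_N -> R) : injective f -> (forall k, 0 <= F k) ->
   \sum_(j | Q j) F (f j) <= \sum_k F k.
  move=> fi F0; rewrite (partition_big f xpredT) //=; apply: ler_sum => k _.
  have [/existsP[j /andP[Qj /eqP fj]]|/existsPn h] := boolP [exists j, Q j && (f j == k)].
    rewrite (bigD1 j) ?Qj ?fj ?eqxx //= big1 ?addr0 ?fj // => i /andP[/andP[_ /eqP fik] ij].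
    by move: ij; rewrite (fi i j) ?eqxx // fik fj.
  by rewrite big1 // => j Qj; have := h j; rewrite Qj.
apply: (le_trans (nc_sum _ _ _)).
apply: (@le_trans _ _ (\sum_(j | Q j) (nc (G (a j) q) ^+ 2 + nc (G q (b j)) ^+ 2) / 2 / nc (G q q))).
  apply: ler_sum => j _; rewrite !ncM ncV ler_wpM2r ?invr_ge0 ?nc_ge0 //.
  by have := sqr_ge0 (nc (G (a j) q) - nc (G q (b j))); lra.
rewrite -!mulr_suml big_split /=.
have h1 := inj_sum a (fun k => nc (G k q) ^+ 2) ia (fun k => sqr_ge0 _).
have h2 := inj_sum b (fun k => nc (G q k) ^+ 2) ib (fun k => sqr_ge0 _).
have h3 := res_col_sq hH sn sp q; have h4 := res_row_sq hH sn sp q.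
by rewrite ler_pdivrMr // mulrC; move: h1 h2 h3 h4; rewrite -/G /=; lra.
Qed.

(** The two minors at [q] agree, so only the rank-one corrections survive; the bound does not grow
    with the number of summands. *)
Lemma partial_trace_diff (H1 H2 : 'M[C]_N) q (J : finType) (a b : J -> 'I_N) (Q : pred J) :
  adjmx H1 = H1 -> adjmx H2 = H2 ->
  (forall k l, k != q -> l != q -> H1 k l = H2 k l) ->
  injective a -> injective b ->
  nc (\sum_(j | Q j) res H1 s (a j) (b j) - \sum_(j | Q j) res H2 s (a j) (b j)) <= 2 / Imc s.
Proof.
move=> h1 h2 H12 ia ib.
have -> : \sum_(j | Q j) res H1 s (a j) (b j) - \sum_(j | Q j) res H2 s (a j) (b j) =
  \sum_(j | Q j) res H1 s (a j) q * res H1 s q (b j) / res H1 s q q -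
  \sum_(j | Q j) res H2 s (a j) q * res H2 s q (b j) / res H2 s q q.
  rewrite -!sumrB; apply: eq_bigr => j _.
  have := minor_res_eq h1 h2 H12 (a j) (b j); rewrite /minor_res => /eqP.
  rewrite subr_eq => /eqP ->; ring.
rewrite (le_trans (ncB _ _)) // mulrDl !mul1r.
by apply: lerD; apply: minor_sum_le.
Qed.
End Minor.

Section Perturb.
Variables (N : nat) (s : C) (H H0 : 'M[C]_N) (p q : 'I_N) (x : C).
Hypothesis sn : Imc s != 0.
Hypotheses (hH : adjmx H = H) (hH0 : adjmx H0 = H0).
Hypothesis HE : H = H0 + (x *: delta_mx p q + conjc x *: delta_mx q p).

Lemma res_perturb i j : res H0 s i j - res H s i j =
  x * res H0 s i p * res H s q j + conjc x * res H0 s i q * res H s p j.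
Proof.
have E : res H0 s - res H s = res H0 s *m (H - H0) *m res H s.
  have -> : H - H0 = (H - s%:M) - (H0 - s%:M) by rewrite opprB addrA subrK.
  by rewrite mulmxBr mulmxBl -mulmxA resK // mulmx1 resV // mul1mx.
have /matrixP /(_ i j) := E; rewrite [LHS]mxE [X in _ + X = _ -> _]mxE => ->.
have -> : H - H0 = x *: delta_mx p q + conjc x *: delta_mx q p by rewrite HE addrC addKr.
have dl (A B : 'M[C]_N) (a b : 'I_N) : (A *m delta_mx a b *m B) i j = A i a * B b j.
  rewrite -(mul_delta_mx (0 : 'I_1)) mulmxA -colE -mulmxA -rowE mxE big_ord1 !mxE //.
have lin (A B M1 M2 : 'M[C]_N) (a1 a2 : C) :
    (A *m (a1 *: M1 + a2 *: M2) *m B) i j = a1 * (A *m M1 *m B) i j + a2 * (A *m M2 *m B) i j.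
  by rewrite mulmxDr mulmxDl -!scalemxAr -!scalemxAl [LHS]mxE; congr (_ + _); rewrite [LHS]mxE.
by rewrite lin !dl !mulrA.
Qed.
End Perturb.

End Resolvent.

(** * The Hermitization and its resolvent *)

Section Hermitization.
Variable R : rcfType.
Local Notation C := (R[i]).

Lemma char_poly_diagonalized n (P Q : 'M[C]_n) (d : 'I_n -> C) : Q *m P = 1%:M ->
  char_poly (Q *m diag_mx (\row_i d i) *m P) = \prod_(i < n) ('X - (d i)%:P).
Proof.
move=> QP; set D := diag_mx _.
have -> : \prod_(i < n) ('X - (d i)%:P) = char_poly D.
  rewrite char_poly_trig; last by exact: diag_mx_is_trig.
  by apply: eq_bigr => i _; rewrite /D !mxE eqxx mulr1n.
have QPP : map_mx (@polyC C) Q *m map_mx (@polyC C) P = 1%:M by rewrite -map_mxM QP map_mx1.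
rewrite /char_poly /char_poly_mx.
have -> : 'X%:M - map_mx (@polyC C) (Q *m D *m P) =
   map_mx (@polyC C) Q *m ('X%:M - map_mx (@polyC C) D) *m map_mx (@polyC C) P.
  rewrite mulmxBr mulmxBl -!map_mxM; congr (_ - _).
  by rewrite mul_mx_scalar -scalemxAl QPP scalemx1.
rewrite !det_mulmx mulrAC -det_mulmx QPP det1 mul1r //.
Qed.

(** The spectral theorem gives a second factorisation of the characteristic polynomial; unique
    factorisation identifies its roots with [eigenvalues] up to order. *)
Lemma eig_sum n (A : 'M[C]_n) (w : C) : adjmx A = A -> Imc w != 0 ->
  \sum_(l <- eigenvalues A) (l - w)^-1 = \tr (res A w).
Proof.
move=> hA w0; have [P [d [PP PP' AE]]] := herm_diag hA.
have chE : char_poly A = \prod_(i < n) ('X - ((d i)%:C%C)%:P) by rewrite AE char_poly_diagonalized.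
have E : char_poly A = lead_coef (char_poly A) *: \prod_(l <- eigenvalues A) ('X - l%:P).
  exact: svalP (closed_field_poly_normal (char_poly A)).
rewrite (monicP (char_poly_monic A)) scale1r {1}chE in E.
have pe : perm_eq [seq (d i)%:C%C | i <- enum 'I_n] (eigenvalues A).
  by apply: prod_XsubC_eq; rewrite big_map big_enum.
rewrite -(perm_big _ pe) big_map big_enum /=.
have -> : res A w = adjmx P *m diag_mx (\row_i ((d i)%:C%C - w)^-1) *m P.
  have U := herm_unit hA w0; rewrite /res; apply: (can_inj (mulKmx U)).
  rewrite mulmxV // (herm_sub_diag w PP AE) !mulmxA -(mulmxA _ P (adjmx P)) PP' mulmx1.
  rewrite -(mulmxA _ (diag_mx _) (diag_mx _)) mulmx_diag (_ : diag_mx _ = 1%:M) ?mulmx1 ?PP //.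
  by apply/matrixP => i k; rewrite !mxE divff // realB_neq0.
rewrite mxtrace_mulC mulmxA PP' mul1mx mxtrace_diag.
by apply: eq_bigr => i _; rewrite mxE.
Qed.

Variables (n : nat).

Definition hmz (X : 'M[C]_n) : 'M[C]_(n + n) := block_mx 0 X (adjmx X) 0.

Lemma hmz_herm X : adjmx (hmz X) = hmz X.
Proof.
rewrite /hmz /adjmx map_block_mx tr_block_mx /= -/(adjmx (adjmx X)) adjmxK.
by rewrite !map_mx0 !trmx0.
Qed.

Lemma hmz_ur X i j : hmz X (lshift n i) (rshift n j) = X i j.
Proof. by rewrite /hmz block_mxEur. Qed.
Lemma hmz_dl X i j : hmz X (rshift n j) (lshift n i) = conjc (X i j).
Proof. by rewrite /hmz block_mxEdl adjmxE. Qed.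
Lemma hmz_ul X i j : hmz X (lshift n i) (lshift n j) = 0.
Proof. by rewrite /hmz block_mxEul mxE. Qed.
Lemma hmz_dr X i j : hmz X (rshift n i) (rshift n j) = 0.
Proof. by rewrite /hmz block_mxEdr mxE. Qed.

Lemma hmz_rank_one (X X' : 'M[C]_n) (x : C) (i0 j0 : 'I_n) :
  (forall i j, X i j = X' i j + x * (i0 == i)%:R * (j0 == j)%:R) ->
  hmz X = hmz X' + (x *: delta_mx (lshift n i0) (rshift n j0) + conjc x *: delta_mx (rshift n j0) (lshift n i0)).
Proof.
move=> XE.
have D p q (i j : 'I_(n + n)) : (x *: delta_mx p q + conjc x *: delta_mx q p) i j =
    x * ((i == p) && (j == q))%:R + conjc x * ((i == q) && (j == p))%:R by rewrite !mxE.
apply/matrixP => i j; rewrite [RHS]mxE D -(fintype.splitK i) -(fintype.splitK j).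
case: (fintype.split i) (fintype.split j) => [a|a] [a'|a'] /=.
- by rewrite !hmz_ul !eq_lrshift andbF /= !mulr0 !addr0.
- rewrite !hmz_ur XE !eq_lrshift /= mulr0 addr0 !(inj_eq (@lshift_inj _ _)) !(inj_eq (@rshift_inj _ _)).
  by rewrite -mulrA -natrM mulnb [a == _]eq_sym [a' == _]eq_sym.
- rewrite !hmz_dl XE rmorphD /= !rmorphM /= !rmorph_nat !eq_rlshift /= mulr0 add0r !(inj_eq (@lshift_inj _ _)) !(inj_eq (@rshift_inj _ _)).
  by rewrite -mulrA -natrM mulnb andbC [a == _]eq_sym [a' == _]eq_sym.
- by rewrite !hmz_dr !eq_rlshift ?andbF /= !mulr0 !addr0.
Qed.

(** A column of [X] sits in a single row and the matching column of the Hermitization, so changing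
    it is a perturbation at one index, as [partial_trace_diff] requires. *)
Lemma hmz_agree (X X' : 'M[C]_n) (j : 'I_n) : (forall a a', a' != j -> X a a' = X' a a') ->
  forall i l, i != rshift n j -> l != rshift n j -> hmz X i l = hmz X' i l.
Proof.
move=> E i l; rewrite -(fintype.splitK i) -(fintype.splitK l).
case: (fintype.split i) (fintype.split l) => [a|a] [a'|a'] /=.
- by rewrite !hmz_ul.
- by rewrite !hmz_ur (inj_eq (@rshift_inj _ _)) => _; exact: E.
- by rewrite !hmz_dl (inj_eq (@rshift_inj _ _)) => aj _; rewrite E.
- by rewrite !hmz_dr.
Qed.

Section Reindex.
Variables (f : 'I_n -> 'I_n).
Definition both (i : 'I_(n + n)) : 'I_(n + n) :=
  match fintype.split i with inl j => lshift n (f j) | inr j => rshift n (f j) end.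
Lemma both_l j : both (lshift n j) = lshift n (f j).
Proof. by rewrite /both (unsplitK (inl j)). Qed.
Lemma both_r j : both (rshift n j) = rshift n (f j).
Proof. by rewrite /both (unsplitK (inr j)). Qed.
Lemma both_inj : injective f -> injective both.
Proof.
move=> fi i1 i2; rewrite -(fintype.splitK i1) -(fintype.splitK i2).
case: (fintype.split i1) (fintype.split i2) => [a|a] [a'|a'] /=; rewrite ?both_l ?both_r.
- by move/lshift_inj/fi ->.
- by move/eqP; rewrite eq_lrshift.
- by move/eqP; rewrite eq_rlshift.
- by move/rshift_inj/fi ->.
Qed.
Lemma hmz_reindex (X X' : 'M[C]_n) : (forall a a', X a a' = X' (f a) (f a')) ->
  forall i j, hmz X i j = hmz X' (both i) (both j).
Proof.
move=> E i1 i2; rewrite -(fintype.splitK i1) -(fintype.splitK i2).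
case: (fintype.split i1) (fintype.split i2) => [a|a] [a'|a'] /=; rewrite ?both_l ?both_r.
- by rewrite !hmz_ul.
- by rewrite !hmz_ur E.
- by rewrite !hmz_dl E.
- by rewrite !hmz_dr.
Qed.
End Reindex.

Variables (X : 'M[C]_n) (s : C).
Hypothesis sn : Imc s != 0.
Let G := res (hmz X) s.
Let hH := hmz_herm X.

Lemma hmz_top i j : \sum_k X i k * G (rshift n k) (lshift n j) = (i == j)%:R + s * G (lshift n i) (lshift n j).
Proof.
have /matrixP /(_ (lshift n i) (lshift n j)) := resK hH sn.
rewrite mxE big_split_ord /= [RHS]mxE (inj_eq (@lshift_inj _ _)) => <-.
have -> : \sum_(k < n) (hmz X - s%:M) (lshift n i) (lshift n k) * res (hmz X) s (lshift n k) (lshift n j)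
    = - s * G (lshift n i) (lshift n j).
  rewrite (bigD1 i) //= big1 => [|k ki]; last first.
    by rewrite sub_scalarE hmz_ul (inj_eq (@lshift_inj _ _)) eq_sym (negbTE ki) mulr0n subr0 mul0r.
  by rewrite addr0 sub_scalarE hmz_ul eqxx mulr1n sub0r.
rewrite mulNr addrAC addNr add0r; apply: eq_bigr => k _.
by rewrite sub_scalarE hmz_ur eq_lrshift mulr0n subr0.
Qed.

Lemma hmz_bot i j : \sum_k conjc (X k i) * G (lshift n k) (lshift n j) = s * G (rshift n i) (lshift n j).
Proof.
have /matrixP /(_ (rshift n i) (lshift n j)) := resK hH sn.
rewrite mxE big_split_ord /= [RHS]mxE eq_rlshift /= => E; apply: subr0_eq; rewrite -[RHS]E.
congr (_ + _).
  by apply: eq_bigr => k _; rewrite sub_scalarE hmz_dl eq_rlshift mulr0n subr0.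
rewrite (bigD1 i) //= big1 => [|k ki]; last first.
  by rewrite sub_scalarE hmz_dr (inj_eq (@rshift_inj _ _)) eq_sym (negbTE ki) mulr0n subr0 mul0r.
by rewrite addr0 sub_scalarE hmz_dr eqxx mulr1n sub0r mulNr.
Qed.

Lemma hmz_right i j : \sum_k G (rshift n i) (lshift n k) * X k j = (i == j)%:R + s * G (rshift n i) (rshift n j).
Proof.
have /matrixP /(_ (rshift n i) (rshift n j)) := resV hH sn.
rewrite mxE big_split_ord /= [RHS]mxE (inj_eq (@rshift_inj _ _)) => <-.
rewrite -addrA -[LHS]addr0; congr (_ + _).
  by apply: eq_bigr => k _; rewrite sub_scalarE hmz_ur eq_lrshift mulr0n subr0.
apply: esym; rewrite (bigD1 j) //= big1 => [|k kj]; last first.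
  by rewrite sub_scalarE hmz_dr (inj_eq (@rshift_inj _ _)) (negbTE kj) mulr0n subr0 mulr0.
by rewrite addr0 sub_scalarE hmz_dr eqxx mulr1n sub0r mulrN mulrC addNr.
Qed.

(** Cyclicity of the trace for [X] and the lower left block, which [hmz_top] and [hmz_right] relate
    to the two diagonal blocks. *)
Lemma hmz_trace : \sum_i G (lshift n i) (lshift n i) = \sum_i G (rshift n i) (rshift n i).
Proof.
have s_n : s != 0 by apply: contra_neq sn => ->.
apply: (mulfI s_n); rewrite !mulr_sumr; apply: (addrI (\sum_(i < n) 1)); rewrite -!big_split /=.
transitivity (\sum_i \sum_k X i k * G (rshift n k) (lshift n i)).
  by apply: eq_bigr => i _; rewrite hmz_top eqxx.
rewrite exchange_big /=; apply: eq_bigr => k _.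
rewrite -[1 + _]/(1 + _) (_ : 1 = (k == k)%:R :> C); last by rewrite eqxx.
by rewrite -hmz_right; apply: eq_bigr => i _; rewrite mulrC.
Qed.

(** Eliminating the lower left block from [hmz_top] and [hmz_bot] leaves (X X' - s^2) G_11 = s with
    X' the adjoint of X. *)
Lemma hmz_gram i j : Imc (s ^+ 2) != 0 ->
  G (lshift n i) (lshift n j) = s * res (X *m adjmx X) (s ^+ 2) i j.
Proof.
move=> w0; pose A := \matrix_(a < n, b < n) G (lshift n a) (lshift n b).
have hA : adjmx (X *m adjmx X) = X *m adjmx X by rewrite adjmxM adjmxK.
have U := herm_unit hA w0.
have E : (X *m adjmx X - (s ^+ 2)%:M) *m A = s%:M.
  apply/matrixP => a b; rewrite mulmxBl -mulmxA mul_scalar_mx.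
  rewrite [LHS]mxE [X in X + _]mxE [X in _ + X]mxE [X in - X]mxE [A a b]mxE [RHS]mxE.
  under eq_bigr => k _.
    rewrite mxE (eq_bigr (fun l => conjc (X l k) * G (lshift n l) (lshift n b))); last first.
      by move=> l _; rewrite adjmxE mxE.
    rewrite hmz_bot mulrCA.
    over.
  rewrite -mulr_sumr hmz_top; case: (a == b); rewrite ?mulr1n ?mulr0n; ring.
have -> : G (lshift n i) (lshift n j) = A i j by rewrite mxE.
have -> : A = s *: res (X *m adjmx X) (s ^+ 2).
  by apply: (can_inj (mulKmx U)); rewrite E -scalemxAr mulmxV // scalemx1.
by rewrite mxE.
Qed.

End Hermitization.

(** * Indices of the periodic block band matrix *)

Section Index.
Variables (n b : nat).
Hypotheses (n0 : (0 < n)%N) (b0 : (0 < b)%N) (bn : (b %| n)%N).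
Local Notation m := (n %/ b)%N.
Local Notation K := (entry_idx m b).

Lemma m_gt0 : (0 < m)%N. Proof. by rewrite divn_gt0 // dvdn_leq. Qed.

Lemma divn_mix (q : 'I_b) (N : nat) : ((N * b + q) %/ b = N)%N.
Proof. by rewrite divnMDl // divn_small // addn0. Qed.
Lemma modn_mix (q : 'I_b) (N : nat) : ((N * b + q) %% b = q)%N.
Proof. by rewrite modnMDl modn_small. Qed.

Lemma ix_lt (I : 'I_m) (r : 'I_b) : (I * b + r < n)%N.
Proof.
have h : (m * b = n)%N := divnK bn.
have h1 : (I * b + r < I.+1 * b)%N by rewrite mulSn addnC ltn_add2r.
apply: (leq_trans h1); apply: (@leq_trans (m * b)); last by rewrite h.
by rewrite leq_mul2r ltn_ord orbT.
Qed.
Definition ix (I : 'I_m) (r : 'I_b) : 'I_n := Ordinal (ix_lt I r).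

Lemma ix_div I r : (ix I r %/ b)%N = I.
Proof. exact: divn_mix. Qed.
Lemma ix_mod I r : (ix I r %% b)%N = r.
Proof. exact: modn_mix. Qed.

Lemma ixP (i : 'I_n) : exists I r, i = ix I r.
Proof.
have hI : (i %/ b < m)%N by rewrite ltn_divLR // divnK.
have hr : (i %% b < b)%N by rewrite ltn_mod.
by exists (Ordinal hI), (Ordinal hr); apply: val_inj; rewrite /= -divn_eq.
Qed.

Lemma ix_inj I r I' r' : ix I r = ix I' r' -> I = I' /\ r = r'.
Proof.
move=> e; split; apply: val_inj => /=.
  by rewrite -(ix_div I r) e ix_div.
by rewrite -(ix_mod I r) e ix_mod.
Qed.
Lemma ix_eq I r I' r' : (ix I r == ix I' r') = (I == I') && (r == r').
Proof. by apply/eqP/andP => [/ix_inj[-> ->] //|[/eqP -> /eqP ->]]. Qed.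

Lemma ix_bij : bijective (fun q : 'I_m * 'I_b => ix q.1 q.2).
Proof.
apply: inj_card_bij; first by move=> [I r] [I' r'] /= /ix_inj[-> ->].
by rewrite card_prod !card_ord divnK.
Qed.
Lemma sum_ix (S : nmodType) (F : 'I_n -> S) : \sum_i F i = \sum_(I < m) \sum_(r < b) F (ix I r).
Proof. by rewrite pair_big /= (reindex (fun q : 'I_m * 'I_b => ix q.1 q.2)) //; apply: onW_bij; exact: ix_bij. Qed.

Definition addm (I : 'I_m) (k : nat) : 'I_m := Ordinal (ltn_pmod (I + k) m_gt0).
Lemma addmA I k l : addm (addm I k) l = addm I (k + l).
Proof. by apply: val_inj; rewrite /= modnDml addnA. Qed.
Lemma addm_modm I k : (k %% m = 0)%N -> addm I k = I.
Proof. by move=> k0; apply: val_inj; rewrite /= -modnDmr k0 addn0 modn_small. Qed.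

(* Block row of the kind-[kd] block stored at index [I], whose block column is always [I]. *)
Definition rb (kd : 'I_3) (I : 'I_m) : 'I_m :=
  addm I (if kd == 0 then 0%N else if kd == 2%:R then 1%N else m.-1).

Definition rho (k : K) : 'I_n := ix (rb k.1.1.1 k.1.1.2) k.1.2.
Definition kap (k : K) : 'I_n := ix k.1.1.2 k.2.

Lemma sum_K (S : nmodType) (F : K -> S) :
  \sum_k F k = \sum_(kd < 3) \sum_(I < m) \sum_(r < b) \sum_(c < b) F (kd, I, r, c).
Proof.
rewrite pair_big /= pair_big /= pair_big /=.
by apply: eq_bigr => -[[[kd I] r] c] _.
Qed.

Section Matrix.
Variable C : comNzRingType.
Implicit Type g : K -> C.

Lemma blk_entryE g kd (I : 'I_m) (r c : 'I_b) : blk_entry g kd I r c = g (kd, I, r, c).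
Proof. by rewrite /blk_entry /ord_of !valK. Qed.

(** The sum over all entries is uniform in m: when m < 3 and block positions coincide, several [k]
    simply hit the same place. *)
Lemma pbb_entry g i j : pbb_matrix g i j = \sum_k g k * (rho k == i)%:R * (kap k == j)%:R.
Proof.
have [I [r ->]] := ixP i; have [J [c ->]] := ixP j.
rewrite mxE !ix_div !ix_mod sum_K.
have inner kd : \sum_(I' < m) \sum_(r' < b) \sum_(c' < b)
    g (kd, I', r', c') * (rho (kd, I', r', c') == ix I r)%:R * (kap (kd, I', r', c') == ix J c)%:R
   = g (kd, J, r, c) * (rb kd J == I)%:R.
  rewrite (bigD1 J) //= [X in _ + X]big1 ?addr0 => [|I' IJ]; last first.
    by rewrite big1 // => r' _; rewrite big1 // => c' _; rewrite /kap /= ix_eq (negbTE IJ) mulr0.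
  rewrite (bigD1 r) //= [X in _ + X]big1 ?addr0 => [|r' rr]; last first.
    by rewrite big1 // => c' _; rewrite /rho /= ix_eq (negbTE rr) andbF mulr0 mul0r.
  rewrite (bigD1 c) //= [X in _ + X]big1 ?addr0 => [|c' cc]; last first.
    by rewrite /kap /= ix_eq (negbTE cc) andbF mulr0.
  by rewrite /rho /kap /= !ix_eq !eqxx andbT mulr1.
under eq_bigr do rewrite inner.
rewrite !big_ord_recl big_ord0 addr0 /=.
have mm := m_gt0.
have e0 : nat_of_ord (rb 0 J) = J by rewrite /rb /= addn0 modn_small.
rewrite -addrA; congr (_ + _).
  have -> : rb ord0 J = J by apply: val_inj; rewrite /= -[RHS]e0.
  have [->|JI] := eqVneq J I; first by rewrite eqxx mul1r mulr1 blk_entryE.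
  by rewrite (_ : (nat_of_ord J == I) = false) ?mul0r ?mulr0 //; apply/negbTE.
rewrite addrC; congr (_ + _).
  have -> : (lift ord0 ord0 : 'I_3) = 1 by apply: val_inj.
  (* Solving J = I + 1 modulo m for the block row gives I = J + (m - 1), the shift used in [rb]. *)
  have E : (nat_of_ord J == (I + 1) %% m)%N = (rb 1 J == I).
    rewrite -val_eqE /rb /=; apply/eqP/eqP => [->|<-].
      by rewrite modnDml -addnA add1n prednK // modnDr modn_small.
    by rewrite modnDml -addnA addn1 prednK // modnDr modn_small.
  rewrite E; case: eqP => [JI|_]; last by rewrite mul0r mulr0.
  by rewrite mul1r mulr1 -(eqP (_ : nat_of_ord J == (I + 1) %% m)%N) ?blk_entryE // E JI.
have -> : (lift ord0 (lift ord0 ord0) : 'I_3) = 2%:R by apply: val_inj.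
have E : (nat_of_ord J == (I + m - 1) %% m)%N = (rb 2%:R J == I).
  rewrite -val_eqE /rb /=; apply/eqP/eqP => [->|<-].
    by rewrite modnDml subnK ?modnDr ?modn_small // addn_gt0 mm orbT.
  rewrite -addnBA // modnDml -addnA subnKC // modnDr modn_small //.
rewrite E; case: eqP => [JI|_]; last by rewrite mul0r mulr0.
by rewrite mul1r mulr1 -(eqP (_ : nat_of_ord J == (I + m - 1) %% m)%N) ?blk_entryE // E JI.
Qed.

Definition shiftK (l : nat) (k : K) : K := (k.1.1.1, addm k.1.1.2 l, k.1.2, k.2).
Definition shiftI (l : nat) (i : 'I_n) : 'I_n :=
  Ordinal (ltn_pmod (i + l * b) n0).

Lemma shiftI_ix l I r : shiftI l (ix I r) = ix (addm I l) r.
Proof.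
apply: val_inj => /=; rewrite -{2}(divnK bn) addnAC -mulnDl.
rewrite {1}(divn_eq (I + l) m) mulnDl -mulnA -addnA modnMDl modn_small //.
by rewrite divnK // (ix_lt (addm I l) r).
Qed.

Lemma shiftK_cancel l : (l <= m)%N -> cancel (shiftK l) (shiftK (m - l)) /\ cancel (shiftK (m - l)) (shiftK l).
Proof.
move=> lm; split => -[[[kd I] r] c]; rewrite /shiftK /= addmA addm_modm //.
  by rewrite subnKC // modnn.
by rewrite subnK // modnn.
Qed.

Lemma shiftI_inj l : (l <= m)%N -> injective (shiftI l).
Proof.
move=> lm i j; have [I [r ->]] := ixP i; have [J [c ->]] := ixP j.
rewrite !shiftI_ix => /ix_inj[h ->]; congr (ix _ _).
have := congr1 (fun x => addm x (m - l)) h; rewrite !addmA !addm_modm //; by rewrite subnKC // modnn.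
Qed.

Lemma rho_shift l k : rho (shiftK l k) = shiftI l (rho k).
Proof. by rewrite /rho shiftI_ix /shiftK /= /rb !addmA addnC. Qed.
Lemma kap_shift l k : kap (shiftK l k) = shiftI l (kap k).
Proof. by rewrite /kap shiftI_ix. Qed.

(** Relabelling the entries by a block shift permutes rows and columns by the same shift. An iid law
    is unchanged by the relabelling, whence equal means of block traces. *)
Lemma pbb_shift g l i j : (l <= m)%N ->
  pbb_matrix (fun k => g (shiftK l k)) i j = pbb_matrix g (shiftI l i) (shiftI l j).
Proof.
move=> lm; have [h1 h2] := shiftK_cancel lm.
rewrite !pbb_entry [RHS](reindex_inj (can_inj h1)) /=; apply: eq_bigr => k _.
by rewrite rho_shift kap_shift !(inj_eq (shiftI_inj lm)).
Qed.
End Matrix.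
End Index.

(** * Expansion in a single entry *)

(** Here X = |x|, the letters A, B, D are moduli of entries of [G0], and e1, e2 are differences of
    the two resolvents. Each remainder term contains two small factors, either off-diagonal entries
    or further powers of X h^2, so Young's inequality leaves squares of entries, summable by the
    Ward identity, and higher powers of X. *)
Lemma atom_real (R : realFieldType) (X A B D a1 a2 a3 h v e1 e2 : R) :
  0 <= X -> 0 <= A -> 0 <= B -> 0 <= D -> 0 <= h -> 0 <= v ->
  a1 <= B + 2 * X * h ^+ 2 -> a2 <= D + 2 * X * h ^+ 2 -> 0 <= a1 -> 0 <= a2 ->
  e1 <= X * h * a1 + X * D * h -> e2 <= X * h * A + X * h * a2 ->
  X ^+ 2 * A * a1 + X ^+ 2 * h * e1 + v * (e2 * h + h * e1) <=
  2 * (X ^+ 2 + v) * (A ^+ 2 + B ^+ 2 + D ^+ 2) + 4 * (X ^+ 4 * h ^+ 4) + 6 * v * (X ^+ 2 * h ^+ 4).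
Proof.
move=> X0 A0 B0 D0 h0 v0 H1 H2 _ _ H3 H4.
have Xh : 0 <= X * h by exact: mulr_ge0.
have E1 : e1 <= X * h * (B + 2 * X * h ^+ 2) + X * D * h.
  by apply: (le_trans H3); rewrite lerD2r ler_wpM2l.
have E2 : e2 <= X * h * A + X * h * (D + 2 * X * h ^+ 2).
  by apply: (le_trans H4); rewrite lerD2l ler_wpM2l.
set w := X * h ^+ 2.
have T1 : X ^+ 2 * A * a1 <= X ^+ 2 * (A * (B + 2 * w)).
  by rewrite -mulrA ler_wpM2l ?sqr_ge0 // ler_wpM2l // (le_trans H1) // /w mulrA.
have T2 : X ^+ 2 * h * e1 <= X ^+ 2 * (w * (B + 2 * w + D)).
  apply: (@le_trans _ _ (X ^+ 2 * h * (X * h * (B + 2 * X * h ^+ 2) + X * D * h))).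
    by rewrite ler_wpM2l // mulr_ge0 ?sqr_ge0.
  by apply: le_of_eq; rewrite /w; ring.
have T3 : v * (e2 * h + h * e1) <= v * (w * (A + 2 * D + B + 4 * w)).
  rewrite ler_wpM2l //.
  apply: (@le_trans _ _ ((X * h * A + X * h * (D + 2 * X * h ^+ 2)) * h + h * (X * h * (B + 2 * X * h ^+ 2) + X * D * h))).
    by apply: lerD; [rewrite ler_wpM2r | rewrite ler_wpM2l].
  by apply: le_of_eq; rewrite /w; ring.
have U : X ^+ 2 * (A * (B + 2 * w)) + X ^+ 2 * (w * (B + 2 * w + D)) <= X ^+ 2 * (2 * (A ^+ 2 + B ^+ 2 + D ^+ 2) + 4 * w ^+ 2).
  rewrite -mulrDr ler_wpM2l ?sqr_ge0 //.
  have := sqr_ge0 (A - B); have := sqr_ge0 (A - w); have := sqr_ge0 (w - B); have := sqr_ge0 (w - D).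
  have := sqr_ge0 A; have := sqr_ge0 B; have := sqr_ge0 D.
  lra.
have W : v * (w * (A + 2 * D + B + 4 * w)) <= v * (2 * (A ^+ 2 + B ^+ 2 + D ^+ 2) + 6 * w ^+ 2).
  rewrite ler_wpM2l //.
  have := sqr_ge0 (A - w); have := sqr_ge0 (w - D); have := sqr_ge0 (w - B).
  have := sqr_ge0 A; have := sqr_ge0 B; have := sqr_ge0 D.
  lra.
apply: (le_trans (lerD (lerD T1 T2) T3)).
apply: (le_trans (lerD U W)).
by apply: le_of_eq; rewrite /w; ring.
Qed.

(* [x] is the entry of the Hermitian matrix at (p, q), attached to coordinate [k], and [G0] is the
   resolvent after this entry has been set to 0, hence independent of [x]. *)
Section Atom.
Context (K : finType) d' (V : measurableType d') (R : realType).
Local Notation Om := (config K V).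
Variables (Q : probability Om R) (mu : probability V R) (iid : iid_law Q mu).
Variables (k : K) (x : Om -> R[i]) (N : nat) (G0 G : Om -> 'I_N -> 'I_N -> R[i]).
Variables (p q : 'I_N) (h v w4 : R).
Hypotheses (h0 : 0 <= h).
Hypothesis xk : forall y y', y k = y' k -> x y = x y'.
Hypothesis G0k : forall y y', (forall j, j != k -> y j = y' j) -> G0 y = G0 y'.
Hypotheses (Gh : forall y i j, nc (G y i j) <= h) (G0h : forall y i j, nc (G0 y i j) <= h).
Hypotheses (mG : forall i j, cmeas (fun y => G y i j)) (mG0 : forall i j, cmeas (fun y => G0 y i j)).
Hypothesis pert : forall y i j,
  G0 y i j - G y i j = x y * G0 y i p * G y q j + conjc (x y) * G0 y i q * G y p j.
Hypotheses (mx : cmeas x) (ix4 : itg Q (fun y => nc (x y) ^+ 4)).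
Hypotheses (x1 : CE Q x = 0) (x2 : Ex Q (fun y => nc (x y) ^+ 2) = v)
  (x4 : Ex Q (fun y => nc (x y) ^+ 4) = w4).

Let mnx (e : nat) : measurable_fun setT (fun y => nc (x y) ^+ e).
Proof. by apply: measurable_funX; exact: cmeas_nc. Qed.
Let ix2 : itg Q (fun y => nc (x y) ^+ 2).
Proof.
apply: (itg_sqr_itg (mnx 2)); apply: itg_ext ix4 => y.
by rewrite -exprM.
Qed.
Let cix : citg Q x.
Proof.
apply: (citg_le mx (g := fun y => nc (x y))) => //.
by apply: itg_sqr_itg ix2; exact: cmeas_nc.
Qed.
Let v0 : 0 <= v. Proof. by rewrite -x2; apply: Ex_ge0 => y; exact: sqr_ge0. Qed.
Let v2 : v ^+ 2 <= w4.
Proof.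
rewrite -x2 -x4 (le_trans (Ex_sq_le ix2 _)) //; last first.
  by rewrite (Ex_ext Q (g := fun y => nc (x y) ^+ 4)) // => y; rewrite -exprM.
by apply: itg_ext ix4 => y; rewrite -exprM.
Qed.

Let diff y i j : nc (G0 y i j - G y i j) <= 2 * nc (x y) * h ^+ 2.
Proof.
rewrite pert (le_trans (ncD _ _)) // !ncM nc_conj.
have X0 := nc_ge0 (x y).
have l1 : nc (x y) * nc (G0 y i p) * nc (G y q j) <= nc (x y) * h * h.
  by rewrite ler_pM ?mulr_ge0 ?nc_ge0 // ler_wpM2l.
have l2 : nc (x y) * nc (G0 y i q) * nc (G y p j) <= nc (x y) * h * h.
  by rewrite ler_pM ?mulr_ge0 ?nc_ge0 // ler_wpM2l.
apply: (le_trans (lerD l1 l2)).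
by apply: le_of_eq; ring.
Qed.

Let close y i j : nc (G y i j) <= nc (G0 y i j) + 2 * nc (x y) * h ^+ 2.
Proof.
rewrite (_ : G y i j = G0 y i j - (G0 y i j - G y i j)); last by ring.
by rewrite (le_trans (ncB _ _)) // lerD2l.
Qed.
Let close0 y i j : nc (G0 y i j) ^+ 2 <= 2 * nc (G y i j) ^+ 2 + 8 * (nc (x y) ^+ 2 * h ^+ 4).
Proof.
have : nc (G0 y i j) <= nc (G y i j) + 2 * nc (x y) * h ^+ 2.
  rewrite (_ : G0 y i j = G y i j + (G0 y i j - G y i j)); last by ring.
  by rewrite (le_trans (ncD _ _)) // lerD2l.
rewrite (_ : h ^+ 4 = (h ^+ 2) ^+ 2); last by rewrite -exprM.
have := nc_ge0 (G0 y i j); have := nc_ge0 (G y i j).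
move: (nc (G0 y i j)) (nc (G y i j)) (nc (x y)) (h ^+ 2) => a c X H ha hc hle.
have : a ^+ 2 <= (c + 2 * X * H) ^+ 2 by rewrite ler_sqr ?nnegrE //; exact: le_trans hc hle.
have := sqr_ge0 (c - 2 * X * H); nra.
Qed.

(** Expanding once, x G_qr = x G0_qr - x^2 G0_qp G_qr - |x|^2 G0_qq G_pr. The first term has mean 0
    by independence, and |x|^2 may be replaced by its mean v in front of [G0]. The term with x^2 is
    only bounded, since E x^2 is unknown, but it contains two factors that are small on average. *)
Lemma atom_bound (r : 'I_N) :
  nc (CE Q (fun y => x y * G y q r) + (v%:C)%C * CE Q (fun y => G y q q * G y p r)) <=
  8 * v * (Ex Q (fun y => nc (G y q p) ^+ 2) + Ex Q (fun y => nc (G y q r) ^+ 2)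
           + Ex Q (fun y => nc (G y p q) ^+ 2)) + 106 * w4 * h ^+ 4.
Proof.
pose X y := nc (x y).
pose T y := - (x y ^+ 2 * G0 y q p * G y q r) - (X y ^+ 2)%:C%C * G0 y q q * (G y p r - G0 y p r)
  + (v%:C)%C * (G y q q * G y p r - G0 y q q * G0 y p r).
pose S y := nc (G0 y q p) ^+ 2 + nc (G0 y q r) ^+ 2 + nc (G0 y p q) ^+ 2.
have dec y : x y * G y q r + (v%:C)%C * (G y q q * G y p r)
   = x y * G0 y q r + (v%:C%C - (X y ^+ 2)%:C%C) * (G0 y q q * G0 y p r) + T y.
  have := pert y q r; rewrite -/(X y) => e.
  have xx : conjc (x y) * x y = (X y ^+ 2)%:C%C by rewrite mulrC mulJ.
  have e' : x y * G y q r = x y * G0 y q r - x y ^+ 2 * G0 y q p * G y q r - (X y ^+ 2)%:C%C * G0 y q q * G y p r.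
    rewrite -xx (_ : G y q r = G0 y q r - (G0 y q r - G y q r)); last by ring.
    by rewrite [in LHS]e; ring.
  by rewrite e' /T; ring.
have Tb y : nc (T y) <= 2 * (X y ^+ 2 + v) * S y + 4 * (X y ^+ 4 * h ^+ 4) + 6 * v * (X y ^+ 2 * h ^+ 4).
  have X0 : 0 <= X y := nc_ge0 _.
  apply: (@le_trans _ _ (X y ^+ 2 * nc (G0 y q p) * nc (G y q r) + X y ^+ 2 * h * nc (G0 y p r - G y p r)
     + v * (nc (G0 y q q - G y q q) * h + h * nc (G0 y p r - G y p r)))).
    rewrite /T (le_trans (ncD _ _)) // lerD //.
      rewrite (le_trans (ncB _ _)) // ncN !ncM -/(X y) -expr2 nc_real (ger0_norm (sqr_ge0 _)) [X in _ + _ * X]ncBC lerD //.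
      by rewrite ler_wpM2r ?nc_ge0 // ler_wpM2l ?sqr_ge0.
    rewrite ncM nc_real ger0_norm // ler_wpM2l //.
    rewrite (_ : _ - _ = - ((G0 y q q - G y q q) * G y p r + G0 y q q * (G0 y p r - G y p r))); last by ring.
    rewrite ncN (le_trans (ncD _ _)) // !ncM lerD //.
      by rewrite ler_wpM2l ?nc_ge0.
    by rewrite ler_wpM2r ?nc_ge0.
  have pr i j : nc (G0 y i j - G y i j) <= X y * nc (G0 y i p) * nc (G y q j) + X y * nc (G0 y i q) * nc (G y p j).
    by rewrite pert (le_trans (ncD _ _)) // !ncM nc_conj.
  apply: (@atom_real _ _ _ _ _ _ (nc (G y p q))) => //; try exact: nc_ge0.
    apply: (le_trans (pr _ _)); rewrite lerD // ?[_ * nc (G0 y p q) * _]mulrA ?ler_wpM2r ?nc_ge0 //.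
      by rewrite ler_wpM2l.
    by rewrite ler_wpM2l ?mulr_ge0 ?nc_ge0.
  apply: (le_trans (pr _ _)); rewrite lerD //.
    by rewrite -!mulrA ler_wpM2l // mulrC ler_wpM2r ?nc_ge0.
  by rewrite ler_wpM2r ?nc_ge0 // ler_wpM2l.
have mX e : measurable_fun setT (fun y => X y ^+ e) := mnx e.
have mS : measurable_fun setT S.
  by apply: measurable_funD; [apply: measurable_funD|]; apply: measurable_funX; exact: cmeas_nc.
have sq0 y i j : nc (G0 y i j) ^+ 2 <= h ^+ 2.
  by rewrite ler_sqr ?nnegrE ?nc_ge0.
have sq1 y i j : nc (G y i j) ^+ 2 <= h ^+ 2.
  by rewrite ler_sqr ?nnegrE ?nc_ge0.
have Sb y : `|S y| <= 3 * h ^+ 2.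
  rewrite ger0_norm; last by rewrite /S !addr_ge0 ?sqr_ge0.
  rewrite (_ : 3 * h ^+ 2 = h ^+ 2 + h ^+ 2 + h ^+ 2); last by ring.
  by rewrite /S !lerD.
have iS : itg Q S := itg_bounded Q mS Sb.
have iXS : itg Q (fun y => X y ^+ 2 * S y) := itgM_bounded ix2 mS Sb.
(* This is why [S] is built from [G0]: it is independent of the entry, so |x|^2 can be averaged
   separately. *)
have ES : Ex Q (fun y => X y ^+ 2 * S y) = v * Ex Q S.
  rewrite -x2; apply: (Ex_indep iid (k := k) (C := 3 * h ^+ 2)) => //.
    by move=> y y' e; rewrite /X (xk e).
  by move=> y y' e; rewrite /S (G0k e).
pose bd y := 2 * (X y ^+ 2 * S y) + 2 * v * S y + 4 * h ^+ 4 * X y ^+ 4 + 6 * v * h ^+ 4 * X y ^+ 2.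
have i1 : itg Q (fun y => 2 * (X y ^+ 2 * S y)) := itgZ 2 iXS.
have i2 : itg Q (fun y => 2 * v * S y) := itgZ _ iS.
have i3 : itg Q (fun y => 4 * h ^+ 4 * X y ^+ 4) := itgZ _ ix4.
have i4 : itg Q (fun y => 6 * v * h ^+ 4 * X y ^+ 2) := itgZ _ ix2.
have ibd : itg Q bd := itgD (itgD (itgD i1 i2) i3) i4.
have Ebd : Ex Q bd = 4 * v * Ex Q S + 4 * h ^+ 4 * w4 + 6 * v * h ^+ 4 * v.
  rewrite (ExD (itgD (itgD i1 i2) i3) i4) (ExD (itgD i1 i2) i3) (ExD i1 i2).
  by rewrite (ExZ 2 iXS) (ExZ _ iS) (ExZ _ ix4) (ExZ _ ix2) ES x2 x4; ring.
have mT : cmeas T.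
  have mxr : cmeas (fun y => (X y ^+ 2)%:C%C).
    by split => /=; [exact: mX | exact: measurable_cst].
  apply: cmeasD; [apply: cmeasB|].
  - apply: cmeasN; apply: cmeasM => //; apply: cmeasM => //.
    by apply: cmeas_ext (cmeasM mx mx) => y; rewrite expr2.
  - apply: cmeasM; [apply: cmeasM => //|exact: cmeasB].
  - apply: cmeasM; [exact: cmeas_cst|by apply: cmeasB; apply: cmeasM].
have iT : citg Q T.
  apply: (citg_le mT _ ibd) => y; apply: (le_trans (Tb y)).
  by apply: le_of_eq; rewrite /bd; ring.
have ET : nc (CE Q T) <= Ex Q bd.
  apply: (le_trans (nc_CE iT)); apply: Ex_le => //; first exact: citg_nc.
  move=> y; apply: (le_trans (Tb y)).
  by apply: le_of_eq; rewrite /bd; ring.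
have hb2 (F F' : Om -> 'I_N -> 'I_N -> R[i]) i j i' j' : (forall y i j, nc (F y i j) <= h) ->
    (forall y i j, nc (F' y i j) <= h) -> forall y, nc (F y i j * F' y i' j') <= h * h.
  by move=> f f' y; rewrite ncM ler_pM ?nc_ge0.
have z1 : CE Q (fun y => x y * G0 y q r) = 0.
  rewrite (CE_indep iid (k := k) (C := h)) ?x1 ?mul0r //.
  by move=> y y' e; rewrite (G0k e).
pose D y := v%:C%C - (X y ^+ 2)%:C%C : R[i].
have iD : citg Q D.
  apply: citgB; first exact: citg_cst.
  by split => //=; exact: itg_cst.
have z2 : CE Q (fun y => D y * (G0 y q q * G0 y p r)) = 0.
  rewrite (CE_indep iid (k := k) (C := h * h)) //.
  - rewrite [X in X * _](_ : _ = 0) ?mul0r //.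
    rewrite /D CEB ?CE_cst; [|exact: citg_cst|by split => //=; exact: itg_cst].
    by rewrite /CE /= x2 (Ex_cst Q 0) subrr.
  - by move=> y y' e; rewrite /D /X (xk e).
  - by move=> y y' e; rewrite (G0k e).
  - exact: cmeasM.
  - exact: hb2.
have ia : citg Q (fun y => x y * G y q r) := citgM_bounded cix (mG q r) (fun y => Gh y q r).
have ib : citg Q (fun y => G y q q * G y p r).
  by apply: (@citg_bounded _ _ _ Q _ (h * h)); [exact: cmeasM | exact: hb2].
have ic : citg Q (fun y => x y * G0 y q r) := citgM_bounded cix (mG0 q r) (fun y => G0h y q r).
have id : citg Q (fun y => D y * (G0 y q q * G0 y p r)).
  by apply: (@citgM_bounded _ _ _ Q _ _ (h * h)) => //; [exact: cmeasM | exact: hb2].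
have -> : CE Q (fun y => x y * G y q r) + (v%:C)%C * CE Q (fun y => G y q q * G y p r) = CE Q T.
  rewrite -CEZ // -CED //; last exact: citgZ.
  rewrite (CE_ext Q dec) CED //; last exact: citgD.
  by rewrite CED // z1 z2 !add0r.
apply: (le_trans ET); rewrite Ebd.
have iG i j : itg Q (fun y => nc (G y i j) ^+ 2).
  apply: (itg_bounded Q (C := h ^+ 2)) => [|y]; first by apply: measurable_funX; exact: cmeas_nc.
  by rewrite ger0_norm ?sqr_ge0.
pose S1 y := nc (G y q p) ^+ 2 + nc (G y q r) ^+ 2 + nc (G y p q) ^+ 2.
have iS1 : itg Q S1 := itgD (itgD (iG _ _) (iG _ _)) (iG _ _).
(* [G0] depends on the chosen entry, whereas sums over entries need squares from the common
   resolvent [G]; each of the three exchanges costs 8 |x|^2 h^4. *)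
have ES1 : Ex Q S <= 2 * Ex Q S1 + 24 * h ^+ 4 * v.
  rewrite -x2 -(ExZ _ iS1) -(ExZ _ ix2) -ExD; [|exact: itgZ|exact: itgZ].
  apply: Ex_le => //; first by apply: itgD; exact: itgZ.
  move=> y; have := close0 y q p; have := close0 y q r; have := close0 y p q.
  rewrite /S /S1; lra.
have <- : Ex Q S1 = Ex Q (fun y => nc (G y q p) ^+ 2) + Ex Q (fun y => nc (G y q r) ^+ 2)
           + Ex Q (fun y => nc (G y p q) ^+ 2).
  by rewrite /S1 ExD // ?ExD //; exact: itgD.
have h4 : 0 <= h ^+ 4 by rewrite exprn_even_ge0.
(* The constant of the fourth moment is 106 = 4 + 6 + 4 * 24, after v^2 <= w4. *)
have l1 : 4 * v * Ex Q S <= 4 * v * (2 * Ex Q S1 + 24 * h ^+ 4 * v).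
  by rewrite ler_wpM2l // mulr_ge0.
have l2 : h ^+ 4 * v ^+ 2 <= h ^+ 4 * w4 by rewrite ler_wpM2l.
lra.
Qed.
End Atom.

(** * The Hermitized model *)

Section MeasRes.
Context d (T : measurableType d) (R : realType).

Lemma cmeas_det N (M : T -> 'M[R[i]]_N) : (forall i j, cmeas (fun t => M t i j)) ->
  cmeas (fun t => \det (M t)).
Proof.
move=> mM; rewrite /determinant; apply: cmeas_sum => sg; apply: cmeasM; first exact: cmeas_cst.
by apply: cmeas_prod => i.
Qed.

(** Cramer's rule: an entry of the resolvent is a cofactor divided by the determinant, both
    polynomial in the matrix entries. *)
Lemma cmeas_res N (M : T -> 'M[R[i]]_N) s i j : (forall t, adjmx (M t) = M t) -> Imc s != 0 ->
  (forall i j, cmeas (fun t => M t i j)) -> cmeas (fun t => res (M t) s i j).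
Proof.
move=> hM s0 mM.
have mS i' j' : cmeas (fun t => (M t - s%:M) i' j').
  apply: (@cmeas_ext _ _ _ (fun t => M t i' j' - s *+ (i' == j'))) => [t|].
    by rewrite sub_scalarE.
  by apply: cmeasB => //; exact: cmeas_cst.
apply: (@cmeas_ext _ _ _ (fun t => (\det (M t - s%:M))^-1 * cofactor (M t - s%:M) j i)) => [t|].
  by rewrite /res /invmx herm_unit // [RHS]mxE [X in _ = _ * X]mxE.
apply: cmeasM; first by apply: cmeasV; exact: cmeas_det.
rewrite /cofactor; apply: cmeasM; first exact: cmeas_cst.
apply: cmeas_det => k l; apply: cmeas_ext (mS (lift j k) (lift i l)) => t.
by rewrite !mxE.
Qed.
End MeasRes.

Section ResPerm.
Variable R : rcfType.
Lemma res_reindex N (H H' : 'M[R[i]]_N) s (f : 'I_N -> 'I_N) : adjmx H = H -> Imc s != 0 ->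
  injective f -> (forall i j, H' i j = H (f i) (f j)) ->
  forall i j, res H' s i j = res H s (f i) (f j).
Proof.
move=> hH s0 fi E i j.
pose M := \matrix_(k, l) res H s (f k) (f l).
have U : (H' - s%:M) *m M = 1%:M.
  apply/matrixP => k l; rewrite [LHS]mxE.
  have /matrixP /(_ (f k) (f l)) := resK hH s0.
  rewrite [LHS]mxE [RHS]mxE (inj_eq fi) => e; rewrite [RHS]mxE -e.
  rewrite [RHS](reindex_inj fi) /=; apply: eq_bigr => q _.
  by rewrite !sub_scalarE E (inj_eq fi) [M _ _]mxE.
have [uA _] := mulmx1_unit U.
have -> : res H' s = M.
  by rewrite /res -[RHS](mulKmx uA) U mulmx1.
by rewrite mxE.
Qed.
End ResPerm.

Section KSum.
Variables (n b : nat).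
Hypotheses (n0 : (0 < n)%N) (b0 : (0 < b)%N) (bn : (b %| n)%N).
Local Notation m := (n %/ b)%N.
Local Notation K := (entry_idx m b).
Local Notation rho := (rho n0 b0 bn).
Local Notation kap := (kap bn).

Lemma card_K : #|{: K}| = (3 * b * n)%N.
Proof.
rewrite !card_prod !card_ord.
have h : (m * b = n)%N := divnK bn.
by rewrite -(mulnA 3) h mulnAC.
Qed.

(** For a fixed kind and a fixed column, the rows [rho k] run once through a single block, so their
    sum is part of a full column sum. There are 3 kinds and n columns. *)
Lemma sum_K_le (R : numDomainType) (F : 'I_n -> 'I_n -> R) (C : R) : (forall i j, 0 <= F i j) ->
  (forall j, \sum_i F i j <= C) -> \sum_k F (rho k) (kap k) <= 3 * (n%:R * C).
Proof.
move=> F0 FC; rewrite sum_K.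
rewrite [leRHS](_ : _ = \sum_(kd < 3) (n%:R * C)); last by rewrite sumr_const card_ord mulr_natl.
apply: ler_sum => kd _.
rewrite [leRHS](_ : _ = \sum_(j < n) C); last by rewrite sumr_const card_ord mulr_natl.
rewrite (sum_ix b0 bn); apply: ler_sum => I _.
rewrite exchange_big /=; apply: ler_sum => c _.
apply: le_trans (FC (ix bn I c)); rewrite (sum_ix b0 bn) (bigD1 (rb n0 b0 bn kd I)) //= lerDl.
by apply: sumr_ge0 => J _; exact: sumr_ge0.
Qed.
End KSum.

Section Model.
Context (R : realType) (n b : nat).
Hypotheses (n0 : (0 < n)%N) (b0 : (0 < b)%N) (bn : (b %| n)%N).
Local Notation m := (n %/ b)%N.
Local Notation K := (entry_idx m b).
Local Notation rho := (rho n0 b0 bn).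
Local Notation kap := (kap bn).
Local Notation shK := (@shiftK n b n0 b0 bn).
Local Notation shI := (@shiftI n b n0).
Local Notation V := (measurableTypeR R * measurableTypeR R)%type.
Local Notation Om := (config K V).
Local Notation c := ((3 * b)%N%:R : R).
Variables (z s : R[i]).
Hypothesis s0 : 0 < Imc s.
Let s1 : Imc s != 0. Proof. by rewrite gt_eqF. Qed.

Definition atom (k : K) (y : K -> R * R) : R[i] := ((Num.sqrt c)^-1)%:C%C * cplx_of (y k).
Definition Xc (y : K -> R * R) : 'M[R[i]]_n := Xz_matrix (fun k => cplx_of (y k)) z.
(* [s] is a square root of the spectral parameter zeta. *)
Definition Gc (y : K -> R * R) : 'M[R[i]]_(n + n) := res (hmz (Xc y)) s.

Lemma Xc_entry y i j : Xc y i j = \sum_k atom k y * (rho k == i)%:R * (kap k == j)%:R - z *+ (i == j).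
Proof.
rewrite /Xc /Xz_matrix sub_scalarE mxE (pbb_entry n0 b0 bn) mulr_sumr; congr (_ - _).
by apply: eq_bigr => k _; rewrite /atom !mulrA.
Qed.

Lemma cmeas_coord k : cmeas (fun y : Om => cplx_of (y k)).
Proof.
by split => /=; [apply: measurableT_comp (@measurable_coord _ _ _ k); exact: measurable_fst
                |apply: measurableT_comp (@measurable_coord _ _ _ k); exact: measurable_snd].
Qed.
Lemma cmeas_atom k : cmeas (atom k : Om -> _).
Proof. by apply: cmeasM; [exact: cmeas_cst | exact: cmeas_coord]. Qed.

Lemma cmeas_Xc i j : cmeas (fun y : Om => Xc y i j).
Proof.
apply: (@cmeas_ext _ _ _ (fun y : Om => \sum_k atom k y * (rho k == i)%:R * (kap k == j)%:R - z *+ (i == j))) => [y|].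
  by rewrite Xc_entry.
apply: cmeasB; last exact: cmeas_cst.
apply: cmeas_sum => k; apply: cmeasM; last exact: cmeas_cst.
by apply: cmeasM; [exact: cmeas_atom | exact: cmeas_cst].
Qed.

Lemma cmeas_hmz i j : cmeas (fun y : Om => hmz (Xc y) i j).
Proof.
rewrite -(fintype.splitK i) -(fintype.splitK j); case: (fintype.split i) (fintype.split j) => [a|a] [a'|a'] /=.
- by apply: cmeas_ext (cmeas_cst _ 0) => y; rewrite hmz_ul.
- by apply: cmeas_ext (cmeas_Xc a a') => y; rewrite hmz_ur.
- by apply: cmeas_ext (cmeas_conj (cmeas_Xc a' a)) => y; rewrite hmz_dl.
- by apply: cmeas_ext (cmeas_cst _ 0) => y; rewrite hmz_dr.
Qed.

Lemma cmeas_Gc i j : cmeas (fun y : Om => Gc y i j).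
Proof. by apply: cmeas_res => // [y|*]; [exact: hmz_herm | exact: cmeas_hmz]. Qed.

Lemma Gc_le y i j : nc (Gc y i j) <= (Imc s)^-1.
Proof. by apply: res_le => //; exact: hmz_herm. Qed.

Definition upd0 (k : K) (y : K -> R * R) : K -> R * R := fun j => if j == k then (0, 0) else y j.

Lemma Xc_upd k y i j : Xc y i j = Xc (upd0 k y) i j + atom k y * (rho k == i)%:R * (kap k == j)%:R.
Proof.
have a0 : atom k (upd0 k y) = 0 by rewrite /atom /upd0 eqxx (_ : cplx_of (0, 0) = 0) // mulr0.
pose F w l := atom l w * (rho l == i)%:R * (kap l == j)%:R.
have D w : Xc w i j = F w k + \sum_(l | l != k) F w l - z *+ (i == j).
  by rewrite Xc_entry; congr (_ - _); exact: (bigD1 k).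
have F0 : F (upd0 k y) k = 0 by rewrite /F a0 !mul0r.
have E : \sum_(l | l != k) F (upd0 k y) l = \sum_(l | l != k) F y l.
  by apply: eq_bigr => l lk; rewrite /F /atom /upd0 (negbTE lk).
apply: (etrans (D y)); apply: esym; apply: (etrans (congr1 (fun w => w + _) (D (upd0 k y)))).
by rewrite F0 add0r E [LHS]addrC addrA.
Qed.

Lemma hmz_upd k y : hmz (Xc y) = hmz (Xc (upd0 k y)) +
  (atom k y *: delta_mx (lshift n (rho k)) (rshift n (kap k))
   + conjc (atom k y) *: delta_mx (rshift n (kap k)) (lshift n (rho k))).
Proof.
by apply: hmz_rank_one => i j; exact: Xc_upd. Qed.

Lemma Gc_pert k y i j : Gc (upd0 k y) i j - Gc y i j =
  atom k y * Gc (upd0 k y) i (lshift n (rho k)) * Gc y (rshift n (kap k)) j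
  + conjc (atom k y) * Gc (upd0 k y) i (rshift n (kap k)) * Gc y (lshift n (rho k)) j.
Proof. by apply: res_perturb => //; [exact: hmz_herm | exact: hmz_herm | exact: hmz_upd]. Qed.

Lemma Gc_bdiff (J : finType) (f g : J -> 'I_(n + n)) (q : pred J) j (y y' : Om) : injective f -> injective g ->
  agree_off kap (pred1 j) y y' ->
  nc (\sum_(a | q a) Gc y (f a) (g a) - \sum_(a | q a) Gc y' (f a) (g a)) <= 2 / Imc s.
Proof.
move=> fi gi yy'; apply: (@partial_trace_diff R (n + n) s s0 (hmz (Xc y)) (hmz (Xc y')) (rshift n j) J f g q (hmz_herm _) (hmz_herm _) _ fi gi).
apply: hmz_agree => a a' aj.
apply: (etrans (Xc_entry y a a')); apply: (etrans _ (esym (Xc_entry y' a a'))); congr (_ - _).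
apply: eq_bigr => k _.
have [ka|] := eqVneq (kap k) a'; last by rewrite !mulr0.
by rewrite /atom yy' //= ka.
Qed.

Lemma Gc_shift l y i j : (l <= m)%N -> Gc (fun k => y (shK l k)) i j = Gc y (both (shI l) i) (both (shI l) j).
Proof.
move=> lm; have si := @shiftI_inj n b n0 b0 bn l lm.
apply: (res_reindex (hmz_herm _) s1 (both_inj si)); apply: hmz_reindex => a a'.
have E := pbb_shift n0 b0 bn (fun k => cplx_of (y k)) a a' lm.
apply: (etrans (sub_scalarE _ _ _ _)); apply: (etrans _ (esym (sub_scalarE _ _ _ _))).
rewrite (inj_eq si); congr (_ - _).
apply: (etrans (mxE _ _ _ _)); apply: (etrans _ (esym (mxE _ _ _ _))).
by congr (_ * _).
Qed.
End Model.

(** * Block traces and loop equations *)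

Lemma mul_le_half_sqr (R : realFieldType) (u v : R) : u * v <= 2^-1 * (u ^+ 2 + v ^+ 2).
Proof. by have := sqr_ge0 (u - v); lra. Qed.
Lemma half_sum_le (R : realFieldType) (u v D : R) : u <= D -> v <= D -> 2^-1 * (u + v) <= D.
Proof. by lra. Qed.

Section Cov.
Context d (T : measurableType d) (R : realType) (P : probability T R).

Lemma cov_le (f1 f2 : T -> R[i]) (B1 B2 D : R) : cmeas f1 -> cmeas f2 ->
  (forall t, nc (f1 t) <= B1) -> (forall t, nc (f2 t) <= B2) ->
  Ex P (fun t => (Rec (f1 t) - Ex P (fun t => Rec (f1 t))) ^+ 2) <= D ->
  Ex P (fun t => (Imc (f1 t) - Ex P (fun t => Imc (f1 t))) ^+ 2) <= D ->
  Ex P (fun t => (Rec (f2 t) - Ex P (fun t => Rec (f2 t))) ^+ 2) <= D ->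
  Ex P (fun t => (Imc (f2 t) - Ex P (fun t => Imc (f2 t))) ^+ 2) <= D ->
  nc (CE P (fun t => f1 t * f2 t) - CE P f1 * CE P f2) <= 2 * D.
Proof.
move=> m1 m2 b1 b2 r1 i1 r2 i2.
have c1 : citg P f1 := citg_bounded P m1 b1.
have c2 : citg P f2 := citg_bounded P m2 b2.
have c12 : citg P (fun t => f1 t * f2 t) := citgM_bounded c1 m2 b2.
pose g1 t := f1 t - CE P f1; pose g2 t := f2 t - CE P f2.
have mg1 : cmeas g1 := cmeasB m1 (cmeas_cst _ _).
have mg2 : cmeas g2 := cmeasB m2 (cmeas_cst _ _).
have gb1 t : nc (g1 t) <= B1 + nc (CE P f1) by rewrite (le_trans (ncB _ _)) // lerD2r.
have gb2 t : nc (g2 t) <= B2 + nc (CE P f2) by rewrite (le_trans (ncB _ _)) // lerD2r.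
have cg : citg P (fun t => g1 t * g2 t) := citgM_bounded (citg_bounded P mg1 gb1) mg2 gb2.
have -> : CE P (fun t => f1 t * f2 t) - CE P f1 * CE P f2 = CE P (fun t => g1 t * g2 t).
  have e t : g1 t * g2 t = f1 t * f2 t - CE P f2 * f1 t - (CE P f1 * f2 t - CE P f1 * CE P f2).
    by rewrite /g1 /g2; ring.
  have i3 := citgZ (CE P f2) c1; have i4 := citgZ (CE P f1) c2.
  have i5 := citg_cst P (CE P f1 * CE P f2).
  rewrite (CE_ext P e) (CEB (citgB c12 i3) (citgB i4 i5)) (CEB c12 i3) (CEB i4 i5) CEZ // CEZ // CE_cst; ring.
apply: (le_trans (nc_CE cg)).
pose q1 t := nc (g1 t) ^+ 2; pose q2 t := nc (g2 t) ^+ 2.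
have iq (g : T -> R[i]) (B : R) : cmeas g -> (forall t, nc (g t) <= B) ->
   itg P (fun t => nc (g t) ^+ 2) /\ itg P (fun t => (Rec (g t)) ^+ 2) /\ itg P (fun t => (Imc (g t)) ^+ 2).
  move=> [mr mi] gB; have B0 t : `|nc (g t)| <= B by rewrite ger0_norm ?nc_ge0.
  have aux (f : T -> R) : measurable_fun setT f -> (forall t, `|f t| <= B) -> itg P (fun t => f t ^+ 2).
    move=> mf fB; apply: (itg_bounded P (C := B ^+ 2)) => [|t]; first exact: measurable_funX.
    by rewrite normrX ler_sqr ?nnegrE // (le_trans _ (fB t)).
  split; first by apply: aux => //; exact: cmeas_nc (conj mr mi).
  by split; apply: aux => // t; apply: le_trans (gB t); [exact: nc_re | exact: nc_im].
have [iq1 [ir1 ii1]] := iq _ _ mg1 gb1; have [iq2 [ir2 ii2]] := iq _ _ mg2 gb2.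
have E (g : T -> R[i]) : itg P (fun t => (Rec (g t)) ^+ 2) -> itg P (fun t => (Imc (g t)) ^+ 2) ->
    Ex P (fun t => nc (g t) ^+ 2) = Ex P (fun t => Rec (g t) ^+ 2) + Ex P (fun t => Imc (g t) ^+ 2).
  by move=> h1 h2; rewrite -ExD //; apply: Ex_ext => t; rewrite nc_sq.
have l1 : Ex P q1 <= 2 * D.
  rewrite E // mulr_natl mulr2n; apply: lerD.
    by apply: le_trans r1; apply: le_of_eq; apply: Ex_ext => t; rewrite /g1 cReD cReN.
  by apply: le_trans i1; apply: le_of_eq; apply: Ex_ext => t; rewrite /g1 cImD cImN.
have l2 : Ex P q2 <= 2 * D.
  rewrite E // mulr_natl mulr2n; apply: lerD.
    by apply: le_trans r2; apply: le_of_eq; apply: Ex_ext => t; rewrite /g2 cReD cReN.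
  by apply: le_trans i2; apply: le_of_eq; apply: Ex_ext => t; rewrite /g2 cImD cImN.
apply: (@le_trans _ _ (Ex P (fun t => 2^-1 * (q1 t + q2 t)))).
  apply: Ex_le; [exact: citg_nc|by apply: itgZ; exact: itgD|] => t; rewrite ncM /q1 /q2.
  exact: mul_le_half_sqr.
rewrite ExZ ?ExD //; last exact: itgD.
exact: half_sum_le l1 l2.
Qed.
End Cov.

Section Model.
Context (R : realType) (n b : nat).
Hypotheses (n0 : (0 < n)%N) (b0 : (0 < b)%N) (bn : (b %| n)%N).
Local Notation m := (n %/ b)%N.
Local Notation K := (entry_idx m b).
Local Notation rho := (rho n0 b0 bn).
Local Notation kap := (kap bn).
Local Notation ix := (ix bn).
Local Notation shK := (@shiftK n b n0 b0 bn).
Local Notation shI := (@shiftI n b n0).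
Local Notation V := (measurableTypeR R * measurableTypeR R)%type.
Local Notation Om := (config K V).
Local Notation c := ((3 * b)%N%:R : R).
Variables (z s : R[i]).
Hypothesis s0 : 0 < Imc s.
Local Notation h := ((Imc s)^-1).
Local Notation Gc := (@Gc R n b z s).
Variables (Q : probability Om R) (mu : probability V R) (iid : iid_law Q mu).

(* Embeds an index of X into the upper ([false]) or lower ([true]) half of the Hermitization. *)
Definition sd (u : bool) : 'I_n -> 'I_(n + n) := if u then @rshift n n else @lshift n n.
Lemma sd_inj u : injective (sd u).
Proof. by case: u => /=; [exact: rshift_inj | exact: lshift_inj]. Qed.
Lemma shII_sd l u j : both (shI l) (sd u j) = sd u (shI l j).
Proof. by case: u; [exact: both_r | exact: both_l]. Qed.

Lemma sum_sd_le (F : 'I_(n + n) -> R) u : (forall i, 0 <= F i) -> \sum_i F (sd u i) <= \sum_i F i.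
Proof.
move=> F0; rewrite big_split_ord /=; case: u => /=; [rewrite lerDr|rewrite lerDl]; exact: sumr_ge0.
Qed.

Definition bsum (u u' : bool) (I : 'I_m) (y : Om) : R[i] := \sum_(r < b) Gc y (sd u (ix I r)) (sd u' (ix I r)).
Definition avg (u u' : bool) (y : Om) : R[i] := n%:R^-1 * \sum_i Gc y (sd u i) (sd u' i).

Lemma cG i j : citg Q (fun y => Gc y i j).
Proof. by apply: (citg_bounded Q); [exact: (cmeas_Gc n0 b0 bn z s0) | move=> y; exact: Gc_le]. Qed.
Lemma cmeas_bsum u u' I : cmeas (bsum u u' I).
Proof. by apply: cmeas_sum => r; exact: (cmeas_Gc n0 b0 bn z s0). Qed.
Lemma bsum_le u u' I y : nc (bsum u u' I y) <= b%:R * h.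
Proof.
apply: (le_trans (nc_sum _ _ _)); rewrite [leRHS](_ : _ = \sum_(r < b) h); last first.
  by rewrite sumr_const card_ord mulr_natl.
by apply: ler_sum => r _; exact: Gc_le.
Qed.
Lemma citg_bsum u u' I : citg Q (bsum u u' I).
Proof. exact: (citg_bounded Q (cmeas_bsum u u' I) (@bsum_le u u' I)). Qed.
Lemma citg_avg u u' : citg Q (avg u u').
Proof. by apply: citgZ; apply: citg_sum => i _; exact: cG. Qed.

Let mb : (m * b = n)%N. Proof. exact: divnK. Qed.
Let nC : n%:R != 0 :> R[i]. Proof. by rewrite pnatr_eq0 -lt0n. Qed.
Let mC : m%:R != 0 :> R[i]. Proof. by rewrite pnatr_eq0 -lt0n m_gt0. Qed.
Let nE : n%:R = m%:R * b%:R :> R[i]. Proof. by rewrite -natrM mb. Qed.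

Lemma bsum_mean u u' I : CE Q (bsum u u' I) = b%:R * CE Q (avg u u').
Proof.
pose J0 : 'I_m := Ordinal (m_gt0 n0 b0 bn).
have st J : CE Q (bsum u u' J) = CE Q (bsum u u' J0).
  have lm : (J <= m)%N by exact: ltnW.
  have [h1 h2] := shiftK_cancel n0 b0 bn lm.
  rewrite -[RHS](CE_perm iid h1 h2); last exact: citg_bsum.
  apply: CE_ext => y; rewrite /bsum; apply: eq_bigr => r _.
  have e : addm n0 b0 bn J0 J = J by apply: val_inj; rewrite /= add0n modn_small.
  apply: (etrans _ (esym (Gc_shift n0 b0 bn z s0 y _ _ lm))).
  by rewrite !shII_sd (shiftI_ix n0 b0 bn) e.
have hS : \sum_(J < m) CE Q (bsum u u' J) = n%:R * CE Q (avg u u').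
  rewrite /avg CEZ; last by apply: citg_sum => i _; exact: cG.
  rewrite mulrA divff // mul1r -CE_sum => [|J _]; last exact: citg_bsum.
  by apply: CE_ext => y; rewrite (sum_ix b0 bn).
apply: (mulfI mC); rewrite mulrA -nE -hS (st I).
by rewrite (eq_bigr (fun=> CE Q (bsum u u' J0))) // sumr_const card_ord mulr_natl.
Qed.

Local Notation e2 := (expR (2 : R)).

(** Every one of the n columns of X can move a block trace by 2 h, although the trace has only b
    terms; hence n h^2 and not b h^2. The constant is 16 = 2 * 2! * 2^2 from [bdiff_moment] at
    exponent 2. *)
Lemma bsum_var u u' I (f : R[i] -> R) : f = @Rec R \/ f = @Imc R ->
  Ex Q (fun y => (f (bsum u u' I y) - Ex Q (fun y => f (bsum u u' I y))) ^+ 2) <= 16 * e2 * n%:R * h ^+ 2.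
Proof.
move=> fE; have fD x y : f (x - y) = f x - f y by case: fE => ->; rewrite ?cReD ?cReN ?cImD ?cImN.
have fn x : `|f x| <= nc x by case: fE => ->; [exact: nc_re | exact: nc_im].
have h2 : 0 < 2 * h by rewrite mulr_gt0 // invr_gt0.
have := @bdiff_moment _ _ _ _ _ _ iid n kap (fun y => f (bsum u u' I y)) (b%:R * h) (2 * h) 0 n0 h2.
rewrite muln1 expr1 => H; apply: (le_trans (H _ _ _)).
- by have [r i] := cmeas_bsum u u' I; case: fE => ->.
- by move=> y; exact: le_trans (fn _) (bsum_le _ _ _ _).
- move=> j y y' yy'; rewrite -fD (le_trans (fn _)) //.
  have ij v : injective (fun r => sd v (ix I r)) by move=> r r' /sd_inj e; have [_ ->] := ix_inj b0 e.
  exact: (Gc_bdiff n0 b0 z s0 predT (ij u) (ij u') yy').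
- by apply: le_of_eq; rewrite (_ : 2`!%:R = 2 :> R) //; ring.
Qed.

Lemma bsum_cov u1 u2 u3 u4 I J :
  nc (CE Q (fun y => bsum u1 u2 I y * bsum u3 u4 J y) - b%:R ^+ 2 * (CE Q (avg u1 u2) * CE Q (avg u3 u4)))
   <= 32 * e2 * n%:R * h ^+ 2.
Proof.
rewrite (_ : b%:R ^+ 2 * _ = (b%:R * CE Q (avg u1 u2)) * (b%:R * CE Q (avg u3 u4))); last by ring.
rewrite -(bsum_mean u1 u2 I) -(bsum_mean u3 u4 J).
rewrite (_ : 32 * e2 * n%:R * h ^+ 2 = 2 * (16 * e2 * n%:R * h ^+ 2)); last by ring.
apply: (cov_le (B1 := b%:R * h) (B2 := b%:R * h)); try exact: cmeas_bsum;
  try (by move=> y; exact: bsum_le); apply: bsum_var; by [left | right].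
Qed.

(** Over the entries of one block the sum factors into a product of two block traces; the 3 m blocks
    account for 96 = 3 * 32. *)
Lemma sum_cov u1 u2 u3 u4 :
  nc (\sum_k CE Q (fun y => Gc y (sd u1 (kap k)) (sd u2 (kap k)) * Gc y (sd u3 (rho k)) (sd u4 (rho k)))
      - 3 * m%:R * b%:R ^+ 2 * (CE Q (avg u1 u2) * CE Q (avg u3 u4)))
   <= 96 * e2 * m%:R * n%:R * h ^+ 2.
Proof.
have -> : \sum_k CE Q (fun y => Gc y (sd u1 (kap k)) (sd u2 (kap k)) * Gc y (sd u3 (rho k)) (sd u4 (rho k)))
   = \sum_(kd < 3) \sum_(I < m) CE Q (fun y => bsum u1 u2 I y * bsum u3 u4 (rb n0 b0 bn kd I) y).
  rewrite sum_K; apply: eq_bigr => kd _; apply: eq_bigr => I _.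
  have cGG i j i' j' : citg Q (fun y => Gc y i j * Gc y i' j').
    apply: (citgM_bounded (cG i j) (cmeas_Gc n0 b0 bn z s0 i' j')) => y; exact: Gc_le.
  transitivity (CE Q (fun y => \sum_(r < b) \sum_(a < b) (Gc y (sd u1 (ix I a)) (sd u2 (ix I a)) *
      Gc y (sd u3 (ix (rb n0 b0 bn kd I) r)) (sd u4 (ix (rb n0 b0 bn kd I) r))))).
    rewrite CE_sum => [|r _]; last by apply: citg_sum => a _; exact: cGG.
    by apply: eq_bigr => r _; rewrite CE_sum // => a _; exact: cGG.
  by apply: CE_ext => y; rewrite /bsum mulr_suml exchange_big /=; apply: eq_bigr => a _; rewrite mulr_sumr.
set A := CE Q _ * CE Q _.
rewrite (_ : 3 * m%:R * b%:R ^+ 2 * A = \sum_(kd < 3) \sum_(I < m) (b%:R ^+ 2 * A)); last first.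
  rewrite !sumr_const !card_ord -[RHS]mulr_natl -[in RHS]mulr_natl; ring.
rewrite -sumrB; apply: (le_trans (nc_sum _ _ _)).
rewrite [leRHS](_ : _ = \sum_(kd < 3) \sum_(I < m) (32 * e2 * n%:R * h ^+ 2)); last first.
  rewrite !sumr_const !card_ord -[RHS]mulr_natl -[in RHS]mulr_natl; ring.
apply: ler_sum => kd _; rewrite -sumrB; apply: (le_trans (nc_sum _ _ _)).
by apply: ler_sum => I _; exact: bsum_cov.
Qed.

Lemma sum_sq_K u u' y : \sum_k nc (Gc y (sd u (rho k)) (sd u' (kap k))) ^+ 2 <= 3 * (n%:R * h ^+ 2).
Proof.
apply: (sum_K_le n0 b0 bn (F := fun i j => nc (Gc y (sd u i) (sd u' j)) ^+ 2)) => [i j|j]; first exact: sqr_ge0.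
have H := res_col_le (hmz_herm (Xc z y)) (lt0r_neq0 s0) s0 (sd u' j).
apply: le_trans H.
by apply: (@sum_sd_le (fun i => nc (Gc y i (sd u' j)) ^+ 2)) => i; exact: sqr_ge0.
Qed.
Lemma sum_sq_K' u u' y : \sum_k nc (Gc y (sd u' (kap k)) (sd u (rho k))) ^+ 2 <= 3 * (n%:R * h ^+ 2).
Proof.
apply: (sum_K_le n0 b0 bn (F := fun i j => nc (Gc y (sd u' j) (sd u i)) ^+ 2)) => [i j|j]; first exact: sqr_ge0.
have H := res_row_le (hmz_herm (Xc z y)) (lt0r_neq0 s0) s0 (sd u' j).
apply: le_trans H.
by apply: (@sum_sd_le (fun i => nc (Gc y (sd u' j) i) ^+ 2)) => i; exact: sqr_ge0.
Qed.

Lemma itg_sq i j : itg Q (fun y => nc (Gc y i j) ^+ 2).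
Proof.
apply: (itg_bounded Q (C := h ^+ 2)) => [|y].
  by apply: measurable_funX; apply: cmeas_nc; exact: (cmeas_Gc n0 b0 bn z s0).
rewrite ger0_norm ?sqr_ge0 // ler_sqr ?nnegrE ?nc_ge0 ?invr_ge0 ?(ltW s0) //; exact: Gc_le.
Qed.

Lemma Ex_sq_K (i j : K -> 'I_(n + n)) (C : R) : (forall y, \sum_k nc (Gc y (i k) (j k)) ^+ 2 <= C) ->
  \sum_k Ex Q (fun y => nc (Gc y (i k) (j k)) ^+ 2) <= C.
Proof.
move=> hC; rewrite -Ex_sum => [|k _]; last exact: itg_sq.
rewrite -[leRHS](Ex_cst Q C); apply: Ex_le => //; last exact: itg_cst.
by apply: itg_sum => k _; exact: itg_sq.
Qed.
End Model.

Lemma sum_entries (C : comNzRingType) n (K : finType) (rho kap : K -> 'I_n) (a : K -> C) (z : C)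
    (X F : 'I_n -> 'I_n -> C) :
  (forall i j, X i j = \sum_k a k * (rho k == i)%:R * (kap k == j)%:R - z *+ (i == j)) ->
  \sum_i \sum_j X i j * F i j = \sum_k a k * F (rho k) (kap k) - z * \sum_i F i i.
Proof.
move=> XE.
transitivity (\sum_i \sum_j (\sum_k a k * (rho k == i)%:R * (kap k == j)%:R * F i j - z *+ (i == j) * F i j)).
  by apply: eq_bigr => i _; apply: eq_bigr => j _; rewrite XE mulrBl mulr_suml.
under eq_bigr do rewrite sumrB; rewrite sumrB; congr (_ - _).
  transitivity (\sum_i \sum_k a k * (rho k == i)%:R * F i (kap k)).
    apply: eq_bigr => i _; rewrite exchange_big /=; apply: eq_bigr => k _.
    rewrite (bigD1 (kap k)) //= eqxx mulr1 big1 ?addr0 // => j jk.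
    by rewrite [kap k == j]eq_sym (negbTE jk) mulr0 mul0r.
  rewrite exchange_big /=; apply: eq_bigr => k _.
  rewrite (bigD1 (rho k)) //= eqxx mulr1 big1 ?addr0 // => j jk.
  by rewrite [rho k == j]eq_sym (negbTE jk) mulr0 mul0r.
rewrite mulr_sumr; apply: eq_bigr => i _.
rewrite (bigD1 i) //= eqxx mulr1n big1 ?addr0 // => j ji.
by rewrite [i == j]eq_sym (negbTE ji) mulr0n mul0r.
Qed.

(** The defects are d1 = 1 + a (s + a) + z be and d2 = be (s + a) + zb a. In (s + a) d1 - z d2 the
    unknown [be] cancels. Each defect combines an expansion error with a decoupling error. *)
Lemma loop_algebra (C : fieldType) (n c k a be s z zb r2 U1 W1 U2 W2 : C) : n != 0 -> c != 0 -> k = n * c ->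
  r2 = z * zb ->
  n^-1 * U1 - z * be = 1 + s * a -> n^-1 * U2 - zb * a = s * be ->
  let d1 := n^-1 * (U1 + c^-1 * W1) - n^-1 * c^-1 * (W1 - k * (a * a)) in
  let d2 := n^-1 * (U2 + c^-1 * W2) - n^-1 * c^-1 * (W2 - k * (be * a)) in
  a * (r2 - (s + a) ^+ 2) = (s + a) + (- d1) * (s + a) - z * (- d2).
Proof.
move=> n0 c0 -> -> E1 E2 d1 d2.
have -> : d1 = 1 + s * a + a * a + z * be.
  rewrite /d1 -E1; field; by rewrite n0 c0.
have -> : d2 = s * be + zb * a + be * a.
  rewrite /d2 -E2; field; by rewrite n0 c0.
ring.
Qed.

Lemma CE_conj d (T : measurableType d) (R : realType) (P : probability T R) (u : T -> R[i]) :
  citg P u -> CE P (fun t => conjc (u t)) = conjc (CE P u).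
Proof.
move=> [ur ui]; rewrite /CE /=; congr Complex; first by apply: Ex_ext => t; case: (u t).
by rewrite -ExN //; apply: Ex_ext => t; case: (u t).
Qed.

Section Model.
Context (R : realType) (n b : nat).
Hypotheses (n0 : (0 < n)%N) (b0 : (0 < b)%N) (bn : (b %| n)%N).
Local Notation m := (n %/ b)%N.
Local Notation K := (entry_idx m b).
Local Notation rho := (rho n0 b0 bn).
Local Notation kap := (kap bn).
Local Notation V := (measurableTypeR R * measurableTypeR R)%type.
Local Notation Om := (config K V).
Local Notation c := ((3 * b)%N%:R : R).
Variables (z s : R[i]).
Hypothesis s0 : 0 < Imc s.
Local Notation h := ((Imc s)^-1).
Local Notation Gc := (@Gc R n b z s).
Local Notation atom := (@atom R n b).
Variables (Q : probability Om R) (mu : probability V R) (iid : iid_law Q mu).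
Variable w : R.
Hypothesis hE1 : forall k, CE Q (fun y => cplx_of (y k)) = 0.
Hypothesis hE2 : forall k, Ex Q (fun y => nc (cplx_of (y k)) ^+ 2) = 1.
Hypothesis hI4 : forall k, itg Q (fun y => nc (cplx_of (y k)) ^+ 4).
Hypothesis hE4 : forall k, Ex Q (fun y => nc (cplx_of (y k)) ^+ 4) = w.

Let c_gt0 : 0 < c. Proof. by rewrite ltr0n muln_gt0. Qed.
Let h_gt0 : 0 < h. Proof. by rewrite invr_gt0. Qed.
Let sn : Imc s != 0. Proof. exact: lt0r_neq0. Qed.

Lemma nc_atom k y : nc (atom k y) = (Num.sqrt c)^-1 * nc (cplx_of (y k)).
Proof. by rewrite /atom ncM nc_real ger0_norm // invr_ge0 sqrtr_ge0. Qed.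

Lemma nc_atom2 k y : nc (atom k y) ^+ 2 = c^-1 * nc (cplx_of (y k)) ^+ 2.
Proof. by rewrite nc_atom exprMn exprVn sqr_sqrtr // ltW. Qed.
Lemma nc_atom4 k y : nc (atom k y) ^+ 4 = c^-1 ^+ 2 * nc (cplx_of (y k)) ^+ 4.
Proof. by rewrite (exprM _ 2 2) nc_atom2 exprMn -exprM. Qed.

Lemma itg_coord2 k : itg Q (fun y => nc (cplx_of (y k)) ^+ 2).
Proof.
apply: itg_sqr_itg; first by apply: measurable_funX; apply: cmeas_nc; exact: cmeas_coord.
by apply: itg_ext (hI4 k) => y; rewrite -exprM.
Qed.
Lemma citg_coord k : citg Q (fun y => cplx_of (y k)).
Proof.
apply: (citg_le (P := Q) (g := fun y : Om => nc (cplx_of (y k))) (cmeas_coord R k)) => //.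
by apply: itg_sqr_itg (itg_coord2 k); apply: cmeas_nc; exact: cmeas_coord.
Qed.
Lemma atom_mean k : CE Q (atom k) = 0.
Proof. by rewrite /atom CEZ ?hE1 ?mulr0 //; exact: citg_coord. Qed.
Lemma atom_sq k : Ex Q (fun y => nc (atom k y) ^+ 2) = c^-1.
Proof. by rewrite (Ex_ext Q (nc_atom2 k)) ExZ ?hE2 ?mulr1 //; exact: itg_coord2. Qed.
Lemma itg_atom4 k : itg Q (fun y => nc (atom k y) ^+ 4).
Proof. by apply: itg_ext (itgZ (c^-1 ^+ 2) (hI4 k)) => y; rewrite nc_atom4. Qed.
Lemma atom_4 k : Ex Q (fun y => nc (atom k y) ^+ 4) = c^-1 ^+ 2 * w.
Proof. by rewrite (Ex_ext Q (nc_atom4 k)) ExZ ?hE4. Qed.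

Lemma cmeas_upd k i j : cmeas (fun y : Om => Gc (upd0 k y) i j).
Proof.
have mf : measurable_fun setT (upd0 k : Om -> Om).
  apply: measurable_config => l; rewrite /upd0; case: (l == k); first exact: measurable_cst.
  exact: measurable_coord.
have [m1 m2] := cmeas_Gc n0 b0 bn z s0 i j.
by split; [exact: (measurableT_comp m1 mf) | exact: (measurableT_comp m2 mf)].
Qed.

Lemma upd_agree k (y y' : Om) : (forall j, j != k -> y j = y' j) -> upd0 k y = upd0 k y'.
Proof. by move=> e; apply/funext => j; rewrite /upd0; case: eqVneq => // /e. Qed.

Lemma atom_bound_row k r : let q := sd true (kap k) in let p := sd false (rho k) in
  nc (CE Q (fun y => atom k y * Gc y q r) + ((c^-1)%:C)%C * CE Q (fun y => Gc y q q * Gc y p r)) <=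
  8 * c^-1 * (Ex Q (fun y => nc (Gc y q p) ^+ 2) + Ex Q (fun y => nc (Gc y q r) ^+ 2)
           + Ex Q (fun y => nc (Gc y p q) ^+ 2)) + 106 * (c^-1 ^+ 2 * w) * h ^+ 4.
Proof.
pose G0 (y : Om) := fun i j => Gc (upd0 k y) i j.
have a1 : forall y y' : Om, y k = y' k -> atom k y = atom k y' by move=> y y' e; rewrite /atom e.
have a2 : forall y y' : Om, (forall j, j != k -> y j = y' j) -> G0 y = G0 y'.
  by move=> y y' e; rewrite /G0 (upd_agree e).
have a3 y i j : nc (Gc y i j) <= h := Gc_le z s0 y i j.
have a4 y i j : nc (G0 y i j) <= h := Gc_le z s0 (upd0 k y) i j.
have a5 := cmeas_Gc n0 b0 bn z s0.
have a6 := cmeas_upd k.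
cbv zeta. refine (atom_bound iid (G0 := G0) (G := fun y i j => Gc y i j) (p := sd false (rho k)) (q := sd true (kap k)) (ltW h_gt0) a1 a2 a3 a4 a5 a6 (Gc_pert n0 b0 bn z s0 k)
  (cmeas_atom R k) (itg_atom4 k) (atom_mean k) (atom_sq k) (atom_4 k) r).
Qed.

(** The transposed position of the Hermitization holds the conjugate entry, so the same expansion
    applies with [p] and [q] exchanged. *)
Lemma atom_bound_col k r : let q := sd false (rho k) in let p := sd true (kap k) in
  nc (CE Q (fun y => conjc (atom k y) * Gc y q r) + ((c^-1)%:C)%C * CE Q (fun y => Gc y q q * Gc y p r)) <=
  8 * c^-1 * (Ex Q (fun y => nc (Gc y q p) ^+ 2) + Ex Q (fun y => nc (Gc y q r) ^+ 2)
           + Ex Q (fun y => nc (Gc y p q) ^+ 2)) + 106 * (c^-1 ^+ 2 * w) * h ^+ 4.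
Proof.
pose G0 (y : Om) := fun i j => Gc (upd0 k y) i j.
pose X (y : Om) := conjc (atom k y).
have a1 : forall y y' : Om, y k = y' k -> X y = X y' by move=> y y' e; rewrite /X /atom e.
have a2 : forall y y' : Om, (forall j, j != k -> y j = y' j) -> G0 y = G0 y'.
  by move=> y y' e; rewrite /G0 (upd_agree e).
have a3 y i j : nc (Gc y i j) <= h := Gc_le z s0 y i j.
have a4 y i j : nc (G0 y i j) <= h := Gc_le z s0 (upd0 k y) i j.
have a5 := cmeas_Gc n0 b0 bn z s0.
have a6 := cmeas_upd k.
have a7 y i j : G0 y i j - Gc y i j = X y * G0 y i (sd true (kap k)) * Gc y (sd false (rho k)) j
    + conjc (X y) * G0 y i (sd false (rho k)) * Gc y (sd true (kap k)) j.
  by rewrite /X conjcK [RHS]addrC; exact: Gc_pert.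
have a8 : cmeas X := cmeas_conj (cmeas_atom R k).
have a9 : itg Q (fun y => nc (X y) ^+ 4).
  by apply: itg_ext (itg_atom4 k) => y; rewrite nc_conj.
have a10 : CE Q X = 0.
  by rewrite /X CE_conj ?atom_mean ?conjc0 //; exact: citgZ (citg_coord k).
have a11 : Ex Q (fun y => nc (X y) ^+ 2) = c^-1.
  by rewrite -(atom_sq k); apply: Ex_ext => y; rewrite nc_conj.
have a12 : Ex Q (fun y => nc (X y) ^+ 4) = c^-1 ^+ 2 * w.
  by rewrite -(atom_4 k); apply: Ex_ext => y; rewrite nc_conj.
cbv zeta; exact: (atom_bound iid (G0 := G0) (G := fun y i j => Gc y i j) (p := sd true (kap k)) (q := sd false (rho k)) (ltW h_gt0) a1 a2 a3 a4 a5 a6 a7 a8 a9 a10 a11 a12).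
Qed.

Lemma sum_K_cst (x : R) : \sum_(k : K) x = c * n%:R * x.
Proof. by rewrite sumr_const (card_K bn) -[LHS]mulr_natl natrM. Qed.

Local Notation ERR := (72 * h ^+ 2 / c + 106 * w * h ^+ 4 / c).

(** The squares sum to O(n h^2) irrespective of the number of entries, giving 72 = 8 * 9; the fourth
    moment term is multiplied by the c n entries and keeps one factor 1 / c. *)
Lemma sum_atom_bound (A B D : K -> R) (x : K -> R[i]) : \sum_k A k <= 3 * (n%:R * h ^+ 2) ->
  \sum_k B k <= 3 * (n%:R * h ^+ 2) -> \sum_k D k <= 3 * (n%:R * h ^+ 2) ->
  (forall k, nc (x k) <= 8 * c^-1 * (A k + B k + D k) + 106 * (c^-1 ^+ 2 * w) * h ^+ 4) ->
  nc (\sum_k x k) <= n%:R * ERR.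
Proof.
move=> hA hB hD hx; apply: (le_trans (nc_sum _ _ _)).
apply: (le_trans (ler_sum _ (fun k _ => hx k))).
rewrite big_split /= sum_K_cst -mulr_sumr !big_split /=.
have -> : n%:R * ERR = 8 * c^-1 * (3 * (n%:R * h ^+ 2) + 3 * (n%:R * h ^+ 2) + 3 * (n%:R * h ^+ 2))
    + c * n%:R * (106 * (c^-1 ^+ 2 * w) * h ^+ 4).
  move: (c_gt0) => /lt0r_neq0; move: (c) (h) (w) (n%:R) => C H W N C0; field.
  exact: C0.
by rewrite lerD2r ler_wpM2l ?mulr_ge0 ?invr_ge0 ?(ltW c_gt0) // !lerD.
Qed.
End Model.

Lemma div_trace (F : fieldType) (N A z B s D x : F) : N != 0 -> A - z * B = N * x + s * D ->
  N^-1 * A - z * (N^-1 * B) = x + s * (N^-1 * D).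
Proof. by move=> N0 e; rewrite (_ : A = N * x + s * D + z * B); [field | rewrite -e; ring]. Qed.

Lemma nc_natV (R : rcfType) (n : nat) : nc (n%:R^-1 : R[i]) = n%:R^-1.
Proof. by rewrite ncV -[n%:R in LHS](rmorph_nat (real_complex R)) nc_real ger0_norm. Qed.

Lemma conjc_mul_nat (R : rcfType) (a : R[i]) (p q : nat) : conjc (a * p%:R * q%:R) = conjc a * p%:R * q%:R.
Proof. by rewrite !rmorphM /= !rmorph_nat. Qed.

Section Model.
Context (R : realType) (n b : nat).
Hypotheses (n0 : (0 < n)%N) (b0 : (0 < b)%N) (bn : (b %| n)%N).
Local Notation m := (n %/ b)%N.
Local Notation K := (entry_idx m b).
Local Notation rho := (rho n0 b0 bn).
Local Notation kap := (kap bn).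
Local Notation V := (measurableTypeR R * measurableTypeR R)%type.
Local Notation Om := (config K V).
Local Notation c := ((3 * b)%N%:R : R).
Variables (z s : R[i]).
Hypothesis s0 : 0 < Imc s.
Local Notation h := ((Imc s)^-1).
Local Notation Gc := (@Gc R n b z s).
Local Notation atom := (@atom R n b).
Local Notation avg := (@avg R n b z s).
Let sn : Imc s != 0. Proof. exact: lt0r_neq0. Qed.
Let nC : n%:R != 0 :> R[i]. Proof. by rewrite pnatr_eq0 -lt0n. Qed.

(** Normalised trace of the upper left block of (H - s) G = 1, with the deterministic shift of X
    separated from its random entries. *)
Lemma trace_top y : n%:R^-1 * (\sum_k atom k y * Gc y (sd true (kap k)) (sd false (rho k)))
   - z * avg true false y = 1 + s * avg false false y.
Proof.
pose F i j := Gc y (sd true j) (sd false i).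
have e := sum_entries F (Xc_entry n0 b0 bn z y).
have e' : \sum_i \sum_j Xc z y i j * F i j = n%:R + s * \sum_i Gc y (sd false i) (sd false i).
  transitivity (\sum_(i < n) (1 + s * Gc y (sd false i) (sd false i))).
    by apply: eq_bigr => i _; have := hmz_top (Xc z y) sn i i; rewrite eqxx.
  by rewrite big_split /= sumr_const card_ord mulr_sumr.
have := div_trace nC (etrans (esym e) (etrans e' (congr1 (fun x => x + _) (esym (mulr1 _))))).
exact.
Qed.

Lemma trace_bot y : n%:R^-1 * (\sum_k conjc (atom k y) * Gc y (sd false (rho k)) (sd false (kap k)))
   - conjc z * avg false false y = s * avg true false y.
Proof.
pose F i j := Gc y (sd false i) (sd false j).
have ent i j : conjc (Xc z y i j) =
    \sum_k conjc (atom k y) * (rho k == i)%:R * (kap k == j)%:R - conjc z *+ (i == j).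
  rewrite (Xc_entry n0 b0 bn) rmorphB /= rmorph_sum /= rmorphMn /=; congr (_ - _).
  by apply: eq_bigr => k _; exact: conjc_mul_nat.
have e := sum_entries F ent.
have e' : \sum_i \sum_j conjc (Xc z y i j) * F i j = s * \sum_i Gc y (sd true i) (sd false i).
  rewrite exchange_big mulr_sumr; apply: eq_bigr => i _.
  exact: (hmz_bot (Xc z y) sn i i).
by have := div_trace nC (etrans (esym e) (etrans e' (esym (etrans (congr1 (fun x => x + _) (mulr0 _)) (add0r _))))); rewrite add0r.
Qed.

Lemma avg_TT y : avg true true y = avg false false y.
Proof. by rewrite /avg -(hmz_trace (Xc z y) sn). Qed.

Lemma avg_le u u' y : nc (avg u u' y) <= h.
Proof.
rewrite /avg ncM nc_natV.
have n_gt0 : 0 < n%:R :> R by rewrite ltr0n.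
rewrite ler_pdivrMl // (le_trans (nc_sum _ _ _)) //.
rewrite [leRHS](_ : _ = \sum_(i < n) h); last by rewrite sumr_const card_ord mulr_natl.
by apply: ler_sum => i _; exact: (Gc_le z s0).
Qed.
End Model.

Section Model.
Context (R : realType) (n b : nat).
Hypotheses (n0 : (0 < n)%N) (b0 : (0 < b)%N) (bn : (b %| n)%N).
Local Notation m := (n %/ b)%N.
Local Notation K := (entry_idx m b).
Local Notation rho := (rho n0 b0 bn).
Local Notation kap := (kap bn).
Local Notation V := (measurableTypeR R * measurableTypeR R)%type.
Local Notation Om := (config K V).
Local Notation c := ((3 * b)%N%:R : R).
Variables (z s : R[i]).
Hypothesis s0 : 0 < Imc s.
Local Notation h := ((Imc s)^-1).
Local Notation Gc := (@Gc R n b z s).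
Local Notation atom := (@atom R n b).
Local Notation avg := (@avg R n b z s).
Variables (Q : probability Om R) (mu : probability V R) (iid : iid_law Q mu).
Variable w : R.
Hypothesis hE1 : forall k, CE Q (fun y => cplx_of (y k)) = 0.
Hypothesis hE2 : forall k, Ex Q (fun y => nc (cplx_of (y k)) ^+ 2) = 1.
Hypothesis hI4 : forall k, itg Q (fun y => nc (cplx_of (y k)) ^+ 4).
Hypothesis hE4 : forall k, Ex Q (fun y => nc (cplx_of (y k)) ^+ 4) = w.
Let sn : Imc s != 0. Proof. exact: lt0r_neq0. Qed.
Let n_gt0 : 0 < n%:R :> R. Proof. by rewrite ltr0n. Qed.
Let c_gt0 : 0 < c. Proof. by rewrite ltr0n muln_gt0. Qed.
Local Notation e2 := (expR (2 : R)).
Local Notation ERR := (72 * h ^+ 2 / c + 106 * w * h ^+ 4 / c).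

Lemma defect_le (S W : R[i]) : nc S <= n%:R * ERR -> nc W <= 96 * e2 * m%:R * n%:R * h ^+ 2 ->
  nc (n%:R^-1 * S - n%:R^-1 * ((3 * b)%:R)^-1 * W) <= ERR + 96 * e2 * m%:R * h ^+ 2 / c.
Proof.
move=> hS hW; apply: (le_trans (ncB _ _)); rewrite !ncM !nc_natV; apply: lerD.
  by rewrite ler_pdivrMl.
rewrite -invfM ler_pdivrMl ?mulr_gt0 //; apply: (le_trans hW).
apply: le_of_eq;
by move: (lt0r_neq0 c_gt0); move: (c) (h) (m%:R) (n%:R) (e2) => C H M N E C0; field.
Qed.

Lemma citg_atomM k i j : citg Q (fun y => atom k y * Gc y i j).
Proof.
apply: (citgM_bounded _ (cmeas_Gc n0 b0 bn z s0 i j) (fun y => Gc_le z s0 y i j)).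
by apply: citgZ; exact: (citg_coord hI4).
Qed.
Lemma citg_atomcM k i j : citg Q (fun y => conjc (atom k y) * Gc y i j).
Proof.
apply: (citgM_bounded _ (cmeas_Gc n0 b0 bn z s0 i j) (fun y => Gc_le z s0 y i j)).
have [ir ii] : citg Q (atom k) by apply: citgZ; exact: (citg_coord hI4).
split; first by apply: itg_ext ir => y; case: (atom k y).
by apply: itg_ext (itgN ii) => y; case: (atom k y).
Qed.

Lemma loop_eqs : let a := CE Q (avg false false) in exists e1' e2',
  a * ((nc z ^+ 2)%:C%C - (s + a) ^+ 2) = (s + a) + e1' * (s + a) - z * e2' /\
  nc e1' + nc e2' <= 2 * (ERR + 96 * e2 * m%:R * h ^+ 2 / c).
Proof.
move=> a; pose be := CE Q (avg true false).
pose U1 := \sum_k CE Q (fun y => atom k y * Gc y (sd true (kap k)) (sd false (rho k))).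
pose U2 := \sum_k CE Q (fun y => conjc (atom k y) * Gc y (sd false (rho k)) (sd false (kap k))).
pose W1 := \sum_k CE Q (fun y => Gc y (sd true (kap k)) (sd true (kap k)) * Gc y (sd false (rho k)) (sd false (rho k))).
pose W2 := \sum_k CE Q (fun y => Gc y (sd true (kap k)) (sd false (kap k)) * Gc y (sd false (rho k)) (sd false (rho k))).
have ia u u' : citg Q (avg u u') by exact: citg_avg.
have iU1 : citg Q (fun y => \sum_k atom k y * Gc y (sd true (kap k)) (sd false (rho k))).
  by apply: citg_sum => k _; exact: citg_atomM.
have iU2 : citg Q (fun y => \sum_k conjc (atom k y) * Gc y (sd false (rho k)) (sd false (kap k))).
  by apply: citg_sum => k _; exact: citg_atomcM.
have T1 : n%:R^-1 * U1 - z * be = 1 + s * a.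
  have e := CE_ext Q (trace_top n0 b0 bn z s0).
  rewrite (CEB (citgZ _ iU1) (citgZ z (ia _ _))) (CEZ _ iU1) (CEZ z (ia _ _)) in e.
  rewrite (CED (citg_cst Q 1) (citgZ s (ia _ _))) (CEZ s (ia _ _)) CE_cst in e.
  by rewrite CE_sum in e => [|k _]; [exact: e | exact: citg_atomM].
have T2 : n%:R^-1 * U2 - conjc z * a = s * be.
  have e := CE_ext Q (trace_bot n0 b0 bn z s0).
  rewrite (CEB (citgZ _ iU2) (citgZ (conjc z) (ia _ _))) (CEZ _ iU2) (CEZ _ (ia false false)) in e.
  rewrite (CEZ s (ia _ _)) in e.
  by rewrite CE_sum in e => [|k _]; [exact: e | exact: citg_atomcM].
have cE : (c^-1)%:C%C = ((3 * b)%:R)^-1 :> R[i] by rewrite fmorphV rmorph_nat.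
have B1 : nc (U1 + ((3 * b)%:R)^-1 * W1) <= n%:R * ERR.
  rewrite /U1 /W1 mulr_sumr -big_split /= -cE.
  pose A k := Ex Q (fun y => nc (Gc y (sd true (kap k)) (sd false (rho k))) ^+ 2).
  pose D k := Ex Q (fun y => nc (Gc y (sd false (rho k)) (sd true (kap k))) ^+ 2).
  (* Here r = p, so the first two squares of [atom_bound_row] coincide. *)
  apply: (@sum_atom_bound _ n b b0 bn s w A A D) => [|||k]; last first.
  - exact: (atom_bound_row n0 b0 bn z s0 iid hE1 hE2 hI4 hE4 k (sd false (rho k))).
  - by apply: Ex_sq_K => // y; exact: sum_sq_K.
  - by apply: Ex_sq_K => // y; exact: sum_sq_K'.
  - by apply: Ex_sq_K => // y; exact: sum_sq_K'.
have B2 : nc (U2 + ((3 * b)%:R)^-1 * W2) <= n%:R * ERR.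
  have -> : W2 = \sum_k CE Q (fun y => Gc y (sd false (rho k)) (sd false (rho k)) * Gc y (sd true (kap k)) (sd false (kap k))).
    by apply: eq_bigr => k _; apply: CE_ext => y; rewrite mulrC.
  rewrite /U2 mulr_sumr -big_split /= -cE.
  pose A k := Ex Q (fun y => nc (Gc y (sd false (rho k)) (sd true (kap k))) ^+ 2).
  pose B k := Ex Q (fun y => nc (Gc y (sd false (rho k)) (sd false (kap k))) ^+ 2).
  pose D k := Ex Q (fun y => nc (Gc y (sd true (kap k)) (sd false (rho k))) ^+ 2).
  apply: (@sum_atom_bound _ n b b0 bn s w A B D) => [|||k]; last first.
  - exact: (atom_bound_col n0 b0 bn z s0 iid hE1 hE2 hI4 hE4 k (sd false (kap k))).
  - by apply: Ex_sq_K => // y; exact: sum_sq_K'.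
  - by apply: Ex_sq_K => // y; exact: sum_sq_K.
  - by apply: Ex_sq_K => // y; exact: sum_sq_K.
have aT : CE Q (avg true true) = a by apply: CE_ext => y; exact: avg_TT.
have C1 := sum_cov n0 b0 bn z s0 iid true true false false; rewrite aT -/W1 -/a in C1.
have C2 := sum_cov n0 b0 bn z s0 iid true false false false; rewrite -/W2 -/a -/be in C2.
have nC : n%:R != 0 :> R[i] by rewrite pnatr_eq0 -lt0n.
have cC : (3 * b)%:R != 0 :> R[i] by rewrite pnatr_eq0 -lt0n muln_gt0.
have kE : 3 * m%:R * b%:R ^+ 2 = n%:R * (3 * b)%:R :> R[i].
  by rewrite -[n in RHS](divnK bn) !natrM; ring.
have L := loop_algebra W1 W2 nC cC kE (esym (mulJ z)) T1 T2.
have D1 := defect_le B1 C1; have D2 := defect_le B2 C2.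
exists (- (n%:R^-1 * (U1 + (3 * b)%:R^-1 * W1) - n%:R^-1 * (3 * b)%:R^-1 * (W1 - 3 * m%:R * b%:R ^+ 2 * (a * a)))).
exists (- (n%:R^-1 * (U2 + (3 * b)%:R^-1 * W2) - n%:R^-1 * (3 * b)%:R^-1 * (W2 - 3 * m%:R * b%:R ^+ 2 * (be * a)))).
split; first exact: L.
rewrite !ncN [leRHS]mulr_natl mulr2n; exact: lerD D1 D2.
Qed.

Lemma avg_im y : 0 <= Imc (avg false false y).
Proof.
have -> : avg false false y = (n%:R^-1)%:C%C * \sum_i Gc y (sd false i) (sd false i).
  by rewrite fmorphV rmorph_nat.
rewrite cImZ mulr_ge0 ?invr_ge0 ?ler0n // Im_sum; apply: sumr_ge0 => i _.
exact/ltW/(res_im_gt0 (hmz_herm (Xc z y)) sn s0).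
Qed.

Lemma bias g : 0 < Imc g -> g = (s + g) / ((nc z ^+ 2)%:C%C - (s + g) ^+ 2) ->
  nc (CE Q (avg false false) - g) * Num.min 1 (Imc s) <= 8 * (ERR + 96 * e2 * m%:R * h ^+ 2 / c).
Proof.
move=> g0 gE; have [e1' [e2' [L Eb]]] := loop_eqs.
have ia : citg Q (avg false false) by exact: citg_avg.
have a0 : 0 <= Imc (CE Q (avg false false)) by apply: Ex_ge0 => y; exact: avg_im.
have ah : nc (CE Q (avg false false)) <= h.
  apply: (le_trans (nc_CE ia)); rewrite -[leRHS](Ex_cst Q h).
  by apply: Ex_le; [exact: citg_nc | exact: itg_cst | move=> y; exact: avg_le].
apply: (le_trans (stability (erefl _) s0 a0 ah L g0 gE Eb)).
by rewrite mulrA -natrM.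
Qed.
End Model.

(** * Moment bound *)

Definition bias_cst (R : realType) : R := 4608 * expR 2 + 120.
Lemma bias_cst_gt0 (R : realType) : 0 < bias_cst R.
Proof. by apply: addr_gt0; [apply: mulr_gt0; [rewrite ltr0n | exact: expR_gt0] | rewrite ltr0n]. Qed.

(** The power of 3 comes from splitting the deviation into real fluctuation, imaginary fluctuation
    and bias; the term with 48 collects [bdiff_moment] for the two fluctuations and [fluct_num]; 64
    is 32 from [bias_num] doubled by separating the two summands of the bias. *)
Definition moment_cst (R : realType) (p : nat) : R :=
  3 ^+ (2 * p) * (4 * expR 2 * (2 * p)`!%:R * 48 ^+ p + (64 * bias_cst R) ^+ p).

Lemma moment_cst_gt0 (R : realType) p : 0 < moment_cst R p.
Proof.
apply: mulr_gt0; first by apply: exprn_gt0; rewrite ltr0n.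
apply: addr_gt0; last by apply: exprn_gt0; apply: mulr_gt0 (bias_cst_gt0 R); rewrite ltr0n.
apply: mulr_gt0; last by apply: exprn_gt0; rewrite ltr0n.
apply: mulr_gt0; last by rewrite ltr0n fact_gt0.
by apply: mulr_gt0 (expR_gt0 _); rewrite ltr0n.
Qed.

(** To be read with eta8 = (Im zeta)^8, x = n / c^2 and y = c^(-1/2). Only here is the power of the
    fourth moment replaced by the higher moment [wp]. *)
Lemma combine_num (R : realFieldType) (k : nat) (A w wp eta8 x y F D c1 c2 : R) :
  0 <= A -> 0 <= w -> w ^+ k <= wp -> 0 < eta8 -> 0 <= x -> 0 <= y -> 0 <= F -> 0 <= D -> 0 <= c1 -> 0 <= c2 ->
  F <= 48 * A * w / eta8 * y -> D <= 32 * c2 * A * w / eta8 * (x + y) ->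
  c1 * F ^+ k + D ^+ k <= (c1 * 48 ^+ k + (64 * c2) ^+ k) * A ^+ k * wp / eta8 ^+ k * (x ^+ k + y ^+ k).
Proof.
move=> A0 w0 wwp e0 x0 y0 F0 D0 c10 c20 hF hD.
have xk := exprn_ge0 k x0; have yk := exprn_ge0 k y0.
have ie : 0 <= eta8^-1 by rewrite invr_ge0 ltW.
have Ak := exprn_ge0 k A0; have iek := exprn_ge0 k ie.
have k48 : 0 <= 48 ^+ k :> R by rewrite exprn_ge0.
have ck := exprn_ge0 k (mulr_ge0 (ler0n R 64) c20).
have M0 : 0 <= A ^+ k * eta8^-1 ^+ k by exact: mulr_ge0.
have lF : F ^+ k <= 48 ^+ k * (A ^+ k * eta8^-1 ^+ k) * wp * (x ^+ k + y ^+ k).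
  apply: (@le_trans _ _ ((48 * A * w / eta8 * y) ^+ k)).
    by apply: lerXn2r; rewrite ?nnegrE ?(le_trans F0).
  rewrite !exprMn (_ : 48 ^+ k * A ^+ k * w ^+ k * eta8^-1 ^+ k * y ^+ k = 48 ^+ k * (A ^+ k * eta8^-1 ^+ k) * w ^+ k * y ^+ k); last by ring.
  apply: ler_pM => //.
  - by apply: mulr_ge0; [exact: mulr_ge0 | exact: exprn_ge0].
  - by apply: ler_wpM2l wwp; exact: mulr_ge0.
  - by rewrite lerDr.
have lD : D ^+ k <= (64 * c2) ^+ k * (A ^+ k * eta8^-1 ^+ k) * wp * (x ^+ k + y ^+ k).
  apply: (@le_trans _ _ ((32 * c2 * A * w / eta8 * (x + y)) ^+ k)).
    by apply: lerXn2r; rewrite ?nnegrE ?(le_trans D0).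
  rewrite exprMn; apply: (@le_trans _ _ ((32 * c2 * A * w / eta8) ^+ k * (2 ^+ k * (x ^+ k + y ^+ k)))).
    apply: ler_wpM2l; last exact: exprD2_le.
    by rewrite exprn_ge0 // !mulr_ge0.
  rewrite mulrA; apply: ler_wpM2r; first exact: addr_ge0.
  rewrite (_ : _ * 2 ^+ k = (64 * c2) ^+ k * (A ^+ k * eta8^-1 ^+ k) * w ^+ k); last first.
    by rewrite -!exprMn; congr (_ ^+ _); ring.
  by apply: ler_wpM2l wwp; exact: mulr_ge0.
apply: (le_trans (lerD (ler_wpM2l c10 lF) lD)).
by rewrite exprVn; apply: le_of_eq; ring.
Qed.

Section Model.
Context (R : realType) (n b : nat).
Hypotheses (n0 : (0 < n)%N) (b0 : (0 < b)%N) (bn : (b %| n)%N).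
Local Notation m := (n %/ b)%N.
Local Notation K := (entry_idx m b).
Local Notation kap := (kap bn).
Local Notation V := (measurableTypeR R * measurableTypeR R)%type.
Local Notation Om := (config K V).
Local Notation c := ((3 * b)%N%:R : R).
Variables (z s : R[i]).
Hypothesis s0 : 0 < Imc s.
Local Notation h := ((Imc s)^-1).
Local Notation Gc := (@Gc R n b z s).
Local Notation avg := (@avg R n b z s).
Variables (Q : probability Om R) (mu : probability V R) (iid : iid_law Q mu).
Variables w wp : R.
Hypothesis hE1 : forall k, CE Q (fun y => cplx_of (y k)) = 0.
Hypothesis hE2 : forall k, Ex Q (fun y => nc (cplx_of (y k)) ^+ 2) = 1.
Hypothesis hI4 : forall k, itg Q (fun y => nc (cplx_of (y k)) ^+ 4).
Hypothesis hE4 : forall k, Ex Q (fun y => nc (cplx_of (y k)) ^+ 4) = w.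
Let sn : Imc s != 0. Proof. exact: lt0r_neq0. Qed.
Let n_gt0 : 0 < n%:R :> R. Proof. by rewrite ltr0n. Qed.
Local Notation e2 := (expR (2 : R)).
Local Notation N := (avg false false).

Lemma esd_avg (y : Om) : Imc (s ^+ 2) != 0 ->
  esd_stieltjes (fun k => cplx_of (y k)) z (s ^+ 2) = N y / s.
Proof.
move=> s2; have s_n : s != 0 by apply: contra_neq sn => ->.
have hA : adjmx (Xc z y *m adjmx (Xc z y)) = Xc z y *m adjmx (Xc z y) by rewrite adjmxM adjmxK.
have E := eig_sum hA s2.
rewrite /esd_stieltjes /avg -mulrA; congr (_ * _).
apply: (etrans E); rewrite /mxtrace mulr_suml; apply: eq_bigr => i _.
have := hmz_gram (Xc z y) sn i i s2 => e.
by apply: (mulIf s_n); rewrite divfK // mulrC; exact: esym e.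
Qed.

Lemma fluct_moment k (f : R[i] -> R) : f = @Rec R \/ f = @Imc R ->
  Ex Q (fun y => (f (N y) - Ex Q (fun y => f (N y))) ^+ (2 * k.+1)) <=
  2 * e2 * (2 * k.+1)`!%:R * (n%:R * (2 / Imc s / n%:R) ^+ 2) ^+ k.+1.
Proof.
move=> fE; have fD x y : f (x - y) = f x - f y by case: fE => ->; rewrite ?cReD ?cReN ?cImD ?cImN.
have fn x : `|f x| <= nc x by case: fE => ->; [exact: nc_re | exact: nc_im].
have h2 : 0 < 2 / Imc s / n%:R.
  by apply: mulr_gt0; [apply: mulr_gt0; rewrite ?invr_gt0 | rewrite invr_gt0].
have [ir ii] : citg Q N by exact: citg_avg.
apply: (@bdiff_moment _ _ _ _ _ _ iid n kap (fun y => f (N y)) h (2 / Imc s / n%:R) k n0 h2).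
- by case: fE => ->; [exact: itg_meas ir | exact: itg_meas ii].
- by move=> y; exact: le_trans (fn _) (avg_le n0 z s0 _ _ y).
- move=> j y y' yy'; rewrite -fD (le_trans (fn _)) //.
  have := Gc_bdiff n0 b0 z s0 predT (@sd_inj n false) (@sd_inj n false) yy' => H.
  rewrite /avg -mulrBr ncM nc_natV mulrC ler_wpM2r ?invr_ge0 ?ler0n //.
Qed.

Lemma avg_moment k g : let d := nc (CE Q N - g) in
  itg Q (fun y => nc (N y - g) ^+ (2 * k.+1)) /\
  Ex Q (fun y => nc (N y - g) ^+ (2 * k.+1)) <=
  3 ^+ (2 * k.+1) * (4 * e2 * (2 * k.+1)`!%:R * (n%:R * (2 / Imc s / n%:R) ^+ 2) ^+ k.+1 + (d ^+ 2) ^+ k.+1).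
Proof.
move=> d; set q := (2 * k.+1)%N.
have cN : citg Q N by exact: citg_avg.
have mN := citg_meas cN.
have nb y : nc (N y) <= h := avg_le n0 z s0 _ _ y.
have ig : itg Q (fun y => nc (N y - g) ^+ q).
  apply: (itg_bounded Q (C := (h + nc g) ^+ q)) => [|y].
    by apply: measurable_funX; apply: cmeas_nc; apply: cmeasB => //; exact: cmeas_cst.
  rewrite ger0_norm ?exprn_ge0 ?nc_ge0 //; apply: lerXn2r; rewrite ?nnegrE ?nc_ge0 ?addr_ge0 ?nc_ge0 ?invr_ge0 ?(ltW s0) //.
  by rewrite (le_trans (ncB _ _)) // lerD2r.
split=> //.
pose u y := Rec (N y) - Ex Q (fun y => Rec (N y)).
pose v y := Imc (N y) - Ex Q (fun y => Imc (N y)).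
have iu (f : Om -> R) : measurable_fun setT f -> (forall y, `|f y| <= h) ->
    itg Q (fun y => (f y - Ex Q f) ^+ q).
  move=> mf fb; have fi : itg Q f := itg_bounded Q mf fb.
  apply: (itg_bounded Q (C := (h + `|Ex Q f|) ^+ q)) => [|y].
    by apply: measurable_funX; apply: measurable_funB.
  rewrite normrX; apply: lerXn2r; rewrite ?nnegrE ?normr_ge0 ?addr_ge0 ?normr_ge0 ?invr_ge0 ?(ltW s0) //.
  by rewrite (le_trans (ler_normB _ _)) // lerD2r.
have i1 : itg Q (fun y => u y ^+ q).
  by apply: iu => [|y]; [exact: mN.1 | exact: le_trans (nc_re _) (nb y)].
have i2 : itg Q (fun y => v y ^+ q).
  by apply: iu => [|y]; [exact: mN.2 | exact: le_trans (nc_im _) (nb y)].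
have pt y : nc (N y - g) ^+ q <= 3 ^+ q * (u y ^+ q + v y ^+ q + d ^+ q).
  have E : N y - g = Complex (u y) (v y) + (CE Q N - g).
    by apply: complex_ext; [rewrite !cReD !cReN /= /u; ring | rewrite !cImD !cImN /= /v; ring].
  have ev (x : R) : x ^+ q = `|x| ^+ q by rewrite /q exprM [RHS]exprM real_normK ?num_real.
  rewrite (ev (u y)) (ev (v y)).
  apply: (@le_trans _ _ ((`|u y| + `|v y| + d) ^+ q)); last by apply: exprD3_le => //; exact: nc_ge0.
  apply: lerXn2r; rewrite ?nnegrE ?nc_ge0 ?addr_ge0 ?nc_ge0 //.
  by rewrite E (le_trans (ncD _ _)) // lerD2r; exact: (nc_reim (Complex (u y) (v y))).
have isum : itg Q (fun y => u y ^+ q + v y ^+ q + d ^+ q) := itgD (itgD i1 i2) (itg_cst Q (d ^+ q)).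
apply: (le_trans (Ex_le ig (itgZ (3 ^+ q) isum) pt)).
rewrite ExZ // (ExD (itgD i1 i2) (itg_cst Q (d ^+ q))) (ExD i1 i2) Ex_cst.
rewrite ler_wpM2l ?exprn_ge0 // {2}/q exprM lerD2r.
have F1 := fluct_moment k (or_introl (erefl (@Rec R))).
have F2 := fluct_moment k (or_intror (erefl (@Imc R))).
apply: (le_trans (lerD F1 F2)).
by apply: le_of_eq; rewrite -/q; ring.
Qed.
End Model.

(** From Im zeta = 2 Re s Im s and |s|^2 = |zeta| <= A + 1 <= 2 A; this is where A enters the
    estimate. *)
Lemma spectral_scales (R : rcfType) (s zeta : R[i]) (A : R) : s ^+ 2 = zeta -> 0 < Imc s -> 1 < A ->
  - A < Rec zeta < A -> 0 < Imc zeta < 1 ->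
  Imc zeta <= 2 * nc s * Imc s /\ nc s ^+ 2 <= 2 * A.
Proof.
move=> sz s0 A1 /andP[rl rr] /andP[i0 i1]; split.
  have -> : Imc zeta = 2 * Rec s * Imc s by rewrite -sz expr2 cImM; ring.
  rewrite ler_wpM2r ?(ltW s0) //.
  by rewrite ler_wpM2l // (le_trans (ler_norm _)) // nc_re.
rewrite -ncX sz (le_trans (nc_reim _)) //.
have : `|Rec zeta| <= A by rewrite ler_norml !ltW.
by rewrite (gtr0_norm i0); lra.
Qed.

Section Model.
Context (R : realType) (n b : nat).
Hypotheses (n0 : (0 < n)%N) (b0 : (0 < b)%N) (bn : (b %| n)%N).
Local Notation m := (n %/ b)%N.
Local Notation K := (entry_idx m b).
Local Notation V := (measurableTypeR R * measurableTypeR R)%type.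
Local Notation Om := (config K V).
Local Notation c := ((3 * b)%N%:R : R).
Variables (z : R[i]).
Local Notation N s := (@avg R n b z s false false).
Variables (Q : probability Om R) (mu : probability V R) (iid : iid_law Q mu).
Variables w wp : R.
Hypothesis hE1 : forall k, CE Q (fun y => cplx_of (y k)) = 0.
Hypothesis hE2 : forall k, Ex Q (fun y => nc (cplx_of (y k)) ^+ 2) = 1.
Hypothesis hI4 : forall k, itg Q (fun y => nc (cplx_of (y k)) ^+ 4).
Hypothesis hE4 : forall k, Ex Q (fun y => nc (cplx_of (y k)) ^+ 4) = w.
Hypothesis w1 : 1 <= w.
Variables (f : R[i] -> R[i]).
Hypothesis hf : forall zeta, 0 < Imc zeta -> mz_relations z f zeta.

Lemma config_moment_bound k (A : R) (zeta : R[i]) : w ^+ k.+1 <= wp -> 1 < A -> - A < Rec zeta < A -> 0 < Imc zeta < 1 ->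
  let F := fun y : Om => nc (esd_stieltjes (fun k => cplx_of (y k)) z zeta - f zeta) ^+ (2 * k.+1) in
  itg Q F /\
  Ex Q F <= moment_cst R k.+1 * A ^+ k.+1 * wp / Imc zeta ^+ (8 * k.+1)
             * ((n%:R / c ^+ 2) ^+ k.+1 + (Num.sqrt c ^+ k.+1)^-1).
Proof.
move=> wwp A1 hr hi F; have /andP[eta0 eta1] := hi.
have [s [sz s0 _]] := csqrt_ex eta0.
have [etaS SA] := spectral_scales sz s0 A1 hr hi.
have s_n : s != 0 by apply: contraTneq s0 => ->; rewrite ltxx.
have S0 : 0 < nc s by rewrite nc_gt0.
have s2n : Imc (s ^+ 2) != 0 by rewrite sz lt0r_neq0.
pose g := s * f zeta.
have g0 : 0 < Imc g by have [_ h _] := hf s0; rewrite sz in h.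
have gE : g = (s + g) / ((nc z ^+ 2)%:C%C - (s + g) ^+ 2).
  have [h _ _] := hf eta0; rewrite -[in X in _ - _ * X]sz in h.
  exact: mz_to_g s0 g0 h.
(* m_n - m_z is (trace - g) / s, whence the negative power of |s|. *)
have FE y : (nc s ^- 2) ^+ k.+1 * nc (N s y - g) ^+ (2 * k.+1) = F y.
  have eA : esd_stieltjes (fun k => cplx_of (y k)) z zeta = N s y / s.
    by rewrite -[in LHS]sz; exact: esd_avg.
  rewrite /F eA (_ : N s y / s - f zeta = s^-1 * (N s y - g)).
    by rewrite ncM ncV [RHS]exprMn -exprVn -exprM.
  by rewrite /g mulrBr mulKf // [LHS]addrC [s^-1 * _]mulrC addrC.
have [iN hN] := avg_moment n0 b0 bn z s0 iid k g.
set d := nc _ in hN.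
split; first by apply: itg_ext (itgZ _ iN) => y; exact: FE.
rewrite -(Ex_ext Q FE) (ExZ _ iN).
set X := n%:R * _ ^+ 2 in hN; set c1 := 4 * _ * _ in hN.
set rc := Num.sqrt c.
have cE : rc ^+ 2 = c by rewrite sqr_sqrtr // ler0n.
have n_gt0 : 0 < n%:R :> R by rewrite ltr0n.
have c1R : 1 <= c by rewrite ler1n muln_gt0.
have rc1 : 1 <= rc by rewrite -sqrtr1 ler_wsqrtr.
have A1' := ltW A1; have eta1' := ltW eta1.
have cn : rc ^+ 2 <= 3 * n%:R.
  by rewrite cE natrM ler_wpM2l // ler_nat dvdn_leq.
have d0 : 0 <= d by exact: nc_ge0.
have dB := bias n0 b0 bn s0 iid hE1 hE2 hI4 hE4 g0 gE; rewrite -/d in dB.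
have mE : m%:R = 3 * n%:R / rc ^+ 2 :> R.
  rewrite cE -[n in RHS](divnK bn) !natrM.
  have b_n : b%:R != 0 :> R by rewrite pnatr_eq0 -lt0n.
  by move: (m%:R) (b%:R) b_n => M B B0; field.
rewrite -cE mE in dB.
(* The a priori bound required by [sq_le_of_split]: the expected trace and the exact solution are
   both at most 1 / Im s. *)
have d2 : d * Num.min 1 (Imc s) <= 2.
  have gh := exact_nc_leV s0 g0 gE.
  have ah : nc (CE Q (N s)) <= (Imc s)^-1.
    have ia : citg Q (N s) by exact: citg_avg.
    apply: (le_trans (nc_CE ia)); rewrite -[leRHS](Ex_cst Q (Imc s)^-1).
    by apply: Ex_le; [exact: citg_nc | exact: itg_cst | move=> y; exact: avg_le].
  have d2h : d <= 2 * (Imc s)^-1.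
    by apply: (le_trans (ncB _ _)); rewrite [leRHS]mulr_natl mulr2n; exact: lerD.
  apply: (@le_trans _ _ (2 * (Imc s)^-1 * Imc s)); last by rewrite divfK // lt0r_neq0.
  by apply: ler_pM => //; [rewrite le_min ler01 ltW | rewrite ge_min lexx orbT].
have e1 : 1 <= expR 2 :> R by rewrite -expR0 ler_expR.
have BD := bias_num S0 s0 eta0 eta1' etaS SA A1' w1 (ltW n_gt0) rc1 e1 d0 d2 dB.
have BF := fluct_num S0 s0 eta0 eta1' etaS A1' w1 n_gt0 rc1 cn.
rewrite -/(bias_cst R) in BD; rewrite -/X in BF.
have rc0 : 0 < rc by apply: lt_le_trans rc1.
have S2 : 0 < nc s ^+ 2 by exact: exprn_gt0.
have X0 : 0 <= X by rewrite mulr_ge0 ?sqr_ge0 ?ltW.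
have A0 : 0 <= A by exact: le_trans A1'.
have w0 : 0 <= w by exact: le_trans w1.
have c10 : 0 <= c1 by rewrite !mulr_ge0 // ltW // expR_gt0.
have CN := @combine_num R k.+1 A w wp (Imc zeta ^+ 8) (n%:R / (rc ^+ 2) ^+ 2) rc^-1 (X / nc s ^+ 2) (d ^+ 2 / nc s ^+ 2) c1 (bias_cst R)
  A0 w0 wwp (exprn_gt0 8 eta0) (divr_ge0 (ltW n_gt0) (sqr_ge0 _)).
have {}CN := CN _ (divr_ge0 X0 (ltW S2)) (divr_ge0 (sqr_ge0 d) (ltW S2)) c10 (ltW (bias_cst_gt0 R)) BF BD.
have {}CN := CN (ltW (_ : 0 < rc^-1)); rewrite invr_gt0 in CN; have {}CN := CN rc0.
apply: (@le_trans _ _ (3 ^+ (2 * k.+1) * (c1 * (X / nc s ^+ 2) ^+ k.+1 + (d ^+ 2 / nc s ^+ 2) ^+ k.+1))).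
  apply: (le_trans (ler_wpM2l _ hN)); first by rewrite exprn_ge0 // invr_ge0 ltW.
  by apply: le_of_eq; rewrite !exprMn; ring.
apply: (le_trans (ler_wpM2l _ CN)); first by rewrite exprn_ge0.
rewrite cE -[(Imc zeta ^+ 8) ^+ _]exprM [rc^-1 ^+ _]exprVn /moment_cst -/c1.
by apply: le_of_eq; ring.
Qed.
End Model.

(** * From the given probability space to the law of the entries *)

Section Law.
Context d d' (T : measurableType d) (S : measurableType d') (R : realType) (P : probability T R).

Lemma law_exists (f : T -> S) : measurable_fun setT f ->
  exists Q : probability S R, forall A, measurable A -> P (f @^-1` A) = Q A.
Proof.
move=> mf; pose M := isMeasurableFun.Build _ _ _ _ _ mf.
pose X : {mfun T >-> S} := HB.pack f M.
by exists (distribution P X).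
Qed.

Lemma transfer_itg_rev (Q : probability S R) (f : T -> S) (F : S -> R) : measurable_fun setT f ->
  (forall A, measurable A -> P (f @^-1` A) = Q A) ->
  measurable_fun setT F -> itg P (F \o f) -> itg Q F.
Proof.
move=> mf PQ mF hF; apply/integrableP; split; first exact/measurable_EFinP.
have /integrableP[_] := hF; apply: le_lt_trans.
have -> : (\int[Q]_x `|(EFin \o F) x| = \int[pushforward P f]_x `|(EFin \o F) x|)%E.
  apply: eq_measure_integral => A mA _; rewrite /pushforward; exact/esym/PQ.
by rewrite ge0_integral_pushforward //; apply: measurableT_comp => //; apply/measurable_EFinP.
Qed.
End Law.

Section Expectation.
Context d (T : measurableType d) (R : realType) (P : probability T R).

Lemma itg_of_expectation (F : T -> R) : measurable_fun setT F -> (forall t, 0 <= F t) ->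
  ('E_P[F] < +oo)%E -> itg P F.
Proof.
rewrite unlock => mF F0 h; apply/integrableP; split; first exact/measurable_EFinP.
apply: le_lt_trans h; rewrite le_eqVlt; apply/orP; left; apply/eqP; apply: eq_integral => x _ /=.
by rewrite ger0_norm.
Qed.

Lemma expectationE (F : T -> R) : itg P F -> ('E_P[F] = (Ex P F)%:E)%E.
Proof. by rewrite unlock; exact: Ex_fin. Qed.
End Expectation.

Section Atom.
Context (R : realType).
Local Notation V := (measurableTypeR R * measurableTypeR R)%type.

Lemma cmeas_cplx : cmeas (fun v : V => cplx_of v).
Proof. by split => /=; [exact: measurable_fst | exact: measurable_snd]. Qed.

Variables (d : measure_display) (T : measurableType d) (P : probability T R) (xi : T -> V).
Hypothesis mxi : measurable_fun setT xi.
Let u t := cplx_of (xi t).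
Lemma cmeas_xi : cmeas u.
Proof.
have [m1 m2] := cmeas_cplx.
by split; [exact: (measurableT_comp m1 mxi) | exact: (measurableT_comp m2 mxi)].
Qed.

Lemma atom_moments k : ('E_P[fun t => ((xi t).1)%R] = 0)%E -> ('E_P[fun t => ((xi t).2)%R] = 0)%E ->
  ('E_P[fun t => (nc (u t) ^+ 2)%R] = 1)%E -> ('E_P[fun t => (nc (u t) ^+ (4 * k.+1))%R] < +oo)%E ->
  [/\ citg P u, CE P u = 0, itg P (fun t => nc (u t) ^+ 2) & Ex P (fun t => nc (u t) ^+ 2) = 1] /\
  [/\ itg P (fun t => nc (u t) ^+ 4), itg P (fun t => nc (u t) ^+ (4 * k.+1)),
     1 <= Ex P (fun t => nc (u t) ^+ 4) &
     Ex P (fun t => nc (u t) ^+ 4) ^+ k.+1 <= Ex P (fun t => nc (u t) ^+ (4 * k.+1))].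
Proof.
move=> h1 h2 h3 h4.
have mu e : measurable_fun setT (fun t => nc (u t) ^+ e).
  by apply: measurable_funX; apply: cmeas_nc; exact: cmeas_xi.
have i4k : itg P (fun t => nc (u t) ^+ (4 * k.+1)).
  by apply: itg_of_expectation => // t; rewrite exprn_ge0 // nc_ge0.
have i4 : itg P (fun t => nc (u t) ^+ 4).
  apply: (itg_le (g := fun t => 1 + nc (u t) ^+ (4 * k.+1)) (mu 4)); last first.
    by apply: itgD => //; exact: itg_cst.
  move=> t; rewrite ger0_norm ?exprn_ge0 ?nc_ge0 // exprM.
  have x0 : 0 <= nc (u t) ^+ 4 by rewrite exprn_ge0 ?nc_ge0.
  have [x1|/ltW x1] := leP (nc (u t) ^+ 4) 1.
    by rewrite (le_trans x1) // lerDl exprn_ge0.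
  by rewrite (@le_trans _ _ ((nc (u t) ^+ 4) ^+ k.+1)) ?lerDr // exprS ler_peMr // exprn_ege1.
have i22 : itg P (fun t => (nc (u t) ^+ 2) ^+ 2) by apply: itg_ext i4 => t; rewrite -exprM.
have i2 : itg P (fun t => nc (u t) ^+ 2) := itg_sqr_itg (mu 2) i22.
have i1 : itg P (fun t => nc (u t)) := itg_sqr_itg (cmeas_nc cmeas_xi) i2.
have iu : citg P u := citg_le cmeas_xi (fun t => lexx _) i1.
have E2 : Ex P (fun t => nc (u t) ^+ 2) = 1.
  by apply: EFin_inj; rewrite -expectationE.
have E1 : CE P u = 0.
  have [ir ii] := iu; apply: complex_ext => /=.
    by apply: EFin_inj; rewrite -expectationE.
  by apply: EFin_inj; rewrite -expectationE.
(* Unit variance forces the fourth moment to be at least 1, which allows terms with different powers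
   of it to be merged. *)
have w1 : 1 <= Ex P (fun t => nc (u t) ^+ 4).
  have := Ex_sq_le i2 i22; rewrite E2 expr1n => /le_trans; apply.
  by apply: le_of_eq; apply: Ex_ext => t; rewrite -exprM.
do !split => //.
set w := Ex P _ in w1 *; have w0 : 0 <= w by exact: le_trans w1.
(* Jensen's inequality through the tangent at the mean, whose linear part integrates to 0. *)
have -> : w ^+ k.+1 = Ex P (fun t => w ^+ k.+1 + k.+1%:R * w ^+ k * (nc (u t) ^+ 4 - w)).
  rewrite ExD; [|exact: itg_cst|by apply: itgZ; apply: itgB => //; exact: itg_cst].
  rewrite ExZ; last by apply: itgB => //; exact: itg_cst.
  by rewrite ExB ?Ex_cst //; [rewrite subrr mulr0 addr0|exact: itg_cst].
apply: Ex_le => //.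
  by apply: itgD; [exact: itg_cst|apply: itgZ; apply: itgB => //; exact: itg_cst].
by move=> t; rewrite exprM; apply: expr_tangent => //; rewrite exprn_ge0 // nc_ge0.
Qed.
End Atom.

Theorem theorem3p1 (R : realType) (p : nat) (hp : (1 <= p)%N) :
  exists Cp : R, 0 < Cp /\
  forall z : R[i], exists nu : probability R R,
    nu [set x : R | 0 <= x] = 1%E /\
    (forall zeta : R[i], 0 < complex.Im zeta -> mz_relations z (stieltjes nu) zeta) /\
    (forall f : R[i] -> R[i],
        (forall zeta : R[i], 0 < complex.Im zeta -> mz_relations z f zeta) ->
        forall zeta : R[i], 0 < complex.Im zeta -> f zeta = stieltjes nu zeta) /\
    forall (A : R) (d : measure_display) (T : measurableType d) (P : probability T R)
      (n b : nat) (xi : T -> R * R) (Y : entry_idx (n %/ b) b -> T -> R * R),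
      1 < A -> (0 < n)%N -> (0 < b)%N -> (b %| n)%N ->
      measurable_fun setT xi -> (forall k, measurable_fun setT (Y k)) ->
      mutually_independent P Y -> (forall k, same_law P (Y k) xi) ->
      ('E_P[fun t => ((xi t).1)%R] = 0)%E ->
      ('E_P[fun t => ((xi t).2)%R] = 0)%E ->
      ('E_P[fun t => (Normc.normc (cplx_of (xi t)) ^+ 2)%R] = 1)%E ->
      ('E_P[fun t => (Normc.normc (cplx_of (xi t)) ^+ (4 * p))%R] < +oo)%E ->
      let omega := fine ('E_P[fun t => (Normc.normc (cplx_of (xi t)) ^+ (4 * p))%R])%E in
      let c := (3 * b)%N in
      forall zeta : R[i], - A < complex.Re zeta < A -> 0 < complex.Im zeta < 1 ->
        ('E_P[fun t => (Normc.normc (esd_stieltjes (fun k => cplx_of (Y k t)) z zeta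
                              - stieltjes nu zeta) ^+ (2 * p))%R]
         <= (Cp * A ^+ p * omega / complex.Im zeta ^+ (8 * p)
             * ((n%:R / c%:R ^+ 2) ^+ p + (Num.sqrt c%:R ^+ p)^-1))%:E)%E.
Proof.
case: p hp => // k _; exists (moment_cst R k.+1); split; first exact: moment_cst_gt0.
move=> z; have [nu [nu1 nuE]] := limit_law_exists z; exists nu; split => //; split => //.
split; first by move=> f fE; exact: limit_law_unique fE nuE.
move=> A d T P n b xi Y A1 n0 b0 bn mxi mY ind same h1 h2 h3 h4 omega c zeta hr hi.
have [[iu E1 i2 E2] [i4 i4k w1 wk]] := atom_moments mxi h1 h2 h3 h4.
have omE : omega = Ex P (fun t => nc (cplx_of (xi t)) ^+ (4 * k.+1)).
  by rewrite /omega expectationE.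
pose V := (measurableTypeR R * measurableTypeR R)%type.
have mxi' : measurable_fun setT (xi : T -> V) := mxi.
have mY' j : measurable_fun setT (Y j : T -> V) := mY j.
(* [mu] is the law of one entry and [Q], below, the joint law of all entries; independence and
   equality of laws make [Q] a product of copies of [mu]. *)
have [mu muE] := law_exists P mxi'.
have mYv : measurable_fun setT (fun t => (fun j => Y j t) : config _ V).
  exact: measurable_config.
have [Q QE] := law_exists P mYv.
have iid : iid_law Q mu.
  move=> B mB; rewrite -QE; last exact: measurable_rect.
  transitivity (P (\bigcap_j (Y j @^-1` B j))).
    by congr (P _); apply/seteqP; split => t /= h j; [move=> _; exact: h | exact: h].
  rewrite ind //; apply: eq_bigr => j _.
  exact: etrans (same j _ (mB j)) (muE _ (mB j)).
have lawQ (j : entry_idx (n %/ b) b) A0 : measurable A0 -> Q ((fun y : config _ V => y j) @^-1` A0) = mu A0.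
  move=> mA; rewrite -QE; last by rewrite -[X in measurable X]setTI; exact: measurable_coord.
  exact: etrans (same j _ mA) (muE _ mA).
have mc := @cmeas_cplx R.
have mcn e : measurable_fun setT (fun v : V => nc (cplx_of v) ^+ e).
  by apply: measurable_funX; exact: cmeas_nc.
have toQ (F : V -> R) : measurable_fun setT F -> itg P (F \o xi) -> forall j,
    itg Q (fun y => F (y j)) /\ Ex Q (fun y => F (y j)) = Ex P (F \o xi).
  move=> mF iF j; have iF' := transfer_itg_rev mxi' muE mF iF.
  split; first exact: (transfer_itg (measurable_coord j) (lawQ j) iF').
  rewrite (transfer_Ex mxi' muE iF').
  exact: (transfer_Ex (measurable_coord j) (lawQ j) iF').
have hE1 j : CE Q (fun y => cplx_of (y j)) = 0.
  rewrite -E1; have [ir ii] := iu.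
  by apply: complex_ext; [have [] := toQ _ mc.1 ir j | have [] := toQ _ mc.2 ii j].
have hE2 j : Ex Q (fun y => nc (cplx_of (y j)) ^+ 2) = 1.
  by rewrite -E2; have [] := toQ _ (mcn 2) i2 j.
have hI4 j : itg Q (fun y => nc (cplx_of (y j)) ^+ 4) by have [] := toQ _ (mcn 4) i4 j.
have hE4 j : Ex Q (fun y => nc (cplx_of (y j)) ^+ 4) = Ex P (fun t => nc (cplx_of (xi t)) ^+ 4).
  by have [] := toQ _ (mcn 4) i4 j.
have [iF bF] := config_moment_bound n0 b0 bn iid hE1 hE2 hI4 hE4 w1 nuE wk A1 hr hi.
have iFP := transfer_itg mYv QE iF.
rewrite (expectationE iFP) lee_fin (transfer_Ex mYv QE iF) omE.
exact: bF.
Qed.
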